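(* Assume $\operatorname{rank}(M_{(3)})=\operatorname{rank}\begin{bmatrix}M_{(3)} \\ V_{(3)}\end{bmatrix}=n_w$, and that the data are independent samples $(x_{i+1},z_i)_{i=1}^N$ with $x_{i+1}=M(z_i)w_i$, where the $z_i$ are i.i.d. copies of a random vector $z$ whose distribution is dominated by the Lebesgue measure and $\|z_i\|_2$ is bounded almost surely. Let $H=\operatorname{blkdiag}(Q,R)\succ0$ and let $\overline K$ be the optimal distributionally robust controller, under its defining hypothesis that there exists $K$ with $\rho(\mathcal E_K(W;\cdot))<1$ for all symmetric $W$ with $\underline W\preceq W\preceq\overline W$. Then, for sufficiently many samples $N$ and with probability at least $1-\delta$, $$\operatorname{tr}\Big[\sum_{t=0}^\infty Z_tH\Big]-\mathrm{Val}(\mathrm{LQRcp})=\mathcal O\Big(\frac1N\Big),$$ where the first term is the cost of (LQRcp) achieved for $Z_t=\Pi_{\overline K}(X_t)$ with true moment dynamics $X_{t+1}=\mathcal E_\star(Z_t)$. Moreover, for sufficiently many samples $N$ and with probability at least $1-\delta$, $$\mathbb E\Big[\sum_{t=0}^\infty x_t^\top Qx_t+u_t^\top Ru_t\Big]-\mathrm{Val}(\mathrm{SLQR})=\mathcal O\Big(\frac1N\Big),$$ where $x_{t+1}=A(v_t)x_t+B(v_t)u_t$ and $u_t=\overline Kx_t$, so the first term is the cost achieved when applying $\overline K$ to the true multiplicative noise dynamics.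
   Context: Dynamics: $x_{t+1}=A(v_t)x_t+B(v_t)u_t$, $x_t\in\mathbb R^{n_x}$, $u_t\in\mathbb R^{n_u}$, $n_z=n_x+n_u$, $(v_t)$ i.i.d. in $\mathbb R^{n_v}$, $A(v)=\sum_i[v]_i\tilde A_i$, $B(v)=\sum_i[v]_i\tilde B_i$. Model matrices $M_k=[A_k,B_k]\in\mathbb R^{n_x\times n_z}$, $k=1,\dots,n_w$; $M_{(3)}$ has rows $\operatorname{vec}(M_k)^\top$, $V_{(3)}$ has rows $\operatorname{vec}([\tilde A_i,\tilde B_i])^\top$. Disturbance $w=(M_{(3)}^\top)^\dagger V_{(3)}^\top v$ with $\|w\|_2\le r_w$; $w_1,\dots,w_N$ is the noise sequence of i.i.d. copies of $w$. $M(z)=[M_1z,\dots,M_{n_w}z]$. $\delta\in(0,1)$ is a confidence parameter; $\preceq$ is the positive semidefinite order; $\dagger$ is the pseudo-inverse. For symmetric $W,Z$: $\mathcal E(W;Z)=\sum_{k,l}[W]_{kl}M_kZM_l^\top$; $\mathcal E_\star=\mathcal E(W_\star;\cdot)$ with $W_\star=\mathbb E[ww^\top]$. $\Pi_K(X)=\begin{bmatrix}I \\ K\end{bmatrix}X\begin{bmatrix}I & K^\top\end{bmatrix}$, $\mathcal E_K(W;X)=\mathcal E(W;\Pi_K(X))$; $\rho$ is the spectral radius of a linear map on symmetric matrices. $\mathcal F^*(W;P)=\sum_{k,l}[W]_{kl}A_k^\top PA_l$, $\mathcal G^*(W;P)=\sum_{k,l}[W]_{kl}B_k^\top PB_l$,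 $\mathcal H^*(W;P)=\sum_{k,l}[W]_{kl}B_k^\top PA_l$, $\mathcal R(W;P)=Q+\mathcal F^*(W;P)-\mathcal H^*(W;P)^\top(R+\mathcal G^*(W;P))^{-1}\mathcal H^*(W;P)$. Controller: $\overline K=-(R+\mathcal G^*(\overline W;\overline P))^{-1}\mathcal H^*(\overline W;\overline P)$ with $\overline P\succ0$ the solution of $\overline P=\mathcal R(\overline W;\overline P)$, $\underline W=\hat W-\beta_WI_{n_w}$, $\overline W=\hat W+\beta_WI_{n_w}$, $\beta_W=r_w^2\zeta_W\sqrt{2\log(2n_w/\delta)}$. Estimation: $\operatorname{svec}(X)\in\mathbb R^{d(d+1)/2}$ stacks the lower triangle of symmetric $X\in\mathbb R^{d\times d}$ column by column, off-diagonals multiplied by $\sqrt2$; $Q_d$ satisfies $Q_dQ_d^\top=I$, $Q_d\operatorname{vec}(X)=\operatorname{svec}(X)$, $Q_d^\top\operatorname{svec}(X)=\operatorname{vec}(X)$ for symmetric $X$; $U\otimes_sU=Q_m(U\otimes U)Q_n^\top$ for $U\in\mathbb R^{m\times n}$. $Y_N$ stacks $\operatorname{svec}(x_{i+1}x_{i+1}^\top)$, $\mathbf Z_N$ stacks $M(z_i)\otimes_sM(z_i)$, $i=1,\dots,N$; $\operatorname{svec}(\hat W)=\mathbf Z_N^\dagger Y_N$. $\mathbf W_i=(M(z_i)\otimes_sM(z_i))^\top(M(z_i)\otimes_sM(z_i))$, $\mathbf H_i=[\sum_j\mathbf W_j]^\dagger\mathbf W_i$, $\operatorname{svec}(\mathcal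 H_i(X))=\mathbf H_i\operatorname{svec}(X)$, $\|\mathcal H_i\|_2=\max\{\|\mathcal H_i(X)\|_2:X=X^\top,\|X\|_2\le1\}$, $\zeta_W^2=\sum_i\|\mathcal H_i\|_2^2$. Problems, for given $x_0$ with $X_0=\mathbb E[x_0x_0^\top]$: (SLQR) minimize $\mathbb E[\sum_{t\ge0}x_t^\top Qx_t+u_t^\top Ru_t]$ over (causal, possibly randomized) inputs $u_0,u_1,\dots$ subject to the dynamics. (LQRcp) minimize $\sum_{t\ge0}\operatorname{tr}[Z_tH]$ over $Z_t\succeq0$ with upper-left $n_x\times n_x$ block $X_t$ and $X_{t+1}=\mathcal E_\star(Z_t)$. $\mathrm{Val}$ denotes the optimal value. The $\mathcal O(1/N)$ is as $N\to\infty$, with a constant not depending on $N$. *)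

(* Defs.v *)
From HB Require Import structures.
From mathcomp Require Import all_boot all_order all_algebra.
From mathcomp Require Import all_classical all_reals all_analysis.
From mathcomp Require Import complex mxtens zify.

Set Implicit Arguments.
Unset Strict Implicit.
Unset Printing Implicit Defensive.

Import Order.TTheory GRing.Theory Num.Theory.
Import numFieldNormedType.Exports.

Local Open Scope classical_set_scope.
Local Open Scope ring_scope.

Section LinearAlgebra.
Context {R : realType}.

Definition symmx n (A : 'M[R]_n) : Prop := A^T = A.

Definition psdmx n (A : 'M[R]_n) : Prop :=
  symmx A /\ forall x : 'cV[R]_n, 0 <= (x^T *m A *m x) 0 0.

Definition pdmx n (A : 'M[R]_n) : Prop :=
  symmx A /\ forall x : 'cV[R]_n, x != 0 -> 0 < (x^T *m A *m x) 0 0.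

Definition lemx n (A B : 'M[R]_n) : Prop := psdmx (B - A).

Definition norm2 n (x : 'cV[R]_n) : R := Num.sqrt (\sum_i x i 0 ^+ 2).

Definition opnorm2 m n (A : 'M[R]_(m, n)) : R :=
  sup [set norm2 (A *m x) | x in [set x : 'cV[R]_n | norm2 x <= 1]].

(* Moore-Penrose pseudo-inverse, characterized by the four Penrose equations;
   the library's pinvmx is only a one-sided inverse.  mpinvP below shows that
   the default value of xget is never used. *)
Definition is_mpinv m n (A : 'M[R]_(m, n)) (X : 'M[R]_(n, m)) : Prop :=
  [/\ A *m X *m A = A, X *m A *m X = X,
      (A *m X)^T = A *m X & (X *m A)^T = X *m A].

Definition mpinv m n (A : 'M[R]_(m, n)) : 'M[R]_(n, m) :=
  xget 0 [set X | is_mpinv A X].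

(* Column-stacking vectorization: entry j * m + i is X i j, the index
   convention of the Kronecker product *t. *)
Definition vec m n (X : 'M[R]_(m, n)) : 'cV[R]_(n * m) :=
  \col_p X (mxtens_unindex p).2 (mxtens_unindex p).1.

(* Positions (i, j), j <= i, of the lower triangle, column by column. *)
Definition lowtri d : seq ('I_d * 'I_d) :=
  [seq (i, j) | j : 'I_d <- enum 'I_d,
                i : 'I_d <- [seq i : 'I_d <- enum 'I_d | (j <= i)%N]].

(* Equal to d (d + 1) / 2, see sdimE. *)
Definition sdim d : nat := size (lowtri d).

Definition lowpos d (p : 'I_(sdim d)) : 'I_d * 'I_d :=
  tnth (in_tuple (lowtri d)) p.

Definition svec d (X : 'M[R]_d) : 'cV[R]_(sdim d) :=
  \col_p (let: (i, j) := lowpos p in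
          if i == j then X i j else Num.sqrt 2 * X i j).

Definition sbasis d (p : 'I_(sdim d)) : 'M[R]_d :=
  let: (i, j) := lowpos p in
  if i == j then delta_mx i j
  else (Num.sqrt 2)^-1 *: (delta_mx i j + delta_mx j i).

(* The inverse of svec, with values in the symmetric matrices. *)
Definition smat d (s : 'cV[R]_(sdim d)) : 'M[R]_d :=
  \sum_p s p 0 *: sbasis p.

(* The matrix Q_d; its defining properties are Qsym_orth, Qsym_vec and
   Qsym_svec. *)
Definition Qsym d : 'M[R]_(sdim d, d * d) := \matrix_p (vec (sbasis p))^T.

Definition skron m n (U : 'M[R]_(m, n)) : 'M[R]_(sdim m, sdim n) :=
  Qsym m *m (U *t U) *m (Qsym n)^T.

(* Spectral radius of a linear map L on real symmetric matrices: largest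
   modulus of an eigenvalue of its complexification
   X + iY |-> L X + i (L Y), acting on complex symmetric matrices. *)
Definition complexify n (L : 'M[R]_n -> 'M[R]_n) (X : 'M[R[i]]_n) :
    'M[R[i]]_n :=
  map_mx (real_complex R) (L (map_mx (@complex.Re R) X))
  + 'i%C *: map_mx (real_complex R) (L (map_mx (@complex.Im R) X)).

Definition sym_eigenvalue n (L : 'M[R]_n -> 'M[R]_n) (l : R[i]) : Prop :=
  exists X : 'M[R[i]]_n, [/\ X != 0, X^T = X & complexify L X = l *: X].

Definition spectral_radius n (L : 'M[R]_n -> 'M[R]_n) : R :=
  sup [set ComplexField.Normc.normc l | l in [set l | sym_eigenvalue L l]].

End LinearAlgebra.

Section LinearAlgebraFacts.
Context {R : realType}.

Lemma trmx_mul_eq0 n (x : 'cV[R]_n) : x^T *m x = 0 -> x = 0.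
Proof.
move=> /matrixP/(_ 0 0); rewrite !mxE => h.
apply/colP => i; rewrite mxE; apply/eqP; rewrite -[_ == _]orbb -mulf_eq0.
suff /(_ i isT) /eqP : forall i, predT i -> x^T 0 i * x i 0 = 0 by rewrite mxE.
by apply: psumr_eq0P h => k _; rewrite mxE -expr2 sqr_ge0.
Qed.

Lemma gram_unit m n (C : 'M[R]_(m, n)) :
  row_free C -> C *m C^T \in unitmx.
Proof.
move=> rC; rewrite -row_free_unit -kermx_eq0; apply/eqP/row_matrixP => i.
rewrite row0; set u := row i _.
have uk : u *m (C *m C^T) = 0 by apply/sub_kermxP; rewrite row_sub.
have : (u *m C)^T = 0.
  by apply: trmx_mul_eq0; rewrite trmxK trmx_mul mulmxA -(mulmxA u) uk mul0mx.
move=> /(congr1 trmx); rewrite trmxK trmx0 -(mul0mx _ C) => /(row_free_inj rC).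
by [].
Qed.

Lemma mpinv_uniq m n (A : 'M[R]_(m, n)) X Y :
  is_mpinv A X -> is_mpinv A Y -> X = Y.
Proof.
move=> [a1 a2 a3 a4] [b1 b2 b3 b4].
have e1 : A *m X = A *m Y.
  rewrite -a3 -[in LHS]b1 -(mulmxA (A *m Y)) trmx_mul a3 b3.
  by rewrite mulmxA a1.
have e2 : X *m A = Y *m A.
  rewrite -a4 -[in LHS]b1 -(mulmxA A) mulmxA trmx_mul a4 b4.
  by rewrite -mulmxA (mulmxA A) a1.
by rewrite -a2 e2 -mulmxA e1 mulmxA b2.
Qed.

Lemma full_rank_mpinv m n r (C : 'M[R]_(m, r)) (B : 'M[R]_(r, n)) :
    C^T *m C \in unitmx -> B *m B^T \in unitmx ->
  is_mpinv (C *m B)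
    (B^T *m invmx (B *m B^T) *m (invmx (C^T *m C) *m C^T)).
Proof.
move=> uC uB; set X := (X in is_mpinv _ X).
have AX : C *m B *m X = C *m invmx (C^T *m C) *m C^T.
  by rewrite /X !mulmxA -(mulmxA C B) mulmxK.
have XA : X *m (C *m B) = B^T *m invmx (B *m B^T) *m B.
  by rewrite /X !mulmxA -(mulmxA _ C^T C) mulmxKV.
split.
- by rewrite AX !mulmxA -(mulmxA _ C^T C) mulmxKV.
- by rewrite XA /X !mulmxA -(mulmxA _ B B^T) mulmxKV.
- by rewrite AX !trmx_mul trmxK trmx_inv trmx_mul trmxK mulmxA.
- by rewrite XA !trmx_mul trmxK trmx_inv trmx_mul trmxK mulmxA.
Qed.

Lemma mpinvP m n (A : 'M[R]_(m, n)) : is_mpinv A (mpinv A).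
Proof.
rewrite /mpinv; case: xgetP => [X _ //|] h.
have := @full_rank_mpinv m n _ (col_base A) (row_base A).
rewrite mulmx_base => H; case: (h _ (H _ _)).
  rewrite -[X in _ *m X]trmxK; apply: gram_unit.
  by rewrite /row_free mxrank_tr -/(row_full _); exact: col_base_full.
by apply: gram_unit; exact: row_base_free.
Qed.

Lemma lowtri_uniq d : uniq (lowtri d).
Proof.
apply: allpairs_uniq_dep; first exact: enum_uniq.
  by move=> j _; rewrite filter_uniq // enum_uniq.
by move=> [j i] [j' i'] _ _ /= [-> ->].
Qed.

Lemma mem_lowtri d (i j : 'I_d) : ((i, j) \in lowtri d) = (j <= i)%N.
Proof.
apply/allpairsPdep/idP => [[j' [i' [_]]]|ji].
  by rewrite mem_filter => /andP[h _] [-> ->].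
by exists j, i; split; [exact: mem_enum|rewrite mem_filter ji; exact: mem_enum|].
Qed.

Lemma sdimE d : sdim d = (d * d.+1)./2.
Proof.
rewrite /sdim size_allpairs_dep.
have -> : [seq size [seq i : 'I_d <- enum 'I_d | (j <= i)%N] | j : 'I_d <- enum 'I_d]
   = [seq (d - j)%N | j <- iota 0 d].
  rewrite -val_enum_ord -map_comp; apply: eq_map => j /=.
  rewrite size_filter -(count_map val (fun i => (j <= i)%N)) val_enum_ord.
  move: (nat_of_ord j) (ltnW (ltn_ord j)) => {}j jd.
  rewrite -{1}(subnKC jd) iotaD count_cat add0n.
  rewrite (_ : count _ (iota 0 j) = 0%N); last first.
    apply/eqP; rewrite -leqn0 leqNgt -has_count; apply/hasPn => k.
    by rewrite mem_iota /= add0n -ltnNge.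
  rewrite add0n -[RHS](size_iota j).
  by apply/eqP; rewrite -(all_count (leq j)); apply/allP => k; rewrite mem_iota => /andP[].
rewrite sumnE big_map.
have : (\sum_(j <- iota 0 d) (d - j) = \sum_(0 <= j < d) j.+1)%N.
  by rewrite big_nat_rev /= /index_iota subn0 !big_seq; apply: eq_bigr => j;
     rewrite mem_iota /=; lia.
move=> ->; elim: d => [|d IH]; first by rewrite big_nil.
by rewrite big_nat_recr //= IH; lia.
Qed.

Definition low_idx d (i j : 'I_d) (h : (j <= i)%N) : {p | lowpos p = (i, j)}.
Proof.
have hm : (i, j) \in lowtri d by rewrite mem_lowtri.
have hi : (index (i, j) (lowtri d) < sdim d)%N by rewrite index_mem.
by exists (Ordinal hi); rewrite /lowpos (tnth_nth (i, j)) /= nth_index.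
Defined.

Lemma lowpos_inj d : injective (@lowpos d).
Proof.
move=> p q; rewrite /lowpos (tnth_nth (lowpos p)) (tnth_nth (lowpos p) _ q) /=.
by move/eqP; rewrite nth_uniq ?lowtri_uniq // => /eqP/val_inj.
Qed.

Lemma lowpos_le d (p : 'I_(sdim d)) : ((lowpos p).2 <= (lowpos p).1)%N.
Proof. by rewrite -mem_lowtri -surjective_pairing mem_tnth. Qed.

Lemma sqrt2_neq0 : Num.sqrt 2 != 0 :> R.
Proof. by rewrite sqrtr_eq0 -ltNge. Qed.

Lemma sbasisE d (p q : 'I_(sdim d)) :
  @sbasis R d q (lowpos p).1 (lowpos p).2 =
  (p == q)%:R * (if (lowpos p).1 == (lowpos p).2 then 1 else (Num.sqrt 2)^-1).
Proof.
rewrite -(inj_eq (@lowpos_inj d)) /sbasis.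
have := lowpos_le p; have := lowpos_le q.
case: (lowpos p) => a b; case: (lowpos q) => i j /= ji ba.
rewrite xpair_eqE.
have [<-|nij] := eqVneq i j; rewrite !mxE.
  by have [<-|_] := eqVneq a i; rewrite ?mul0r //=; have [_|_] := eqVneq b a;
    rewrite ?mulr1 ?mul0r.
have [ai|nai] /= := eqVneq a i; last first.
  rewrite mul0r add0r; have [aj|naj] /= := eqVneq a j; last by rewrite mulr0.
  have [bi|_] /= := eqVneq b i; last by rewrite mulr0.
  by move: nij; rewrite -val_eqE eqn_leq ji andbT -bi -aj ba.
rewrite {a}ai in ba *; rewrite (negbTE nij) addr0.
by have [->|_] /= := eqVneq b j; rewrite ?(negbTE nij) ?mulr1 ?mul1r ?mul0r ?mulr0.
Qed.

Lemma smatE d (s : 'cV[R]_(sdim d)) p :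
  smat s (lowpos p).1 (lowpos p).2 =
  s p 0 * (if (lowpos p).1 == (lowpos p).2 then 1 else (Num.sqrt 2)^-1).
Proof.
rewrite summxE (bigD1 p) //= big1 => [|q qp]; rewrite mxE sbasisE.
  by rewrite eqxx mul1r addr0.
by rewrite eq_sym (negbTE qp) mul0r mulr0.
Qed.

Lemma svec_smat d (s : 'cV[R]_(sdim d)) : svec (smat s) = s.
Proof.
apply/colP => p; rewrite mxE; have := smatE s p.
case: (lowpos p) => i j /= ->; have [_|_] := eqVneq i j; rewrite ?mulr1 //.
by rewrite mulrCA mulfV ?mulr1 // sqrt2_neq0.
Qed.

Lemma sbasis_sym d (p : 'I_(sdim d)) : symmx (@sbasis R d p).
Proof.
rewrite /symmx /sbasis; case: (lowpos p) => i j.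
have [->|_] := eqVneq i j; first by rewrite trmx_delta.
by rewrite linearZ linearD /= !trmx_delta addrC.
Qed.

Lemma smat_sym d (s : 'cV[R]_(sdim d)) : symmx (smat s).
Proof.
rewrite /symmx /smat linear_sum /=; apply: eq_bigr => p _.
by rewrite linearZ /= sbasis_sym.
Qed.

Lemma smat_svec d (X : 'M[R]_d) : symmx X -> smat (svec X) = X.
Proof.
move=> sX.
have main (i j : 'I_d) : (j <= i)%N -> smat (svec X) i j = X i j.
  move=> ji; have [p hp] := low_idx ji.
  have := smatE (svec X) p; rewrite mxE hp /= => ->.
  have [_|_] := eqVneq i j; rewrite ?mulr1 //.
  by rewrite mulrAC mulfV ?mul1r // sqrt2_neq0.
have tE (Y : 'M[R]_d) i j : symmx Y -> Y i j = Y j i.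
  by move=> sY; rewrite -[in LHS]sY mxE.
apply/matrixP => i j; case: (leqP j i) => [|/ltnW] ij; first exact: main.
by rewrite (tE _ _ _ (smat_sym _)) (tE _ _ _ sX) main.
Qed.

Lemma Qsym_smat d (s : 'cV[R]_(sdim d)) : (Qsym d)^T *m s = vec (smat s).
Proof.
apply/colP => q; rewrite !mxE summxE; apply: eq_bigr => p _.
by rewrite !mxE mulrC.
Qed.

Lemma Qsym_svec d (X : 'M[R]_d) :
  symmx X -> (Qsym d)^T *m svec X = vec X.
Proof. by move=> sX; rewrite Qsym_smat smat_svec. Qed.

Lemma Qsym_vec d (X : 'M[R]_d) : symmx X -> Qsym d *m vec X = svec X.
Proof.
move=> sX; apply/colP => p; rewrite !mxE.
rewrite (reindex (fun ij : 'I_d * 'I_d => mxtens_index ij)) /=; last first.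
  by exists (@mxtens_unindex _ _) => k _; rewrite ?mxtens_indexK ?mxtens_unindexK.
under eq_bigr => ij _.
  rewrite ?mxE mxtens_indexK; over.
rewrite -(pair_bigA _ (fun b a => sbasis p a b * X a b)) /=.
have dE (a b : 'I_d) : \sum_j \sum_i @delta_mx R _ _ a b i j * X i j = X a b.
  rewrite (bigD1 b) //= (bigD1 a) //= !mxE !eqxx mul1r !big1 ?addr0 //.
    by move=> j jb; rewrite big1 // => i _; rewrite mxE (negbTE jb) andbF mul0r.
  by move=> i ia; rewrite mxE (negbTE ia) mul0r.
rewrite /sbasis; case: (lowpos p) => i j.
have [<-|_] := eqVneq i j; first exact: dE.
under eq_bigr => b _.
  under eq_bigr => a _ do rewrite mxE -mulrA mxE mulrDl.
  rewrite -mulr_sumr big_split /=; over.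
rewrite -mulr_sumr big_split /= !dE.
have -> : X j i = X i j by rewrite -[in LHS]sX mxE.
apply: (mulfI sqrt2_neq0); rewrite mulrA mulfV ?sqrt2_neq0 // mul1r mulrA.
by rewrite -expr2 sqr_sqrtr // mulr_natl mulr2n.
Qed.

Lemma Qsym_orth d : Qsym d *m (Qsym d)^T = 1%:M :> 'M[R]_(sdim d).
Proof.
have H (s : 'cV[R]_(sdim d)) : Qsym d *m (Qsym d)^T *m s = 1%:M *m s.
  by rewrite mul1mx -mulmxA Qsym_smat Qsym_vec ?svec_smat //; exact: smat_sym.
apply/matrixP => i j; have /colP/(_ i) := H (delta_mx j 0).
by rewrite -!colE !mxE.
Qed.

Lemma tens_vec m n (U : 'M[R]_(m, n)) (X : 'M[R]_n) :
  (U *t U) *m vec X = vec (U *m X *m U^T).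
Proof.
apply/colP => p; rewrite mxE [RHS]mxE -[in LHS](mxtens_unindexK p).
case: (mxtens_unindex p) => a b.
rewrite (reindex (fun ij : 'I_n * 'I_n => mxtens_index ij)) /=; last first.
  by exists (@mxtens_unindex _ _) => k _; rewrite ?mxtens_indexK ?mxtens_unindexK.
rewrite (eq_bigr (fun ij : 'I_n * 'I_n => U a ij.1 * U b ij.2 * X ij.2 ij.1));
  last by case=> i j _; rewrite tensmxE mxE mxtens_indexK.
rewrite -(pair_bigA _ (fun i j => U a i * U b j * X j i)) /= mxE.
apply: eq_bigr => i _; rewrite !mxE mulr_suml; apply: eq_bigr => j _.
by rewrite -mulrA mulrC.
Qed.

Lemma skron_svec m n (U : 'M[R]_(m, n)) (X : 'M[R]_n) :
  symmx X -> skron U *m svec X = svec (U *m X *m U^T).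
Proof.
move=> sX; rewrite /skron -mulmxA Qsym_svec // -mulmxA tens_vec Qsym_vec //.
by rewrite /symmx !trmx_mul trmxK sX mulmxA.
Qed.
End LinearAlgebraFacts.

Section Model.
Context {R : realType}.
Variables (nx nu nw : nat).
Variable M : 'I_nw -> 'M[R]_(nx, nx + nu).

Definition modA (k : 'I_nw) : 'M[R]_nx := lsubmx (M k).
Definition modB (k : 'I_nw) : 'M[R]_(nx, nu) := rsubmx (M k).

(* Mode-3 unfolding: row k is vec (M k) transposed. *)
Definition unfold3 : 'M[R]_(nw, (nx + nu) * nx) := \matrix_k (vec (M k))^T.

(* M(z) = [M_1 z, ..., M_nw z] *)
Definition model_at (z : 'cV[R]_(nx + nu)) : 'M[R]_(nx, nw) :=
  \matrix_(a, k) (M k *m z) a 0.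

Definition momE (W : 'M[R]_nw) (Z : 'M[R]_(nx + nu)) : 'M[R]_nx :=
  \sum_k \sum_l W k l *: (M k *m Z *m (M l)^T).

Definition liftK (K : 'M[R]_(nu, nx)) (X : 'M[R]_nx) : 'M[R]_(nx + nu) :=
  col_mx 1%:M K *m X *m row_mx 1%:M K^T.

Definition momEK (K : 'M[R]_(nu, nx)) (W : 'M[R]_nw) (X : 'M[R]_nx) :
  'M[R]_nx := momE W (liftK K X).

Definition adjF (W : 'M[R]_nw) (P : 'M[R]_nx) : 'M[R]_nx :=
  \sum_k \sum_l W k l *: ((modA k)^T *m P *m modA l).
Definition adjG (W : 'M[R]_nw) (P : 'M[R]_nx) : 'M[R]_nu :=
  \sum_k \sum_l W k l *: ((modB k)^T *m P *m modB l).
Definition adjH (W : 'M[R]_nw) (P : 'M[R]_nx) : 'M[R]_(nu, nx) :=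
  \sum_k \sum_l W k l *: ((modB k)^T *m P *m modA l).

Variables (Qx : 'M[R]_nx) (Ru : 'M[R]_nu).

Definition riccati (W : 'M[R]_nw) (P : 'M[R]_nx) : 'M[R]_nx :=
  Qx + adjF W P
  - (adjH W P)^T *m invmx (Ru + adjG W P) *m adjH W P.

Definition dr_stabilizable (Wlo Wup : 'M[R]_nw) : Prop :=
  exists K : 'M[R]_(nu, nx), forall W : 'M[R]_nw,
    symmx W -> lemx Wlo W -> lemx W Wup -> spectral_radius (momEK K W) < 1.

Definition is_dr_controller (Wup : 'M[R]_nw) (K : 'M[R]_(nu, nx)) : Prop :=
  exists P : 'M[R]_nx, [/\ pdmx P, P = riccati Wup P &
    K = - (invmx (Ru + adjG Wup P) *m adjH Wup P)].

(* Least-squares estimate from the N samples (xs i, zs i), i < N, where xs i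
   is the successor state x_(i+1). *)
Section Estimation.
Variables (N : nat) (xs : nat -> 'cV[R]_nx) (zs : nat -> 'cV[R]_(nx + nu)).

Definition est_Y := \mxcol_(i < N) svec (xs i *m (xs i)^T).
Definition est_Z := \mxcol_(i < N) skron (model_at (zs i)).

Definition What : 'M[R]_nw := smat (mpinv est_Z *m est_Y).

Definition gram (i : nat) : 'M[R]_(sdim nw) :=
  (skron (model_at (zs i)))^T *m skron (model_at (zs i)).

Definition est_H (i : nat) : 'M[R]_(sdim nw) :=
  mpinv (\sum_(j < N) gram j) *m gram i.

Definition est_Hnorm (i : nat) : R :=
  sup [set opnorm2 (smat (est_H i *m svec X))
      | X in [set X : 'M[R]_nw | symmx X /\ opnorm2 X <= 1]].

Definition zetaW : R := Num.sqrt (\sum_(i < N) est_Hnorm i ^+ 2).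

Definition betaW (rw delta : R) : R :=
  rw ^+ 2 * zetaW * Num.sqrt (2 * ln (2 * nw%:R / delta)).

Definition Wlower (rw delta : R) : 'M[R]_nw := What - (betaW rw delta)%:M.
Definition Wupper (rw delta : R) : 'M[R]_nw := What + (betaW rw delta)%:M.

End Estimation.

Section MomentProblem.
Variables (W : 'M[R]_nw) (X0 : 'M[R]_nx).

Definition moment_cost (Z : nat -> 'M[R]_(nx + nu)) : \bar R :=
  (\sum_(0 <= t <oo) (\tr (Z t *m block_mx Qx 0 0 Ru))%:E)%E.

Definition moment_feasible (Z : nat -> 'M[R]_(nx + nu)) : Prop :=
  [/\ forall t, psdmx (Z t), ulsubmx (Z 0%N) = X0 &
      forall t, ulsubmx (Z t.+1) = momE W (Z t)].

Definition val_LQRcp : \bar R :=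
  ereal_inf [set moment_cost Z | Z in [set Z | moment_feasible Z]].

Definition closed_loop_moments (K : 'M[R]_(nu, nx)) (t : nat) :
    'M[R]_(nx + nu) :=
  liftK K (iter t (momEK K W) X0).

End MomentProblem.

End Model.

Section Probability.
Context {R : realType}.

(* Borel sigma-algebra of R^n, as the product sigma-algebra. *)
Definition vborel n : set (set 'cV[R]_n) :=
  g_sigma_preimage (fun (i : 'I_n) (x : 'cV[R]_n) => x i 0).

(* Lebesgue-null sets of R^n, by countable covers by boxes. *)
Definition lebesgue_null n (A : set 'cV[R]_n) : Prop :=
  forall e : R, 0 < e -> exists a b : nat -> 'cV[R]_n,
    [/\ forall k i, a k i 0 <= b k i 0,
        A `<=` \bigcup_k [set x | forall i, a k i 0 <= x i 0 <= b k i 0] &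
        (\sum_(0 <= k <oo) (\prod_i (b k i 0 - a k i 0))%:E <= e%:E)%E].

Section OneSpace.
Context {d : measure_display} {T : measurableType d} (P : probability T R).

Definition random_vector n (X : T -> 'cV[R]_n) : Prop :=
  forall A, vborel A -> measurable (X @^-1` A).

Definition sigma_of n (X : T -> 'cV[R]_n) : set (set T) :=
  preimage_set_system setT X (@vborel n).

Definition independent (I : eqType) (F : I -> set (set T)) : Prop :=
  forall (s : seq I) (A : I -> set T), uniq s ->
    (forall i, i \in s -> F i (A i)) ->
    P (\big[setI/setT]_(i <- s) A i) = (\prod_(i <- s) P (A i))%E.

Definition second_moment n (X : T -> 'cV[R]_n) : 'M[R]_n :=
  \matrix_(i, j) fine ('E_P[(fun om => X om i 0 * X om j 0)%R])%E.

Definition square_integrable n (X : T -> 'cV[R]_n) : Prop :=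
  forall i, P.-integrable setT (fun om => (X om i 0 ^+ 2)%:E).

Definition dominated_by_lebesgue n (X : T -> 'cV[R]_n) : Prop :=
  forall A, vborel A -> lebesgue_null A -> P (X @^-1` A) = 0%E.

(* The event S need not be measurable. *)
Definition with_probability_at_least (p : R) (S : set T) : Prop :=
  exists G : set T, [/\ measurable G, (p%:E <= P G)%E & G `<=` S].

End OneSpace.

Definition same_law d1 (T1 : measurableType d1) (P1 : probability T1 R)
    d2 (T2 : measurableType d2) (P2 : probability T2 R) n
    (X : T1 -> 'cV[R]_n) (Y : T2 -> 'cV[R]_n) : Prop :=
  forall A, vborel A -> P1 (X @^-1` A) = P2 (Y @^-1` A).

End Probability.

Section StochasticLQR.
Context {R : realType} {d : measure_display} {T : measurableType d}.
Variable P : probability T R.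
Variables (nx nu nv : nat).
Variables (At : 'I_nv -> 'M[R]_nx) (Bt : 'I_nv -> 'M[R]_(nx, nu)).
Variables (Qx : 'M[R]_nx) (Ru : 'M[R]_nu).
Variables (x0 : T -> 'cV[R]_nx) (v : nat -> T -> 'cV[R]_nv).

Definition dynA (vt : 'cV[R]_nv) : 'M[R]_nx := \sum_i vt i 0 *: At i.
Definition dynB (vt : 'cV[R]_nv) : 'M[R]_(nx, nu) := \sum_i vt i 0 *: Bt i.

Definition dyn_step (vt : 'cV[R]_nv) (x : 'cV[R]_nx) (u : 'cV[R]_nu) :=
  dynA vt *m x + dynB vt *m u.

Fixpoint state (u : nat -> T -> 'cV[R]_nu) (t : nat) (om : T) : 'cV[R]_nx :=
  if t is s.+1 then dyn_step (v s om) (state u s om) (u s om) else x0 om.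

Definition slqr_cost (u : nat -> T -> 'cV[R]_nu) : \bar R :=
  (\int[P]_om \sum_(0 <= t <oo)
    (((state u t om)^T *m Qx *m state u t om
      + (u t om)^T *m Ru *m u t om) 0 0)%:E)%E.

(* Information up to and including the choice of u t. *)
Definition history (u : nat -> T -> 'cV[R]_nu) (t : nat) : set (set T) :=
  <<s sigma_of x0
      `|` \bigcup_(s in [set s | (s <= t)%N]) sigma_of (u s)
      `|` \bigcup_(s in [set s | (s < t)%N]) sigma_of (v s) >>.

(* Causal, possibly randomized inputs: u t may depend on the past and on any
   auxiliary randomness, provided that the noise v t stays independent of the
   information used so far. *)
Definition admissible (u : nat -> T -> 'cV[R]_nu) : Prop :=
  forall t, random_vector (u t) /\
    forall A B, history u t A -> sigma_of (v t) B ->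
      P (A `&` B) = (P A * P B)%E.

Definition val_SLQR : \bar R :=
  ereal_inf [set slqr_cost u | u in [set u | admissible u]].

Fixpoint feedback_state (K : 'M[R]_(nu, nx)) (t : nat) (om : T) : 'cV[R]_nx :=
  if t is s.+1 then
    let x := feedback_state K s om in dyn_step (v s om) x (K *m x)
  else x0 om.

Definition feedback_input (K : 'M[R]_(nu, nx)) (t : nat) (om : T) :
  'cV[R]_nu := K *m feedback_state K t om.

End StochasticLQR.

(* w = (M_(3)^T)^+ V_(3)^T v, the coordinates of [A(v), B(v)] in the basis
   M_1, ..., M_nw. *)
Definition disturbance (R : realType) (nx nu nv nw : nat)
    (M : 'I_nw -> 'M[R]_(nx, nx + nu))
    (At : 'I_nv -> 'M[R]_nx) (Bt : 'I_nv -> 'M[R]_(nx, nu))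
    (vt : 'cV[R]_nv) : 'cV[R]_nw :=
  mpinv (unfold3 M)^T
  *m (unfold3 (fun i => row_mx (At i) (Bt i)))^T *m vt.

(* Main.v *)
(* The cost of a controller built from an overestimate of the noise covariance exceeds the
   optimum only to second order in the estimation error, which is of order 1 / sqrt N.

   Only [identifiable], the part of W* seen by the regressors, can be estimated. A quadratic
   form that vanishes almost surely under a law dominated by Lebesgue measure is zero, so the
   rest of W* does not enter the moment dynamics. A matrix Hoeffding inequality with weights
   that depend on the regressors gives, for a large enough sample and with the required
   probability, identifiable <= Wup <= identifiable + O(1 / sqrt N). The martingale argument
   works with tr (1 + S / m) ^ m for m = 2 ^ k instead of matrix exponentials; it also covers
   the upper bound, at a larger level. The law of large numbers for the Gram matrix makes zeta
   of order 1 / sqrt N.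

   By monotonicity in W the Riccati solution for Wup is at most (1 + O(e)) P*, hence
   |K - K*| = O(e), and P* + O(e^2) is a supersolution of the Lyapunov equation of the closed
   loop under the true covariance. P* itself bounds every feasible cost from below, both for
   the moment problem and for admissible inputs. *)
Require Import Defs.
From HB Require Import structures.
From mathcomp Require Import all_boot all_order all_algebra.
From mathcomp Require Import all_classical all_reals all_analysis.
From mathcomp Require Import measurable_realfun complex mxtens zify ring lra.

Set Implicit Arguments.
Unset Strict Implicit.
Unset Printing Implicit Defensive.

Import Order.TTheory GRing.Theory Num.Theory.
Import numFieldNormedType.Exports.

Local Open Scope classical_set_scope.
Local Open Scope ring_scope.

(** * Positive semidefinite matrices *)

Section QuadraticForms.
Context {R : realType}.

(** The level of [betaW] is fixed by the statement, so the loss factor 3/2 of the discretised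
    exponential has to fit into its factor 2. It fits because that level is needed on one side only:
    the corresponding event fails with probability 3/4 [delta], and the rest of [delta] pays for the
    upper bound and for the law of large numbers. The identifiable part of the covariance is not
    known to be positive semidefinite, and neither is [Wupper]. The Riccati theory therefore assumes
    only [posnoise], positivity of the adjoint map [madj], and stabilizability is stated by a trace
    pairing that involves [madj] alone. With m = 2 ^ k, the bound tr ((X Y)^m) <= tr (X^m Y^m)
    follows from 2 tr (A^T B) <= tr (A^T A) + tr (B^T B) by repeated doubling, and the bound of Y^m
    by its chord follows by induction on the exponent; no matrix functions are involved. All
    regressors belong to the filtration from the start, so the random normalisation by zeta is known
    before the first noise term and the squared weights have a sure bound on their sum. *)

Definition dot n (x y : 'cV[R]_n) : R := (x^T *m y) 0 0.

Definition qf n (A : 'M[R]_n) (x : 'cV[R]_n) : R := (x^T *m A *m x) 0 0.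

Lemma dotE n (x y : 'cV[R]_n) : dot x y = \sum_i x i 0 * y i 0.
Proof. by rewrite /dot mxE; apply: eq_bigr => i _; rewrite mxE. Qed.

Lemma dotC n (x y : 'cV[R]_n) : dot x y = dot y x.
Proof. by rewrite !dotE; apply: eq_bigr => i _; rewrite mulrC. Qed.

Lemma dotDl n (x y z : 'cV[R]_n) : dot (x + y) z = dot x z + dot y z.
Proof. by rewrite /dot linearD /= mulmxDl mxE. Qed.

Lemma dotDr n (x y z : 'cV[R]_n) : dot x (y + z) = dot x y + dot x z.
Proof. by rewrite /dot mulmxDr mxE. Qed.

Lemma dotZl n a (x y : 'cV[R]_n) : dot (a *: x) y = a * dot x y.
Proof. by rewrite /dot linearZ /= -scalemxAl mxE. Qed.

Lemma dotZr n a (x y : 'cV[R]_n) : dot x (a *: y) = a * dot x y.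
Proof. by rewrite dotC dotZl dotC. Qed.

Lemma dotNl n (x y : 'cV[R]_n) : dot (- x) y = - dot x y.
Proof. by rewrite -scaleN1r dotZl mulN1r. Qed.

Lemma dotNr n (x y : 'cV[R]_n) : dot x (- y) = - dot x y.
Proof. by rewrite dotC dotNl dotC. Qed.

Lemma dot0r n (x : 'cV[R]_n) : dot x 0 = 0.
Proof. by rewrite /dot mulmx0 mxE. Qed.

Lemma dot_mulr m n (A : 'M[R]_(m, n)) x y :
  dot x (A *m y) = dot (A^T *m x) y.
Proof. by rewrite /dot trmx_mul trmxK mulmxA. Qed.

Lemma dot_ge0 n (x : 'cV[R]_n) : 0 <= dot x x.
Proof. by rewrite dotE sumr_ge0 // => i _; rewrite -expr2 sqr_ge0. Qed.

Lemma dot_eq0 n (x : 'cV[R]_n) : dot x x = 0 -> x = 0.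
Proof.
move=> h; apply: trmx_mul_eq0; apply/matrixP => i j.
by rewrite !ord1 [LHS]h mxE.
Qed.

Lemma dot_gt0 n (x : 'cV[R]_n) : x != 0 -> 0 < dot x x.
Proof.
move=> x0; rewrite lt_neqAle dot_ge0 andbT eq_sym.
by apply: contra x0 => /eqP/dot_eq0 ->.
Qed.

Lemma norm2E n (x : 'cV[R]_n) : norm2 x = Num.sqrt (dot x x).
Proof. by rewrite /norm2 dotE; congr Num.sqrt; apply: eq_bigr => i _; rewrite expr2. Qed.

Lemma norm2_ge0 n (x : 'cV[R]_n) : 0 <= norm2 x.
Proof. by rewrite sqrtr_ge0. Qed.

Lemma norm2_sqr n (x : 'cV[R]_n) : norm2 x ^+ 2 = dot x x.
Proof. by rewrite norm2E sqr_sqrtr // dot_ge0. Qed.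

Lemma qfE n (A : 'M[R]_n) x : qf A x = dot x (A *m x).
Proof. by rewrite /qf /dot mulmxA. Qed.

Lemma qfDl n (A B : 'M[R]_n) x : qf (A + B) x = qf A x + qf B x.
Proof. by rewrite !qfE mulmxDl dotDr. Qed.

Lemma qfBl n (A B : 'M[R]_n) x : qf (A - B) x = qf A x - qf B x.
Proof. by rewrite !qfE mulmxBl dotDr dotNr. Qed.

Lemma qfZl n a (A : 'M[R]_n) x : qf (a *: A) x = a * qf A x.
Proof. by rewrite !qfE -scalemxAl dotZr. Qed.

Lemma qf0l n (x : 'cV[R]_n) : qf 0 x = 0.
Proof. by rewrite qfE mul0mx dot0r. Qed.

Lemma qf_sum n I (r : seq I) (P : pred I) (F : I -> 'M[R]_n) x :
  qf (\sum_(i <- r | P i) F i) x = \sum_(i <- r | P i) qf (F i) x.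
Proof. by elim/big_rec2: _ => [|i a b _ <-]; rewrite ?qf0l ?qfDl. Qed.

Lemma qf_scalar n a (x : 'cV[R]_n) : qf a%:M x = a * dot x x.
Proof. by rewrite qfE mul_scalar_mx dotZr. Qed.

Lemma qf_congr m n (A : 'M[R]_m) (B : 'M[R]_(m, n)) x :
  qf (B^T *m A *m B) x = qf A (B *m x).
Proof. by rewrite !qfE -!mulmxA dot_mulr trmxK. Qed.

Lemma qf_gram m n (B : 'M[R]_(m, n)) x : qf (B^T *m B) x = dot (B *m x) (B *m x).
Proof. by rewrite -[B^T]mulmx1 qf_congr qfE mul1mx. Qed.

Lemma qf_rank1 n (v x : 'cV[R]_n) : qf (v *m v^T) x = dot v x ^+ 2.
Proof.
rewrite -{1}[v]trmxK qf_gram /dot [X in X^T]mx11_scalar tr_scalar_mx.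
by rewrite mul_scalar_mx mxE expr2.
Qed.

Lemma qf_row m n (A : 'M[R]_(m + n)) (x : 'cV[R]_m) (y : 'cV[R]_n) :
  qf A (col_mx x y) = qf (ulsubmx A) x + dot x (ursubmx A *m y)
    + dot y (dlsubmx A *m x) + qf (drsubmx A) y.
Proof.
rewrite qfE -[A in LHS]submxK mul_block_col /dot tr_col_mx mul_row_col mxE.
by rewrite !qfE /dot !mulmxDr !mxE !addrA.
Qed.

Lemma symmxD n (A B : 'M[R]_n) : symmx A -> symmx B -> symmx (A + B).
Proof. by move=> a b; rewrite /symmx linearD /= a b. Qed.
Lemma symmxN n (A : 'M[R]_n) : symmx A -> symmx (- A).
Proof. by move=> a; rewrite /symmx linearN /= a. Qed.
Lemma symmxB n (A B : 'M[R]_n) : symmx A -> symmx B -> symmx (A - B).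
Proof. by move=> a b; apply: symmxD => //; apply: symmxN. Qed.
Lemma symmxZ n a (A : 'M[R]_n) : symmx A -> symmx (a *: A).
Proof. by move=> h; rewrite /symmx linearZ /= h. Qed.
Lemma symmx0 n : symmx (0 : 'M[R]_n). Proof. exact: trmx0. Qed.
Lemma symmx_scalar n (a : R) : symmx (a%:M : 'M[R]_n).
Proof. exact: tr_scalar_mx. Qed.
Lemma symmx_sum n I (r : seq I) (P : pred I) (F : I -> 'M[R]_n) :
  (forall i, P i -> symmx (F i)) -> symmx (\sum_(i <- r | P i) F i).
Proof. by move=> h; apply: (big_ind (@symmx R n)) => [||i Pi]; [exact: symmx0|exact: symmxD|exact: h]. Qed.
Lemma symmx_congr m n (A : 'M[R]_m) (B : 'M[R]_(m, n)) :
  symmx A -> symmx (B^T *m A *m B).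
Proof. by move=> h; rewrite /symmx !trmx_mul trmxK h mulmxA. Qed.
Lemma symmx_congr' m n (A : 'M[R]_m) (B : 'M[R]_(n, m)) :
  symmx A -> symmx (B *m A *m B^T).
Proof. by move=> h; rewrite /symmx !trmx_mul trmxK h mulmxA. Qed.
Lemma symmx_rank1 n (x : 'cV[R]_n) : symmx (x *m x^T).
Proof. by rewrite /symmx trmx_mul trmxK. Qed.

(** Polarization: expanding the form at [x + y] shows that a symmetric matrix with zero quadratic
    form has zero bilinear form. *)
Lemma symmx_qf_eq n (A B : 'M[R]_n) :
  symmx A -> symmx B -> (forall x, qf A x = qf B x) -> A = B.
Proof.
move=> sA sB h; suff D0 : forall D : 'M[R]_n, symmx D -> (forall x, qf D x = 0) -> D = 0.
  apply/subr0_eq/D0; first exact: symmxB.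
  by move=> x; rewrite qfBl h subrr.
move=> D sD q0.
have dD x y : dot x (D *m y) = 0.
  have := q0 (x + y); rewrite qfE mulmxDr dotDl !dotDr -!qfE !q0 add0r addr0.
  rewrite [dot y _]dot_mulr sD [dot (D *m y) _]dotC => h2.
  by move: h2; lra.
apply/matrixP => i j; have := dD (delta_mx i 0) (delta_mx j 0).
by rewrite /dot trmx_delta -colE -rowE !mxE.
Qed.

Lemma psd_sym n (A : 'M[R]_n) : psdmx A -> symmx A. Proof. by case. Qed.
Lemma psd_qf n (A : 'M[R]_n) x : psdmx A -> 0 <= qf A x. Proof. by move=> [_ h]; exact: h. Qed.
Lemma psd0 n : psdmx (0 : 'M[R]_n).
Proof. by split; [exact: symmx0|move=> x; rewrite -/(qf _ _) qf0l]. Qed.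
Lemma psdD n (A B : 'M[R]_n) : psdmx A -> psdmx B -> psdmx (A + B).
Proof.
move=> [a1 a2] [b1 b2]; split; first exact: symmxD.
by move=> x; rewrite -/(qf _ _) qfDl addr_ge0 ?a2 ?b2.
Qed.
Lemma psdZ n a (A : 'M[R]_n) : 0 <= a -> psdmx A -> psdmx (a *: A).
Proof.
move=> a0 [a1 a2]; split; first exact: symmxZ.
by move=> x; rewrite -/(qf _ _) qfZl mulr_ge0 ?a2.
Qed.
Lemma psd_sum n I (r : seq I) (P : pred I) (F : I -> 'M[R]_n) :
  (forall i, P i -> psdmx (F i)) -> psdmx (\sum_(i <- r | P i) F i).
Proof. by move=> h; apply: (big_ind (@psdmx R n)) => [||i Pi]; [exact: psd0|exact: psdD|exact: h]. Qed.
Lemma psd_congr m n (A : 'M[R]_m) (B : 'M[R]_(m, n)) :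
  psdmx A -> psdmx (B^T *m A *m B).
Proof.
move=> [a1 a2]; split; first exact: symmx_congr.
by move=> x; rewrite -/(qf _ _) qf_congr; exact: a2.
Qed.
Lemma psd_congr' m n (A : 'M[R]_m) (B : 'M[R]_(n, m)) :
  psdmx A -> psdmx (B *m A *m B^T).
Proof. by move=> h; have := psd_congr B^T h; rewrite trmxK. Qed.
Lemma psd_scalar n (a : R) : 0 <= a -> psdmx (a%:M : 'M[R]_n).
Proof.
move=> a0; split; first exact: symmx_scalar.
by move=> x; rewrite -/(qf _ _) qf_scalar mulr_ge0 // dot_ge0.
Qed.
Lemma psd_gram m n (B : 'M[R]_(m, n)) : psdmx (B^T *m B).
Proof.
have := psd_congr B (@psd_scalar m 1 ler01).
by rewrite -mulmxA mul1mx.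
Qed.
Lemma psd_rank1 n (x : 'cV[R]_n) : psdmx (x *m x^T).
Proof. by have := psd_gram x^T; rewrite trmxK. Qed.

Lemma lemxP n (A B : 'M[R]_n) : symmx A -> symmx B ->
  (forall x, qf A x <= qf B x) -> lemx A B.
Proof.
move=> sA sB h; split; first exact: symmxB.
by move=> x; rewrite -/(qf _ _) qfBl subr_ge0.
Qed.
Lemma lemx_qf n (A B : 'M[R]_n) x : lemx A B -> qf A x <= qf B x.
Proof. by move=> [_ /(_ x)]; rewrite -/(qf _ _) qfBl subr_ge0. Qed.
Lemma lemx_refl n (A : 'M[R]_n) : lemx A A.
Proof. by rewrite /lemx subrr; exact: psd0. Qed.
Lemma lemx_trans n (B A C : 'M[R]_n) : lemx A B -> lemx B C -> lemx A C.
Proof. by move=> h1 h2; have := psdD h2 h1; rewrite addrA subrK. Qed.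
Lemma lemxD n (A B C D : 'M[R]_n) : lemx A B -> lemx C D -> lemx (A + C) (B + D).
Proof. by move=> h1 h2; have := psdD h1 h2; rewrite /lemx addrACA -opprD. Qed.
Lemma lemxZ n a (A B : 'M[R]_n) : 0 <= a -> lemx A B -> lemx (a *: A) (a *: B).
Proof. by move=> a0 h; rewrite /lemx -scalerBr; exact: psdZ. Qed.
Lemma lemx0 n (A : 'M[R]_n) : psdmx A -> lemx 0 A.
Proof. by rewrite /lemx subr0. Qed.
Lemma lemx_psd n (A B : 'M[R]_n) : psdmx A -> lemx A B -> psdmx B.
Proof. by move=> h1 h2; have := psdD h2 h1; rewrite subrK. Qed.
Lemma lemx_anti n (A B : 'M[R]_n) : lemx A B -> lemx B A -> A = B.
Proof.
move=> h1 h2; apply/subr0_eq/symmx_qf_eq; [exact: psd_sym h2|exact: symmx0|].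
move=> x; rewrite qf0l qfBl; have := lemx_qf x h1; have := lemx_qf x h2; lra.
Qed.
Lemma lemx_addr n (A B : 'M[R]_n) : psdmx B -> lemx A (A + B).
Proof. by rewrite /lemx addrAC subrr add0r. Qed.

(** Discriminant of [qf A (x + t *: y)], a polynomial in [t] that is nonnegative. *)
Lemma psd_CS n (A : 'M[R]_n) x y : psdmx A ->
  dot x (A *m y) ^+ 2 <= qf A x * qf A y.
Proof.
move=> hA; have [sA _] := hA.
have key t : 0 <= qf A x + 2 * t * dot x (A *m y) + t ^+ 2 * qf A y.
  have := psd_qf (x + t *: y) hA; rewrite qfE mulmxDr dotDl !dotDr -scalemxAr.
  rewrite !dotZl !dotZr -!qfE [dot y (A *m x)]dot_mulr sA [dot (A *m y) _]dotC.
  by move=> h; apply: (le_trans h); rewrite le_eqVlt; apply/orP; left; apply/eqP; ring.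
have y0 := psd_qf y hA; have x0 := psd_qf x hA.
(* If the leading coefficient vanishes, the polynomial is affine and a nonzero slope would give it
   the value -1. *)
have [e|n0] := eqVneq (qf A y) 0.
  rewrite e mulr0; have [->|d0] := eqVneq (dot x (A *m y)) 0; first by rewrite expr0n.
  have := key (- (qf A x + 1) / (2 * dot x (A *m y))).
  rewrite e mulr0 addr0.
  have -> : 2 * (- (qf A x + 1) / (2 * dot x (A *m y))) * dot x (A *m y) = - (qf A x + 1).
    by field; rewrite d0 //=; apply/eqP; lra.
  lra.
have yp : 0 < qf A y by rewrite lt_neqAle eq_sym n0.
have := key (- dot x (A *m y) / qf A y).
have -> : qf A x + 2 * (- dot x (A *m y) / qf A y) * dot x (A *m y)
   + (- dot x (A *m y) / qf A y) ^+ 2 * qf A y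
   = (qf A x * qf A y - dot x (A *m y) ^+ 2) / qf A y by field.
by rewrite pmulr_lge0 ?invr_gt0 // subr_ge0.
Qed.

Lemma dot_CS n (x y : 'cV[R]_n) : dot x y ^+ 2 <= dot x x * dot y y.
Proof.
have := psd_CS x y (@psd_scalar n 1 ler01).
by rewrite !qf_scalar !mul1r mul1mx.
Qed.

Lemma dot_le_norm2 n (x y : 'cV[R]_n) : `|dot x y| <= norm2 x * norm2 y.
Proof.
rewrite -sqrtr_sqr !norm2E -sqrtrM ?dot_ge0 //.
by apply: ler_wsqrtr; exact: dot_CS.
Qed.

Lemma ler_norm2D n (x y : 'cV[R]_n) : norm2 (x + y) <= norm2 x + norm2 y.
Proof.
rewrite -(@ler_pXn2r _ 2) ?nnegrE ?addr_ge0 ?norm2_ge0 //.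
rewrite sqrrD !norm2_sqr dotDl !dotDr [dot y x]dotC.
have := dot_le_norm2 x y; have := ler_norm (dot x y); lra.
Qed.

Lemma norm2Z n a (x : 'cV[R]_n) : norm2 (a *: x) = `|a| * norm2 x.
Proof.
by rewrite !norm2E dotZl dotZr mulrA -expr2 sqrtrM ?sqr_ge0 // sqrtr_sqr.
Qed.

Lemma norm2_0 n : norm2 (0 : 'cV[R]_n) = 0.
Proof. by rewrite norm2E dot0r sqrtr0. Qed.

Lemma norm2_eq0 n (x : 'cV[R]_n) : norm2 x = 0 -> x = 0.
Proof. by move=> h; apply: dot_eq0; rewrite -norm2_sqr h expr0n. Qed.

Lemma norm2_entry n (x : 'cV[R]_n) i : `|x i 0| <= norm2 x.
Proof.
rewrite -sqrtr_sqr /norm2; apply: ler_wsqrtr.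
by rewrite (bigD1 i) //= lerDl sumr_ge0 // => j _; rewrite sqr_ge0.
Qed.

(** An operator norm bound without the supremum of [opnorm2], so that bounds add and multiply
    directly. *)
Definition opb m n (c : R) (A : 'M[R]_(m, n)) : Prop :=
  forall x, norm2 (A *m x) <= c * norm2 x.

Lemma opbD m n c d (A B : 'M[R]_(m, n)) : opb c A -> opb d B -> opb (c + d) (A + B).
Proof.
move=> a b x; rewrite mulmxDl (le_trans (ler_norm2D _ _)) // mulrDl.
by rewrite lerD.
Qed.
Lemma opbM m n p c d (A : 'M[R]_(m, n)) (B : 'M[R]_(n, p)) :
  0 <= c -> opb c A -> opb d B -> opb (c * d) (A *m B).
Proof.
by move=> c0 a b x; rewrite -mulmxA (le_trans (a _)) // -mulrA ler_wpM2l.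
Qed.
Lemma opbZ m n c a (A : 'M[R]_(m, n)) : opb c A -> opb (`|a| * c) (a *: A).
Proof. by move=> h x; rewrite -scalemxAl norm2Z -mulrA ler_wpM2l. Qed.
Lemma opbN m n c (A : 'M[R]_(m, n)) : opb c A -> opb c (- A).
Proof. by move=> h; have := opbZ (-1) h; rewrite scaleN1r normrN1 mul1r. Qed.
Lemma opb1 n : opb 1 (1%:M : 'M[R]_n).
Proof. by move=> x; rewrite mul1mx mul1r. Qed.
Lemma opb0 m n : opb 0 (0 : 'M[R]_(m, n)).
Proof. by move=> x; rewrite mul0mx norm2_0 mul0r. Qed.
Lemma opbW m n c d (A : 'M[R]_(m, n)) : c <= d -> opb c A -> opb d A.
Proof. by move=> cd h x; rewrite (le_trans (h x)) // ler_wpM2r // norm2_ge0. Qed.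
Lemma opb_dot m n c (A : 'M[R]_(m, n)) x y : opb c A ->
  `|dot x (A *m y)| <= c * norm2 x * norm2 y.
Proof.
move=> h; rewrite (le_trans (dot_le_norm2 _ _)) // mulrAC mulrC.
by rewrite ler_wpM2r ?norm2_ge0.
Qed.
Lemma opb_entry m n c (A : 'M[R]_(m, n)) i j : opb c A -> `|A i j| <= c.
Proof.
have nd k l : norm2 (delta_mx l 0 : 'cV[R]_k) = 1.
  rewrite norm2E /dot trmx_delta mul_delta_mx mxE !eqxx sqrtr1 //.
move=> h; have := opb_dot (delta_mx i 0) (delta_mx j 0) h.
by rewrite !nd !mulr1 /dot trmx_delta -colE -rowE !mxE.
Qed.
End QuadraticForms.

(** * Norm bounds, rank-one decomposition and monotone limits of matrices *)

Section Bounds.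
Context {R : realType}.
Implicit Types (m n : nat).

(** Entrywise l1 norm, used for limits and for constants whose exact size does not matter. *)
Definition mxabs m n (A : 'M[R]_(m, n)) : R := \sum_i \sum_j `|A i j|.

Lemma mxabs_ge0 m n (A : 'M[R]_(m, n)) : 0 <= mxabs A.
Proof. by apply: sumr_ge0 => i _; apply: sumr_ge0. Qed.

Lemma norm2_delta n (i : 'I_n) : norm2 (delta_mx i 0 : 'cV[R]_n) = 1.
Proof. by rewrite norm2E /dot trmx_delta mul_delta_mx mxE !eqxx sqrtr1. Qed.

Lemma opb_mxabs m n (A : 'M[R]_(m, n)) : opb (mxabs A) A.
Proof.
move=> x; rewrite [X in X *m _]matrix_sum_delta mulmx_suml.
rewrite /mxabs mulr_suml; elim/big_rec2: _ => [|i a b _ IH]; first by rewrite norm2_0.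
rewrite (le_trans (ler_norm2D _ _)) // lerD // mulmx_suml mulr_suml.
elim/big_rec2: _ => [|j c e _ {}IH]; first by rewrite norm2_0.
rewrite (le_trans (ler_norm2D _ _)) // lerD // -scalemxAl norm2Z ler_wpM2l //.
have -> : delta_mx i j *m x = x j 0 *: delta_mx i 0.
  rewrite -(@mul_delta_mx _ m 1 n 0 i j) -mulmxA -rowE [row j x]mx11_scalar.
  by rewrite mul_mx_scalar !mxE.
by rewrite norm2Z norm2_delta mulr1 norm2_entry.
Qed.

Lemma opb_le n c (A : 'M[R]_n) : symmx A -> opb c A -> lemx A c%:M.
Proof.
move=> sA h; apply: lemxP => // [|x]; first exact: symmx_scalar.
rewrite qf_scalar -norm2_sqr qfE expr2 mulrA.
by rewrite (le_trans (ler_norm _)) // opb_dot.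
Qed.

Lemma opb_ge n c (A : 'M[R]_n) : symmx A -> opb c A -> lemx (- c%:M) A.
Proof.
move=> sA h; have := opb_le (symmxN sA) (opbN h).
by rewrite /lemx !opprK addrC.
Qed.

Lemma symmx_lemxabs n (A : 'M[R]_n) : symmx A -> lemx A (mxabs A)%:M.
Proof. by move=> sA; apply: opb_le => //; exact: opb_mxabs. Qed.

Lemma pd_psd n (A : 'M[R]_n) : pdmx A -> psdmx A.
Proof.
move=> [sA h]; split=> // x; have [->|x0] := eqVneq x 0; last exact/ltW/h.
by rewrite mulmx0 mxE.
Qed.

Lemma pd_unit n (A : 'M[R]_n) : pdmx A -> A \in unitmx.
Proof.
move=> [sA h]; rewrite -row_free_unit -kermx_eq0; apply/eqP/row_matrixP => i.
rewrite row0; set u := row i _; have uA : u *m A = 0 by apply/sub_kermxP; rewrite row_sub.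
apply: trmx_inj; rewrite trmx0; apply/eqP/negPn/negP => /h.
by rewrite trmxK uA mul0mx mxE ltxx.
Qed.

(** With [y = invmx A *m x], Cauchy-Schwarz for [A] bounds [dot x x ^+ 2] by [qf A x * qf A y], and
    [qf A y] is at most a constant times [dot x x]; [c] is the inverse of that constant. *)
Lemma pd_ge n (A : 'M[R]_n) : pdmx A -> exists2 c, 0 < c & lemx c%:M A.
Proof.
move=> pA; have uA := pd_unit pA; have [sA hA] := pA.
pose b := mxabs (invmx A) + 1.
have b0 : 0 < b by rewrite /b; have := mxabs_ge0 (invmx A); lra.
exists b^-1; first by rewrite invr_gt0.
apply: lemxP => // [|x]; first exact: symmx_scalar.
rewrite qf_scalar ler_pdivrMl //; have [->|x0] := eqVneq x 0.
  by rewrite dot0r; apply: mulr_ge0; [exact: ltW|exact/psd_qf/pd_psd].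
set y := invmx A *m x; have Ay : A *m y = x by rewrite mulKVmx.
have := psd_CS x y (pd_psd pA); rewrite Ay => /le_trans h.
have yb : qf A y <= b * dot x x.
  rewrite qfE Ay dotC (le_trans (ler_norm _)) //.
  rewrite (le_trans (opb_dot _ _ (opb_mxabs _))) // -mulrA -expr2 norm2_sqr.
  by rewrite ler_wpM2r ?dot_ge0 // /b lerDl.
have q0 : 0 <= qf A x by apply: psd_qf; exact: pd_psd.
have := h _ (ler_wpM2l q0 yb); rewrite expr2 mulrA ler_pM2r ?dot_gt0 //.
by rewrite mulrC.
Qed.

Lemma pd_of_ge n c (A : 'M[R]_n) : 0 < c -> symmx A -> lemx c%:M A -> pdmx A.
Proof.
move=> c0 sA h; split=> // x x0; apply: lt_le_trans (lemx_qf x h).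
by rewrite qf_scalar mulr_gt0 // dot_gt0.
Qed.

Lemma pd_lemx n (A B : 'M[R]_n) : pdmx A -> lemx A B -> pdmx B.
Proof.
move=> pA h; split; first exact/psd_sym/(lemx_psd _ h)/pd_psd.
by move=> x x0; apply: lt_le_trans (lemx_qf x h); apply: pA.2.
Qed.

Lemma psd_entry_sqr n (A : 'M[R]_n) i j : psdmx A -> A i j ^+ 2 <= A i i * A j j.
Proof.
have e k l : dot (delta_mx k 0) (A *m delta_mx l 0) = A k l.
  by rewrite /dot trmx_delta -colE -rowE !mxE.
by move=> /(psd_CS (delta_mx i 0) (delta_mx j 0)); rewrite !qfE !e.
Qed.

Lemma psd_diag_ge0 n (A : 'M[R]_n) i : psdmx A -> 0 <= A i i.
Proof.
move=> /(psd_qf (delta_mx i 0)).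
by rewrite qfE /dot trmx_delta -colE -rowE !mxE.
Qed.

(* Peels off one rank-one matrix for each nonzero diagonal entry. *)
Lemma psd_rank1_sum n (A : 'M[R]_n) : psdmx A ->
  exists s : seq 'cV[R]_n, A = \sum_(v <- s) v *m v^T.
Proof.
move: {2}#|_|.+1 (ltnSn #|[pred i | A i i != 0]|) => k.
elim: k A => // k IH A kA pA.
have [i Aii|h] := pickP [pred i | A i i != 0]; last first.
  exists nil; rewrite big_nil; apply/matrixP => i j; rewrite mxE.
  have := psd_entry_sqr i j pA; have /eqP -> := negbFE (h i); rewrite mul0r.
  by rewrite real_exprn_even_le0 ?num_real //= => /eqP.
have Ap : 0 < A i i by rewrite lt_neqAle eq_sym [A i i != 0]Aii psd_diag_ge0.
(* [v *m v^T] agrees with [A] on row and column [i], so subtracting it clears the diagonal entry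
   [i]. *)
pose v := (Num.sqrt (A i i))^-1 *: col i A.
have vE j l : (v *m v^T) j l = A j i * A l i / A i i.
  rewrite mxE big_ord1 !mxE mulrACA -expr2 exprVn sqr_sqrtr ?ltW //.
  by rewrite mulrC.
(* Positivity of this Schur complement is Cauchy-Schwarz for [A] between the [i]-th basis vector and
   [x]. *)
have pB : psdmx (A - v *m v^T).
  have sA := psd_sym pA; split; first by apply: symmxB => //; exact: symmx_rank1.
  move=> x; rewrite -/(qf _ _) qfBl qf_rank1 subr_ge0.
  rewrite /v dotZl exprMn exprVn sqr_sqrtr; last exact: ltW.
  rewrite ler_pdivrMl //.
  have := psd_CS (delta_mx i 0) x pA.
  rewrite dot_mulr sA -colE qfE -colE {2}/dot trmx_delta -rowE !mxE.
  by move=> h; exact: h.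
case: (IH _ _ pB) => [|s Bs].
  (* A zero diagonal entry of a positive matrix has a zero row, so it stays zero, while entry [i]
     becomes zero. *)
  rewrite -ltnS (leq_trans _ kA) // ltnS; apply: proper_card; apply/properP; split.
    apply/fintype.subsetP => j; rewrite !inE !mxE -/(dot v v) => h; apply: contra h => /eqP Aj.
    rewrite Aj big_ord1 !mxE; have := psd_entry_sqr j i pA; rewrite Aj mul0r.
    rewrite real_exprn_even_le0 ?num_real //= => /eqP ->.
    by rewrite !mulr0 subr0.
  exists i => //; rewrite !inE negbK; apply/eqP.
  rewrite 2!mxE vE mulfK ?subrr // gt_eqF //.
exists (v :: s); rewrite big_cons -Bs; by rewrite addrCA subrr addr0.
Qed.

Lemma mxtrace_psdM n (A B : 'M[R]_n) : psdmx A -> psdmx B -> 0 <= \tr (A *m B).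
Proof.
move=> pA /psd_rank1_sum[s ->]; rewrite mulmx_sumr linear_sum /= sumr_ge0 // => v _.
rewrite mulmxA mxtrace_mulC mulmxA trace_mx11.
exact: (psd_qf v pA).
Qed.

Lemma mxtrace_lemxM n (A B C : 'M[R]_n) : lemx A B -> psdmx C ->
  \tr (A *m C) <= \tr (B *m C).
Proof.
move=> h1 h2; have := mxtrace_psdM h1 h2.
by rewrite mulmxBl linearB /= subr_ge0.
Qed.

Lemma mxtrace_psd_ge0 n (A : 'M[R]_n) : psdmx A -> 0 <= \tr A.
Proof. by move=> h; apply: sumr_ge0 => i _; exact: psd_diag_ge0. Qed.

Lemma mxtrace_rank1M n (A : 'M[R]_n) v : \tr (A *m (v *m v^T)) = qf A v.
Proof. by rewrite mulmxA mxtrace_mulC mulmxA trace_mx11. Qed.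

Lemma psd_le_tr n (A : 'M[R]_n) : psdmx A -> lemx A (\tr A)%:M.
Proof.
move=> /[dup] pA /psd_rank1_sum[s As]; apply: lemxP => [||x].
- exact: psd_sym.
- exact: symmx_scalar.
rewrite qf_scalar As qf_sum linear_sum /= mulr_suml; apply: ler_sum => v _.
by rewrite qf_rank1 mxtrace_mulC trace_mx11; exact: dot_CS.
Qed.

Lemma cvgn_sum I (r : seq I) (f : I -> nat -> R) (l : I -> R) :
  (forall i, f i @ \oo --> l i) ->
  (fun k => \sum_(i <- r) f i k) @ \oo --> \sum_(i <- r) l i.
Proof.
move=> h; elim: r => [|i r IH].
  by rewrite big_nil; under eq_fun do rewrite big_nil; exact: cvg_cst.
by rewrite big_cons; under eq_fun do rewrite big_cons; exact: cvgD.
Qed.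

(** Every quadratic form converges as a bounded monotone real sequence, and polarization carries the
    convergence to the entries. Both the Lyapunov and the Riccati solutions are obtained as such
    limits. *)
Lemma mono_mx_cvg n (S : nat -> 'M[R]_n) U :
  symmx (S 0%N) -> (forall k, lemx (S k) (S k.+1)) -> (forall k, lemx (S k) U) ->
  exists L, [/\ symmx L, forall k, lemx (S k) L & forall e, 0 < e ->
     exists K, forall k, (K <= k)%N -> mxabs (L - S k) <= e].
Proof.
move=> s0 hS hU.
have sS k : symmx (S k).
  by elim: k => // k IH; have := symmxD (psd_sym (hS k)) IH; rewrite subrK.
have ndq x : {homo (fun k => qf (S k) x) : a b / (a <= b)%N >-> a <= b}.
  by apply/nondecreasing_seqP => k; apply: lemx_qf.
have cq x : cvgn (fun k => qf (S k) x).
  apply: nondecreasing_is_cvgn; first exact: ndq.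
  by exists (qf U x) => _ [k _ <-]; apply: lemx_qf.
pose L := \matrix_(i, j) limn (fun k => S k i j).
have cS i j : (fun k => S k i j) @ \oo --> L i j.
  rewrite mxE; suff : cvgn (fun k => S k i j) by [].
  have -> : (fun k => S k i j) = (fun k => 2^-1 *
     (qf (S k) (delta_mx i 0 + delta_mx j 0) - qf (S k) (delta_mx i 0)
       - qf (S k) (delta_mx j 0))).
    apply/funext => k; rewrite !qfE mulmxDr dotDl !dotDr.
    rewrite /dot !trmx_delta -!colE -!rowE !mxE.
    have -> : S k j i = S k i j by rewrite -[in LHS](sS k) mxE.
    by field.
  by apply: is_cvgM; [exact: is_cvg_cst|do 2?[apply: is_cvgB]; exact: cq].
have cqL x : (fun k => qf (S k) x) @ \oo --> qf L x.
  rewrite (_ : (fun k => _) = (fun k => \sum_i \sum_j x i 0 * S k i j * x j 0)); last first.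
    apply/funext => k; rewrite qfE dotE; apply: eq_bigr => i _; rewrite mxE mulr_sumr.
    by apply: eq_bigr => j _; rewrite mulrA.
  rewrite (_ : qf L x = \sum_i \sum_j x i 0 * L i j * x j 0); last first.
    rewrite qfE dotE; apply: eq_bigr => i _; rewrite mxE mulr_sumr.
    by apply: eq_bigr => j _; rewrite mulrA.
  apply: cvgn_sum => i; apply: cvgn_sum => j.
  by apply: cvgM; [apply: cvgM; [exact: cvg_cst|exact: cS]|exact: cvg_cst].
have sL : symmx L.
  apply/matrixP => i j; rewrite !mxE.
  suff -> : (fun k => S k j i) = (fun k => S k i j) by [].
  by apply/funext => k; rewrite -[in LHS](sS k) mxE.
exists L; split => // [k|e e0].
  apply: lemxP => // x; rewrite -(cvg_lim (@Rhausdorff R) (cqL x)).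
  exact: nondecreasing_cvgn_le.
have : (fun k => mxabs (L - S k)) @ \oo --> (0 : R).
  rewrite (_ : 0 = \sum_(i < n) \sum_(j < n) (0 : R)); last first.
    by rewrite big1 // => i _; rewrite big1.
  apply: cvgn_sum => i; apply: cvgn_sum => j; rewrite -(@normr0 _ R).
  apply: cvg_norm; rewrite -(subrr (L i j)).
  rewrite (_ : (fun k => _) = (fun k => L i j - S k i j)); last first.
    by apply/funext => k; rewrite !mxE.
  by apply: cvgB; [exact: cvg_cst|exact: cS].
move=> /cvgrPdist_le/(_ e e0)[K _ hK]; exists K => k Kk.
have := hK k Kk; rewrite /= sub0r normrN ger0_norm ?mxabs_ge0 //.
Qed.
End Bounds.

(** * Spectral radius and Lyapunov certificates *)

Section LinearMaps.
Context {R : realType}.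
Implicit Types (m n p q : nat).

(** The operators on matrices below are plain functions with a proof of [linear]; these are the
    additivity rules in that form. *)
Lemma lin_D (U V : lmodType R) (f : U -> V) : linear f -> {morph f : x y / x + y}.
Proof. by move=> h x y; rewrite -{1}[x]scale1r h scale1r. Qed.
Lemma lin_0 (U V : lmodType R) (f : U -> V) : linear f -> f 0 = 0.
Proof. by move=> h; apply: (addrI (f 0)); rewrite -(lin_D h) !addr0. Qed.
Lemma lin_Z (U V : lmodType R) (f : U -> V) a : linear f -> {morph f : x / a *: x}.
Proof. by move=> h x; rewrite -[a *: x]addr0 h (lin_0 h) addr0. Qed.
Lemma lin_N (U V : lmodType R) (f : U -> V) : linear f -> {morph f : x / - x}.
Proof. by move=> h x; rewrite -scaleN1r (lin_Z _ h) scaleN1r. Qed.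
Lemma lin_B (U V : lmodType R) (f : U -> V) : linear f -> {morph f : x y / x - y}.
Proof. by move=> h x y; rewrite (lin_D h) (lin_N h). Qed.
Lemma lin_sum (U V : lmodType R) (f : U -> V) I (r : seq I) (P : pred I) F :
  linear f -> f (\sum_(i <- r | P i) F i) = \sum_(i <- r | P i) f (F i).
Proof.
by move=> h; elim/big_rec2: _ => [|i a b _ <-]; rewrite ?(lin_0 h) ?(lin_D h).
Qed.

Lemma mxabsD m n (A B : 'M[R]_(m, n)) : mxabs (A + B) <= mxabs A + mxabs B.
Proof.
rewrite /mxabs -big_split; apply: ler_sum => i _ /=.
by rewrite -big_split; apply: ler_sum => j _ /=; rewrite mxE ler_normD.
Qed.
Lemma mxabsZ m n a (A : 'M[R]_(m, n)) : mxabs (a *: A) = `|a| * mxabs A.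
Proof.
rewrite /mxabs mulr_sumr; apply: eq_bigr => i _.
by rewrite mulr_sumr; apply: eq_bigr => j _; rewrite mxE normrM.
Qed.
Lemma mxabsN m n (A : 'M[R]_(m, n)) : mxabs (- A) = mxabs A.
Proof. by rewrite -scaleN1r mxabsZ normrN1 mul1r. Qed.
Lemma mxabs0 m n : mxabs (0 : 'M[R]_(m, n)) = 0.
Proof. by rewrite /mxabs big1 // => i _; rewrite big1 // => j _; rewrite mxE normr0. Qed.
Lemma mxabs_sum m n I (r : seq I) (F : I -> 'M[R]_(m, n)) :
  mxabs (\sum_(i <- r) F i) <= \sum_(i <- r) mxabs (F i).
Proof.
elim/big_rec2: _ => [|i a b _ h]; first by rewrite mxabs0.
by rewrite (le_trans (mxabsD _ _)) // lerD2l.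
Qed.
Lemma mxabs_entry m n (A : 'M[R]_(m, n)) i j : `|A i j| <= mxabs A.
Proof.
rewrite /mxabs (bigD1 i) //= (bigD1 j) //= -addrA lerDl.
by rewrite addr_ge0 // sumr_ge0 // => k _; rewrite sumr_ge0.
Qed.
Lemma mxabs_eq0 m n (A : 'M[R]_(m, n)) : mxabs A = 0 -> A = 0.
Proof.
move=> h; apply/matrixP => i j; rewrite mxE; apply/eqP.
by rewrite -normr_le0 -h mxabs_entry.
Qed.
Lemma mxabs_small m n (A : 'M[R]_(m, n)) :
  (forall e, 0 < e -> mxabs A <= e) -> A = 0.
Proof.
move=> h; apply: mxabs_eq0; apply/eqP; rewrite eq_le mxabs_ge0 andbT.
by apply/ler_addgt0Pl => e e0; rewrite addr0 h.
Qed.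

Lemma lin_mxabs m n p q (f : 'M[R]_(m, n) -> 'M[R]_(p, q)) : linear f ->
  exists2 c, 0 <= c & forall D, mxabs (f D) <= c * mxabs D.
Proof.
move=> lf; exists (\sum_i \sum_j mxabs (f (delta_mx i j))).
  by apply: sumr_ge0 => i _; apply: sumr_ge0 => j _; exact: mxabs_ge0.
move=> D; rewrite {1}[D]matrix_sum_delta (lin_sum _ _ _ lf) mulr_suml.
apply: (le_trans (mxabs_sum _ _)); apply: ler_sum => i _.
rewrite (lin_sum _ _ _ lf) mulr_suml.
apply: (le_trans (mxabs_sum _ _)); apply: ler_sum => j _.
by rewrite (lin_Z _ lf) mxabsZ mulrC ler_wpM2l ?mxabs_ge0 // mxabs_entry.
Qed.

Lemma inj_unitmx n (A : 'M[R]_n) : (forall s : 'cV_n, A *m s = 0 -> s = 0) -> A \in unitmx.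
Proof.
move=> h; rewrite -unitmx_tr -row_free_unit -kermx_eq0; apply/eqP/row_matrixP => i.
rewrite row0; set u := row i _; have uA : u *m A^T = 0 by apply/sub_kermxP; rewrite row_sub.
by apply: trmx_inj; rewrite trmx0; apply: h; apply: trmx_inj; rewrite trmx_mul trmxK trmx0.
Qed.

Lemma svec_linear n : linear (@svec R n).
Proof.
move=> a u v; apply/colP => p; rewrite !mxE; case: (lowpos p) => i j.
by case: ifP => _; rewrite !mxE // mulrDr mulrCA.
Qed.

Lemma smat_linear n : linear (@smat R n).
Proof.
move=> a u v; rewrite /smat scaler_sumr -big_split; apply: eq_bigr => p _ /=.
by rewrite !mxE scalerDl scalerA.
Qed.

Definition symmap m n (L : 'M[R]_m -> 'M[R]_n) := forall X, symmx X -> symmx (L X).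
Definition psdmap m n (L : 'M[R]_m -> 'M[R]_n) := forall X, psdmx X -> psdmx (L X).

Lemma psdmap_lemx m n (L : 'M[R]_m -> 'M[R]_n) A B :
  linear L -> psdmap L -> lemx A B -> lemx (L A) (L B).
Proof. by move=> l h /h; rewrite /lemx (lin_B l). Qed.

(** In [svec] coordinates [G] is a square matrix, which injectivity on symmetric matrices makes
    invertible. [F] is the inverse and [b] a bound for it. *)
Lemma inj_sym_bound n (G : 'M[R]_n -> 'M[R]_n) : linear G -> symmap G ->
  (forall X, symmx X -> G X = 0 -> X = 0) ->
  exists F : 'M[R]_n -> 'M[R]_n, exists b, [/\ 0 <= b,
    forall X, symmx X -> mxabs X <= b * mxabs (G X) &
    forall Y, symmx Y -> symmx (F Y) /\ G (F Y) = Y].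
Proof.
move=> lG sG iG.
pose A : 'M[R]_(sdim n) := \matrix_(p, q) svec (G (sbasis q)) p 0.
have AE s : A *m s = svec (G (smat s)).
  apply/colP => p; rewrite /smat (lin_sum _ _ _ lG) (lin_sum _ _ _ (@svec_linear n)).
  rewrite mxE summxE; apply: eq_bigr => q _.
  by rewrite (lin_Z _ lG) (lin_Z _ (@svec_linear n)) [A p q]mxE [RHS]mxE mulrC.
have uA : A \in unitmx.
  apply: inj_unitmx => s; rewrite AE => h.
  have h2 : G (smat s) = 0.
    rewrite -[LHS]smat_svec ?h ?(lin_0 (@smat_linear n)) //.
    exact/sG/smat_sym.
  by rewrite -[s]svec_smat (iG _ _ h2) ?(lin_0 (@svec_linear n)) //; exact: smat_sym.
pose F Y := smat (invmx A *m svec Y).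
have lF : linear F.
  by move=> a u v; rewrite /F (svec_linear a u v) mulmxDr -scalemxAr smat_linear.
have FG X : symmx X -> F (G X) = X.
  move=> sX; rewrite /F -[X in G X]smat_svec // -AE mulKmx //.
  by rewrite smat_svec.
have [b b0 hb] := lin_mxabs lF.
exists F, b; split => // [X sX|Y sY]; first by rewrite -{1}(FG X sX).
split; first exact: smat_sym.
have sF : symmx (F Y) by exact: smat_sym.
rewrite -[LHS]smat_svec; last exact: sG.
by rewrite /F -AE mulKVmx // smat_svec.
Qed.
End LinearMaps.

Section SpectralRadius.
Context {R : realType}.
Variables (n : nat) (L : 'M[R]_n -> 'M[R]_n).
Hypotheses (lL : linear L) (sL : symmap L) (pL : psdmap L).

Lemma normcE (z : R[i]) :
  ComplexField.Normc.normc z = Num.sqrt (complex.Re z ^+ 2 + complex.Im z ^+ 2).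
Proof. by case: z. Qed.

Lemma normc_Re_le (z : R[i]) : `|complex.Re z| <= ComplexField.Normc.normc z.
Proof. by rewrite normcE -sqrtr_sqr ler_wsqrtr // lerDl sqr_ge0. Qed.
Lemma normc_Im_le (z : R[i]) : `|complex.Im z| <= ComplexField.Normc.normc z.
Proof. by rewrite normcE -sqrtr_sqr ler_wsqrtr // lerDr sqr_ge0. Qed.

Lemma normc_le_ReIm (z : R[i]) :
  ComplexField.Normc.normc z <= `|complex.Re z| + `|complex.Im z|.
Proof.
rewrite normcE -[leRHS]ger0_norm ?addr_ge0 // -[leRHS]sqrtr_sqr.
apply: ler_wsqrtr; rewrite sqrrD !real_normK ?num_real //.
by rewrite addrAC lerDl mulrn_wge0 // mulr_ge0.
Qed.

(** Makes the moduli bounded above, so that [spectral_radius] is not the default value of [sup]. The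
    bound compares l1 norms of an eigenvector and of its image, real and imaginary parts
    separately. *)
Lemma sym_eigenvalue_bounded : exists c, forall l, sym_eigenvalue L l ->
  ComplexField.Normc.normc l <= c.
Proof.
have [c c0 hc] := lin_mxabs lL; exists (2 * c) => l [X [X0 _ e]].
pose s := \sum_i \sum_j ComplexField.Normc.normc (X i j).
have nc0 z : 0 <= ComplexField.Normc.normc (z : R[i]) by rewrite normcE sqrtr_ge0.
have s0 : 0 < s.
  rewrite lt_neqAle eq_sym; apply/andP; split; last first.
    by apply: sumr_ge0 => i _; apply: sumr_ge0.
  apply: contra X0 => /eqP sE; apply/eqP/matrixP => i j; rewrite mxE.
  apply: ComplexField.Normc.eq0_normc; apply/eqP; rewrite eq_le nc0 andbT -sE.
  rewrite /s (bigD1 i) //= (bigD1 j) //= -addrA lerDl.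
  by rewrite addr_ge0 // sumr_ge0 // => k _; rewrite sumr_ge0.
rewrite -(ler_pM2r s0) {1}/s mulr_sumr.
set X1 := map_mx (@complex.Re R) X; set X2 := map_mx (@complex.Im R) X.
have b1 : mxabs X1 <= s.
  by apply: ler_sum => i _; apply: ler_sum => j _; rewrite mxE normc_Re_le.
have b2 : mxabs X2 <= s.
  by apply: ler_sum => i _; apply: ler_sum => j _; rewrite mxE normc_Im_le.
have h1 : mxabs (L X1) <= c * s by apply: le_trans (hc _) _; rewrite ler_wpM2l.
have h2 : mxabs (L X2) <= c * s by apply: le_trans (hc _) _; rewrite ler_wpM2l.
apply: (@le_trans _ _ (mxabs (L X1) + mxabs (L X2))); last by lra.
rewrite /mxabs -big_split; apply: ler_sum => i _ /=.
rewrite mulr_sumr -big_split; apply: ler_sum => j _ /=.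
rewrite -ComplexField.Normc.normcM.
have -> : l * X i j = complexify L X i j by rewrite e mxE.
apply: (le_trans (normc_le_ReIm _)); rewrite /complexify !mxE -/X1 -/X2 /=.
by rewrite !mul0r !mul1r subr0 addr0 !add0r.
Qed.

(** All that is drawn from the spectral radius: for a positive map, the absence of real eigenvalues
    from 1 on already yields a Lyapunov certificate. *)
Lemma no_real_eigenvalue X l : spectral_radius L < 1 -> symmx X -> 1 <= l ->
  L X = l *: X -> X = 0.
Proof.
move=> rL sX l1 e; apply/eqP/negPn/negP => X0.
have el : sym_eigenvalue L (l%:C)%C.
  exists (map_mx (real_complex R) X); split.
  - by apply: contra X0 => /eqP/matrixP h; apply/eqP/matrixP => i j; have := h i j;
      rewrite !mxE => -[].
  - by rewrite map_trmx sX.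
  apply/matrixP => i j; rewrite !mxE /=.
  have -> : map_mx (@complex.Re R) (map_mx (real_complex R) X) = X.
    by apply/matrixP => a b; rewrite !mxE.
  have -> : map_mx (@complex.Im R) (map_mx (real_complex R) X) = 0.
    by apply/matrixP => a b; rewrite !mxE.
  by rewrite (lin_0 lL) e !mxE mulr0 addr0 rmorphM.
have [c hc] := sym_eigenvalue_bounded.
have : l <= spectral_radius L.
  apply: ub_le_sup; first by exists c => _ [k /= hk <-]; exact: hc.
  exists (l%:C)%C => //=; rewrite expr0n addr0 sqrtr_sqr ger0_norm //; lra.
by move=> /le_lt_trans/(_ rL); lra.
Qed.

Let Lam l := exists2 X, psdmx X & lemx (1%:M + L X) (l *: X).

(** Iterating [l^-1 *: (1%:M + L Y)] from 0 increases and stays below the solution of the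
    inequality; the limit is a fixed point. *)
Let Lam_eq l : 0 < l -> Lam l -> exists2 Y, psdmx Y & l *: Y = 1%:M + L Y.
Proof.
move=> l0 [X pX hX]; have [c c0 hc] := lin_mxabs lL.
pose T Y := l^-1 *: (1%:M + L Y).
have T_mono A B : lemx A B -> lemx (T A) (T B).
  move=> h; apply: lemxZ; first by rewrite invr_ge0 ltW.
  by apply: lemxD; [exact: lemx_refl|exact: psdmap_lemx].
pose S k := iter k T 0.
have S1 : lemx (S 0%N) (S 1%N).
  apply: lemx0; apply: psdZ; first by rewrite invr_ge0 ltW.
  by rewrite (lin_0 lL) addr0; exact: psd_scalar.
have Sm k : lemx (S k) (S k.+1) by elim: k => // k IH; exact: T_mono.
have TX : lemx (T X) X.
  have := @lemxZ _ _ l^-1 _ _ _ hX; rewrite scalerA mulVf ?gt_eqF // scale1r.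
  by apply; rewrite invr_ge0 ltW.
have SX k : lemx (S k) X.
  elim: k => [|k IH]; first exact: lemx0.
  by apply: lemx_trans TX; exact: T_mono.
have [Y [sY SY eY]] := mono_mx_cvg (@symmx0 R n) Sm SX.
exists Y; first by apply: lemx_psd (SY 0%N); exact: psd0.
apply/subr0_eq; apply: mxabs_small => e e0.
pose e' := e / (l + c).
have lc : 0 < l + c by lra.
have [K hK] := eY e' (divr_gt0 e0 lc).
have h1 := hK K (leqnn K); have h2 := hK K.+1 (leqnSn K).
have -> : l *: Y - (1%:M + L Y) = l *: (Y - S K.+1) - L (Y - S K).
  rewrite [S K.+1]/= -/(S K) scalerBr scalerA mulfV ?gt_eqF // scale1r (lin_B lL).
  by apply/matrixP => i j; rewrite !mxE; ring.
apply: (le_trans (mxabsD _ _)); rewrite mxabsN mxabsZ gtr0_norm //.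
have -> : e = l * e' + c * e' by rewrite /e'; field; lra.
apply: lerD; first by rewrite ler_pM2l.
by apply: (le_trans (hc _)); rewrite ler_wpM2l.
Qed.

(* The least l >= 1 for which l X - L X >= 1 is solvable must be 1: there
   l - L is invertible, so the solutions for l + h converge to a solution for l,
   and strict positivity lets l decrease further. *)
Lemma spectral_radius_lyapunov : spectral_radius L < 1 ->
  exists2 X, psdmx X & lemx (1%:M + L X) X.
Proof.
move=> rL; pose E := [set l | 1 <= l /\ Lam l].
have E0 : E !=set0.
  exists (mxabs (L 1%:M) + 1); split; first by rewrite lerDr mxabs_ge0.
  exists 1%:M; first exact: psd_scalar.
  rewrite addrC scalerDl scale1r; apply: lemxD; last exact: lemx_refl.
  by rewrite scale_scalar_mx mulr1; apply/symmx_lemxabs/sL/symmx_scalar.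
have lbE : has_lbound E by exists 1 => l [].
pose l := inf E.
have l1 : 1 <= l by apply: lb_le_inf => // k [].
have lG : linear (fun X => l *: X - L X).
  by move=> a u v; rewrite lL scalerDr !scalerBr !scalerA [l * a]mulrC opprD addrACA.
have sG : symmap (fun X => l *: X - L X).
  by move=> X sX; apply: symmxB; [exact: symmxZ|exact: sL].
have [F [b [b0 hb hF]]] : exists F : 'M[R]_n -> 'M[R]_n, exists b, [/\ 0 <= b,
    forall X, symmx X -> mxabs X <= b * mxabs (l *: X - L X) &
    forall Y, symmx Y -> symmx (F Y) /\ l *: F Y - L (F Y) = Y].
  apply: inj_sym_bound => // X sX /subr0_eq h.
  by apply: (no_real_eigenvalue rL sX l1); rewrite h.
have [sX eX] := hF _ (@symmx_scalar R n 1); set X := F _ in sX eX.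
have {}eX : l *: X = 1%:M + L X by rewrite -eX subrK.
(* For [k] slightly above [l] the solution [Y] is positive, and the inverse bound [hb] controls
   [Y - X] by [b * (k - l) * mxabs Y]. *)
have pX : psdmx X.
  split=> // x; rewrite -/(qf _ _); apply/ler_addgt0Pr => e e0.
  pose m := mxabs X; have m0 : 0 <= m := mxabs_ge0 X.
  pose w := dot x x; have w0 : 0 <= w := dot_ge0 x.
  (* The first bound gives [b * h <= 1/2], hence [mxabs Y <= 2 * m]; the second makes the error in
     the quadratic form at most [e]. *)
  pose h := Num.min (2 * (b + 1))^-1 (e / (2 * (b + 1) * (m + 1) * (w + 1))).
  have h0 : 0 < h.
    by rewrite lt_min invr_gt0 divr_gt0 // ?mulr_gt0 //; lra.
  have [k [k1 Lk] kh] : exists2 k, E k & k < l + h by exact: inf_adherent.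
  have lk : l <= k by apply: ge_inf => //; split.
  have k0 : 0 < k by lra.
  have [Y pY eY] := Lam_eq k0 Lk.
  have sY := psd_sym pY.
  have dE : l *: (Y - X) - L (Y - X) = - ((k - l) *: Y).
    rewrite scalerBr (lin_B lL) eX scalerBl eY.
    by rewrite !opprD !opprK !addrA; apply/matrixP => i j; rewrite !mxE; ring.
  have d1 := hb _ (symmxB sY sX); rewrite dE mxabsN mxabsZ in d1.
  have kl : `|k - l| <= h by rewrite ger0_norm; lra.
  have d2 : mxabs (Y - X) <= b * h * mxabs Y.
    apply: (le_trans d1); rewrite -mulrA ler_wpM2l // ler_wpM2r ?mxabs_ge0 //.
  have d3 : mxabs Y <= mxabs (Y - X) + m.
    by rewrite -{1}[Y](subrK X) mxabsD.
  have bh : b * h <= 2^-1.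
    apply: (@le_trans _ _ (b * (2 * (b + 1))^-1)).
      by rewrite ler_wpM2l // ge_min lexx.
    by rewrite ler_pdivrMr; lra.
  have d4 : mxabs Y <= 2 * m.
    have : b * h * mxabs Y <= 2^-1 * mxabs Y by rewrite ler_wpM2r ?mxabs_ge0.
    have := mxabs_ge0 Y; lra.
  have d5 : mxabs (Y - X) * w <= e.
    have a1 : b * h * (2 * m) * w <= b * (e / (2 * (b + 1) * (m + 1) * (w + 1))) * (2 * m) * w.
      by rewrite ler_wpM2r // ler_wpM2r ?mulr_ge0 // ler_wpM2l // ge_min lexx orbT.
    have a2 : b * (e / (2 * (b + 1) * (m + 1) * (w + 1))) * (2 * m) * w
       = e * (b / (b + 1)) * (m / (m + 1)) * (w / (w + 1)).
      by field; lra.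
    have fr (t : R) : 0 <= t -> 0 <= t / (t + 1) <= 1.
      by move=> t0; apply/andP; split; [apply: divr_ge0|rewrite ler_pdivrMr]; lra.
    have a3 : e * (b / (b + 1)) * (m / (m + 1)) * (w / (w + 1)) <= e.
      have /andP[u1 u2] := fr _ b0; have /andP[v1 v2] := fr _ m0; have /andP[y1 y2] := fr _ w0.
      rewrite -(mulrA e) -(mulrA e) ger_pMr //.
      by apply: mulr_ile1 => //; [exact: mulr_ge0|exact: mulr_ile1].
    apply: le_trans a3; rewrite -a2; apply: le_trans a1.
    rewrite ler_wpM2r //; apply: (le_trans d2); rewrite ler_wpM2l // mulr_ge0 //; lra.
  have q1 := psd_qf x pY.
  have := lemx_qf x (symmx_lemxabs (symmxB sY sX)); rewrite qfBl qf_scalar -/w.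
  by lra.
have [/eqP l1'|l1'] := boolP (l == 1).
  by exists X => //; rewrite -eX l1' scale1r; exact: lemx_refl.
have {}l1' : 1 < l by rewrite lt_neqAle eq_sym l1'.
(* At level [l] the matrix [2 *: X] satisfies the inequality with slack [1%:M]; lowering the level
   by [h] costs [(h * 2) *: X], which is at most that slack. *)
pose h := Num.min (l - 1) (2 * (mxabs X + 1))^-1.
have m0 := mxabs_ge0 X.
have h0 : 0 < h by rewrite lt_min invr_gt0; apply/andP; split; lra.
have : E (l - h).
  have hh : h <= l - 1 by rewrite ge_min lexx.
  split; first lra.
  exists (2 *: X); first exact: psdZ.
  have -> : (l - h) *: (2 *: X) = 2 *: (1%:M + L X) - (h * 2) *: X.
    by rewrite -eX !scalerA -scalerBl; congr (_ *: _); ring.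
  rewrite (lin_Z _ lL) scalerDr addrAC.
  apply: lemxD; last exact: lemx_refl.
  apply: lemxP => [||x].
  - exact: symmx_scalar.
  - by apply: symmxB; [exact/symmxZ/symmx_scalar|exact: symmxZ].
  rewrite qfBl !qfZl !qf_scalar.
  have hx : h <= (2 * (mxabs X + 1))^-1 by rewrite ge_min lexx orbT.
  have qx := lemx_qf x (symmx_lemxabs sX); rewrite qf_scalar in qx.
  have w0 := dot_ge0 x.
  have u1 : h * 2 * qf X x <= h * 2 * (mxabs X * dot x x).
    by rewrite ler_wpM2l // mulr_ge0 // ltW.
  have u2 : h * 2 * (mxabs X * dot x x) <= (2 * (mxabs X + 1))^-1 * 2 * (mxabs X * dot x x).
    by rewrite ler_wpM2r ?mulr_ge0 // ler_wpM2r.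
  have u3 : (2 * (mxabs X + 1))^-1 * 2 * (mxabs X * dot x x) <= dot x x.
    have -> : (2 * (mxabs X + 1))^-1 * 2 * (mxabs X * dot x x)
       = mxabs X / (mxabs X + 1) * dot x x by field; lra.
    by apply: ler_piMl => //; rewrite ler_pdivrMr; lra.
  lra.
move=> /(ge_inf lbE); rewrite -/l; lra.
Qed.
End SpectralRadius.

(** * Riccati equation *)

Section MomentMaps.
Context {R : realType}.
Variables (nx nu nw : nat).
Variable M : 'I_nw -> 'M[R]_(nx, nx + nu).
Implicit Types (W : 'M[R]_nw) (P : 'M[R]_nx) (Z : 'M[R]_(nx + nu)).

(* The adjoint of [momE M W] for the trace pairing; its blocks are adjF, adjH and adjG. *)
Definition madj W P : 'M[R]_(nx + nu) :=
  \sum_k \sum_l W k l *: ((M k)^T *m P *m M l).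

Lemma madj_linear W : linear (madj W).
Proof.
move=> a u v; rewrite /madj scaler_sumr -big_split; apply: eq_bigr => k _ /=.
rewrite scaler_sumr -big_split; apply: eq_bigr => l _ /=.
by rewrite mulmxDr mulmxDl -scalemxAr -scalemxAl scalerDr !scalerA [W k l * a]mulrC.
Qed.

Lemma madj_linearW P : linear (madj^~ P).
Proof.
move=> a u v; rewrite /madj scaler_sumr -big_split; apply: eq_bigr => k _ /=.
rewrite scaler_sumr -big_split; apply: eq_bigr => l _ /=.
by rewrite !mxE scalerDl scalerA.
Qed.

Lemma momE_linear W : linear (momE M W).
Proof.
move=> a u v; rewrite /momE scaler_sumr -big_split; apply: eq_bigr => k _ /=.
rewrite scaler_sumr -big_split; apply: eq_bigr => l _ /=.
by rewrite mulmxDr mulmxDl -scalemxAr -scalemxAl scalerDr !scalerA [W k l * a]mulrC.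
Qed.

Lemma symmx_swap n (A : 'M[R]_n) i j : symmx A -> A i j = A j i.
Proof. by move=> sA; rewrite -[in LHS]sA mxE. Qed.

Lemma madj_sym W : symmx W -> symmap (madj W).
Proof.
move=> sW P sP; rewrite /symmx /madj linear_sum /= [RHS]exchange_big /=.
apply: eq_bigr => k _; rewrite linear_sum /=; apply: eq_bigr => l _.
by rewrite linearZ /= !trmx_mul trmxK sP mulmxA (symmx_swap k l sW).
Qed.

Lemma mxtrace_momE W Z P : symmx W -> \tr (momE M W Z *m P) = \tr (Z *m madj W P).
Proof.
move=> sW.
have -> : \tr (Z *m madj W P) = \sum_l \sum_k W l k * \tr (Z *m ((M l)^T *m P *m M k)).
  rewrite /madj mulmx_sumr linear_sum /=; apply: eq_bigr => k _.
  rewrite mulmx_sumr linear_sum /=; apply: eq_bigr => l _.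
  by rewrite -scalemxAr linearZ.
rewrite /momE mulmx_suml linear_sum [RHS]exchange_big /=; apply: eq_bigr => k _.
rewrite mulmx_suml linear_sum /=; apply: eq_bigr => l _.
rewrite -scalemxAl linearZ /= (symmx_swap l k sW); congr (_ * _).
by rewrite -!mulmxA mxtrace_mulC !mulmxA.
Qed.

Lemma madj_rank1 (a : 'cV[R]_nw) P :
  madj (a *m a^T) P =
  (\sum_k a k 0 *: M k)^T *m P *m (\sum_k a k 0 *: M k).
Proof.
have -> : (\sum_k a k 0 *: M k)^T = \sum_k a k 0 *: (M k)^T.
  by rewrite linear_sum; apply: eq_bigr => k _; rewrite linearZ.
rewrite mulmx_suml mulmx_suml; apply: eq_bigr => k _.
rewrite mulmx_sumr; apply: eq_bigr => l _.
rewrite -!scalemxAl -scalemxAr scalerA; congr (_ *: _).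
by rewrite mxE big_ord1 !mxE.
Qed.

Lemma madj_psd W : psdmx W -> psdmap (madj W).
Proof.
move=> /psd_rank1_sum[s ->] P pP; rewrite (lin_sum _ _ _ (madj_linearW P)).
by apply: psd_sum => v _; rewrite madj_rank1; exact: psd_congr.
Qed.

Lemma momE_sym W : symmx W -> symmap (momE M W).
Proof.
move=> sW P sP; rewrite /symmx /momE linear_sum /= [RHS]exchange_big /=.
apply: eq_bigr => k _; rewrite linear_sum /=; apply: eq_bigr => l _.
by rewrite linearZ /= !trmx_mul trmxK sP mulmxA (symmx_swap k l sW).
Qed.

(** By the trace duality, tested on rank-one matrices. Positivity is asked of the adjoint map rather
    than of [W]. *)
Lemma momE_psd W : symmx W -> psdmap (madj W) -> psdmap (momE M W).
Proof.
move=> sW pW Z pZ; split; first exact/momE_sym/psd_sym.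
move=> x; rewrite -/(qf _ _) -mxtrace_rank1M mxtrace_momE //.
by apply: mxtrace_psdM => //; apply: pW; exact: psd_rank1.
Qed.

Lemma madj_block W P : symmx W -> symmx P ->
  madj W P = block_mx (adjF M W P) (adjH M W P)^T (adjH M W P) (adjG M W P).
Proof.
move=> sW sP.
have bE k l : (M k)^T *m P *m M l = block_mx
   ((modA M k)^T *m P *m modA M l) ((modA M k)^T *m P *m modB M l)
   ((modB M k)^T *m P *m modA M l) ((modB M k)^T *m P *m modB M l).
  rewrite -{1}[M k]hsubmxK -{1}[M l]hsubmxK tr_row_mx mul_col_mx mul_col_row.
  by [].
have sumE p q (f : 'M[R]_(nx + nu) -> 'M[R]_(p, q)) : linear f ->
    f (madj W P) = \sum_k \sum_l W k l *: f ((M k)^T *m P *m M l).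
  move=> lf; rewrite /madj (lin_sum _ _ _ lf); apply: eq_bigr => k _.
  by rewrite (lin_sum _ _ _ lf); apply: eq_bigr => l _; rewrite (lin_Z _ lf).
rewrite -[LHS]submxK; congr block_mx.
- rewrite sumE => [|a u v]; last by apply/matrixP => i j; rewrite !mxE.
  by apply: eq_bigr => k _; apply: eq_bigr => l _; rewrite bE block_mxKul.
- rewrite sumE => [|a u v]; last by apply/matrixP => i j; rewrite !mxE.
  rewrite exchange_big /adjH linear_sum /=; apply: eq_bigr => k _; rewrite linear_sum /=.
  apply: eq_bigr => l _; rewrite linearZ /= bE block_mxKur !trmx_mul trmxK sP mulmxA.
  by rewrite (symmx_swap l k sW).
- rewrite sumE => [|a u v]; last by apply/matrixP => i j; rewrite !mxE.
  by apply: eq_bigr => k _; apply: eq_bigr => l _; rewrite bE block_mxKdl.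
- rewrite sumE => [|a u v]; last by apply/matrixP => i j; rewrite !mxE.
  by apply: eq_bigr => k _; apply: eq_bigr => l _; rewrite bE block_mxKdr.
Qed.

Definition cl (K : 'M[R]_(nu, nx)) (S : 'M[R]_(nx + nu)) : 'M[R]_nx :=
  (col_mx 1%:M K)^T *m S *m col_mx 1%:M K.

Lemma cl_linear K : linear (cl K).
Proof. by move=> a u v; rewrite /cl mulmxDr mulmxDl -scalemxAr -scalemxAl. Qed.

Lemma cl_sym K : symmap (cl K).
Proof. by move=> X; exact: symmx_congr. Qed.

Lemma cl_psd K : psdmap (cl K).
Proof. by move=> X; exact: psd_congr. Qed.

Lemma qf_cl K S x : qf (cl K S) x = qf S (col_mx x (K *m x)).
Proof. by rewrite qf_congr mul_col_mx mul1mx. Qed.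

Lemma cl_block K a b c d : cl K (block_mx a b c d) = a + b *m K + K^T *m c + K^T *m d *m K.
Proof.
rewrite /cl tr_col_mx trmx1 mul_row_block mul_row_col !mul1mx mulmx1 mulmxDl.
by rewrite !addrA [a + _ + _]addrAC.
Qed.

Lemma dot_col_mx m n (a c : 'cV[R]_m) (b e : 'cV[R]_n) :
  dot (col_mx a b) (col_mx c e) = dot a c + dot b e.
Proof. by rewrite /dot tr_col_mx mul_row_col mxE. Qed.

Variables (Qx : 'M[R]_nx) (Ru : 'M[R]_nu).
Hypothesis pdH : pdmx (block_mx Qx 0 0 Ru).
Let Hc := block_mx Qx 0 0 Ru.

Lemma mxtrace_cl_momEK K W P X : symmx W ->
  \tr (cl K (madj W P) *m X) = \tr (P *m momEK M K W X).
Proof.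
move=> sW; rewrite [RHS]mxtrace_mulC /momEK mxtrace_momE // /Defs.liftK /cl.
have -> : row_mx 1%:M K^T = (col_mx 1%:M K)^T by rewrite tr_col_mx trmx1.
by rewrite -(mulmxA _ (col_mx _ _) X) mxtrace_mulC !mulmxA.
Qed.

(** Policy evaluation: stage cost plus expected cost-to-go [P] under the fixed feedback [K]. *)
Definition Jmap W K P := cl K (Hc + madj W P).
Definition kgain W P := - (invmx (Ru + adjG M W P) *m adjH M W P).
(** Weaker than [psdmx W]. It suffices for the Riccati theory and is inherited by a symmetric matrix
    with a larger adjoint map, even when that matrix is not known to be positive. *)
Definition posnoise W := symmx W /\ psdmap (madj W).

Lemma adjGE W P : adjG M W P = drsubmx (madj W P).
Proof.
rewrite /madj (lin_sum _ _ _ (_ : linear (@drsubmx R nx nu nx nu))); last first.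
  by move=> a u v; apply/matrixP => i j; rewrite !mxE.
apply: eq_bigr => k _; rewrite (lin_sum _ _ _ (_ : linear (@drsubmx R nx nu nx nu))); last first.
  by move=> a u v; apply/matrixP => i j; rewrite !mxE.
apply: eq_bigr => l _; rewrite (lin_Z _ (_ : linear (@drsubmx R nx nu nx nu))); last first.
  by move=> a u v; apply/matrixP => i j; rewrite !mxE.
congr (_ *: _); rewrite -{1}[M k]hsubmxK -{1}[M l]hsubmxK tr_row_mx mul_col_mx mul_col_row.
by rewrite block_mxKdr.
Qed.

Lemma qf_dr (S : 'M[R]_(nx + nu)) y : qf (drsubmx S) y = qf S (col_mx 0 y).
Proof. by rewrite qf_row !mulmx0 dot0r dotC dot0r !qfE mulmx0 dot0r !add0r. Qed.

Lemma Hc_madj_pd W P : posnoise W -> psdmx P -> pdmx (Hc + madj W P).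
Proof. by move=> [_ pW] pP; apply: pd_lemx pdH _; apply: lemx_addr; exact: pW. Qed.

Lemma RuG_E W P : Ru + adjG M W P = drsubmx (Hc + madj W P).
Proof.
have -> : drsubmx (Hc + madj W P) = drsubmx Hc + drsubmx (madj W P).
  by apply/matrixP => i j; rewrite !mxE.
by rewrite block_mxKdr adjGE.
Qed.

Lemma RuG_pd W P : posnoise W -> psdmx P -> pdmx (Ru + adjG M W P).
Proof.
move=> nW pP; rewrite RuG_E; have [sS pS] := Hc_madj_pd nW pP; split.
  by rewrite /symmx trmx_drsub sS.
move=> y y0; rewrite -/(qf _ _) qf_dr; apply: pS; apply: contra y0 => /eqP.
by move=> /(congr1 (@dsubmx _ _ _ _)); rewrite col_mxKd linear0 => ->.
Qed.

(** Completion of the square in [K]. The price of a wrong gain is quadratic in its error, which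
    turns an estimation error of order 1 / sqrt N into a gap of order 1 / N. *)
Lemma Jmap_square W P K : posnoise W -> psdmx P ->
  Jmap W K P = riccati M Qx Ru W P
    + (K - kgain W P)^T *m (Ru + adjG M W P) *m (K - kgain W P).
Proof.
move=> nW pP; have [sW _] := nW; have sP := psd_sym pP.
have pS := RuG_pd nW pP; have uS := pd_unit pS; have [sS _] := pS.
rewrite /Jmap /Hc madj_block // add_block_mx !add0r cl_block /riccati /kgain.
set S := Ru + _ in uS sS *; set H := adjH _ _ _; rewrite opprK; clearbody S H.
have -> : (K + invmx S *m H)^T = K^T + H^T *m invmx S.
  by rewrite linearD /= trmx_mul trmx_inv sS.
have -> : (K^T + H^T *m invmx S) *m S = K^T *m S + H^T.
  by rewrite mulmxDl mulmxKV.
have -> : (K^T *m S + H^T) *m (K + invmx S *m H)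
    = K^T *m S *m K + K^T *m H + H^T *m K + H^T *m invmx S *m H.
  have e3 : K^T *m S *m (invmx S *m H) = K^T *m H by rewrite -mulmxA mulKVmx.
  by rewrite mulmxDl !mulmxDr e3 !mulmxA !addrA.
set a := K^T *m S *m K; set b := K^T *m H; set e := _ *m K; set f := _ *m H.
by apply/matrixP => i j; rewrite !mxE; ring.
Qed.

Lemma Jmap_kgain W P : posnoise W -> psdmx P ->
  Jmap W (kgain W P) P = riccati M Qx Ru W P.
Proof. by move=> nW pP; rewrite Jmap_square // subrr trmx0 !mul0mx addr0. Qed.

Lemma riccati_le_J W P K : posnoise W -> psdmx P ->
  lemx (riccati M Qx Ru W P) (Jmap W K P).
Proof.
move=> nW pP; rewrite Jmap_square //; apply: lemx_addr; apply: psd_congr.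
exact/pd_psd/RuG_pd.
Qed.

Lemma Jmap_mono W K P P' : posnoise W -> lemx P P' -> lemx (Jmap W K P) (Jmap W K P').
Proof.
move=> [_ pW] h; apply: (psdmap_lemx (@cl_linear K) (@cl_psd K)).
by apply: lemxD; [exact: lemx_refl|exact: (psdmap_lemx (madj_linear _))].
Qed.

Lemma Jmap_psd W K P : posnoise W -> psdmx P -> psdmx (Jmap W K P).
Proof. by move=> nW pP; apply: cl_psd; exact/pd_psd/Hc_madj_pd. Qed.

(** The Riccati operator is the minimum over [K] of the monotone maps [Jmap W K]; compare at the
    minimizer for [P']. *)
Lemma riccati_mono W P P' : posnoise W -> psdmx P -> lemx P P' ->
  lemx (riccati M Qx Ru W P) (riccati M Qx Ru W P').
Proof.
move=> nW pP h; have pP' := lemx_psd pP h.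
rewrite -(Jmap_kgain nW pP').
by apply: lemx_trans (riccati_le_J (kgain W P') nW pP) _; exact: Jmap_mono.
Qed.

Lemma riccati_psd W P : posnoise W -> psdmx P -> psdmx (riccati M Qx Ru W P).
Proof. by move=> nW pP; rewrite -Jmap_kgain //; exact: Jmap_psd. Qed.

(** The Lyapunov inequality for the moment map of [K], tested against positive [P]. In this dual
    form it involves [W] only through [madj W], so it passes to any [W] with a smaller adjoint
    map. *)
Definition stabilizable W := exists K X, psdmx X /\
  forall P, psdmx P -> \tr (cl K (madj W P) *m X) <= \tr (P *m X) - \tr P.

Lemma stabilizable_of_radius W K : posnoise W ->
  spectral_radius (momEK M K W) < 1 -> stabilizable W.
Proof.
move=> [sW pW] h; exists K.
have lE : linear (momEK M K W).
  move=> a u v; rewrite /momEK /Defs.liftK mulmxDr mulmxDl -scalemxAr -scalemxAl.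
  exact: momE_linear.
have eK X : Defs.liftK K X = (row_mx 1%:M K^T)^T *m X *m row_mx 1%:M K^T.
  by rewrite tr_row_mx trmx1 trmxK.
have sE : symmap (momEK M K W).
  by move=> X sX; apply: momE_sym => //; rewrite eK; exact: symmx_congr.
have pE : psdmap (momEK M K W).
  by move=> X pX; apply: momE_psd => //; rewrite eK; exact: psd_congr.
have [X pX hX] := spectral_radius_lyapunov lE sE pE h.
exists X; split => // P pP; rewrite mxtrace_cl_momEK //.
have := mxtrace_lemxM hX pP.
rewrite mulmxDl mul1mx linearD /= ![\tr (_ *m P)]mxtrace_mulC; lra.
Qed.

Lemma stabilizable_mono W W' : stabilizable W' ->
  (forall P, psdmx P -> lemx (madj W P) (madj W' P)) -> stabilizable W.
Proof.
move=> [K [X [pX hX]]] h; exists K, X; split => // P pP.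
apply: le_trans (hX P pP); apply: mxtrace_lemxM => //.
by apply: (psdmap_lemx (@cl_linear K) (@cl_psd K)); exact: h.
Qed.

(* Value iteration from 0 increases and is bounded, by the trace pairing with the
   Lyapunov certificate X. *)
Lemma riccati_exists W : posnoise W -> stabilizable W ->
  exists2 P, psdmx P & P = riccati M Qx Ru W P.
Proof.
move=> nW [K [X [pX hX]]]; have [sW pW] := nW.
pose S k := iter k (riccati M Qx Ru W) 0.
have pS k : psdmx (S k) by elim: k => [|k IH]; [exact: psd0|exact: riccati_psd].
have Sm k : lemx (S k) (S k.+1).
  by elim: k => [|k IH]; [exact/lemx0/pS|exact: riccati_mono].
have SE k : S k.+1 = riccati M Qx Ru W (S k) by [].
pose c := \tr (cl K Hc *m X).
(* Pair [S k <= S k.+1 <= Jmap W K (S k)] with [X]: the terms [\tr (S k *m X)] cancel and the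
   certificate leaves [\tr (S k)] below [c]. *)
have Sc k : \tr (S k) <= c.
  have h1 : \tr (riccati M Qx Ru W (S k) *m X) <= c + \tr (cl K (madj W (S k)) *m X).
    apply: le_trans (mxtrace_lemxM (riccati_le_J K nW (pS k)) pX) _.
    by rewrite /Jmap (lin_D (@cl_linear K)) mulmxDl mxtraceD.
  have h2 := hX _ (pS k).
  have h3 : \tr (S k *m X) <= \tr (riccati M Qx Ru W (S k) *m X).
    exact: mxtrace_lemxM (Sm k) pX.
  by lra.
have SU k : lemx (S k) c%:M.
  apply: lemx_trans (psd_le_tr (pS k)) _.
  by rewrite /lemx -raddfB; apply: psd_scalar; rewrite subr_ge0.
have [P [sP SP eP]] := mono_mx_cvg (@symmx0 R nx) Sm SU.
have pP : psdmx P by apply: lemx_psd (SP 0%N); exact: psd0.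
exists P => //; apply: lemx_anti.
  apply: lemxP => // [|x]; first exact/psd_sym/riccati_psd.
  apply/ler_addgt0Pr => e e0.
  have w0 : 0 < dot x x + 1 by have := dot_ge0 x; lra.
  have [k hk] := eP (e / (dot x x + 1)) (divr_gt0 e0 w0).
  have h1 := lemx_qf x (SP k.+1).
  have h2 := lemx_qf x (riccati_mono nW (pS k) (SP k)).
  have h3 := lemx_qf x (symmx_lemxabs (symmxB sP (psd_sym (pS k.+1)))).
  rewrite qf_scalar qfBl in h3.
  have h4 : mxabs (P - S k.+1) * dot x x <= e.
    apply: le_trans (_ : e / (dot x x + 1) * dot x x <= e).
      by rewrite ler_wpM2r ?dot_ge0 // hk.
    by rewrite mulrAC ler_pdivrMr // ler_pM2l // lerDl.
  by rewrite -SE in h2; lra.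
have [h h0 hH] := pd_ge pdH; have [m m0 hm] := lin_mxabs (madj_linear W).
apply: lemxP => // [|x]; first exact/psd_sym/riccati_psd.
apply/ler_addgt0Pr => e e0.
pose w := dot x x; have w0 : 0 <= w := dot_ge0 x.
have c0 : 0 <= c by apply: le_trans (Sc 0%N); rewrite linear0.
pose B := m * (c * w / h); have B0 : 0 <= B.
  by rewrite mulr_ge0 // divr_ge0 ?mulr_ge0 // ltW.
have B1 : 0 < B + 1 by lra.
have [k hk] := eP (e / (B + 1)) (divr_gt0 e0 B1).
(* Using the gain of the iterate instead of that of [P] costs only [madj W (P - S k)] at [z], and
   [z] is bounded uniformly in [k] because its stage cost is part of [qf (S k.+1) x]. *)
pose Kk := kgain W (S k); pose z := col_mx x (Kk *m x).
have h1 := lemx_qf x (riccati_le_J Kk nW pP).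
have h2 : qf (Jmap W Kk P) x = qf (S k.+1) x + qf (madj W (P - S k)) z.
  rewrite SE -(Jmap_kgain nW (pS k)) /Jmap -/Kk !qf_cl -/z !qfDl.
  rewrite (lin_B (madj_linear W)) qfBl; ring.
have h3 : qf (madj W (P - S k)) z <= mxabs (madj W (P - S k)) * dot z z.
  rewrite -qf_scalar; apply: lemx_qf; apply: symmx_lemxabs; apply: madj_sym => //.
  by apply: symmxB => //; exact/psd_sym/pS.
have h4 : h * dot z z <= c * w.
  have := lemx_qf x (SU k.+1); rewrite qf_scalar -/w.
  rewrite SE -(Jmap_kgain nW (pS k)) /Jmap -/Kk qf_cl -/z qfDl.
  have := lemx_qf z hH; rewrite qf_scalar.
  have := psd_qf z (pW _ (pS k)); rewrite /Hc; lra.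
have h5 : dot z z <= c * w / h by rewrite ler_pdivlMr // mulrC.
have h6 : mxabs (madj W (P - S k)) * dot z z <= e.
  apply: (@le_trans _ _ (m * (e / (B + 1)) * (c * w / h))).
    apply: ler_pM => //; [exact: mxabs_ge0|exact: dot_ge0|].
    by apply: le_trans (hm _) _; rewrite ler_wpM2l // hk.
  have -> : m * (e / (B + 1)) * (c * w / h) = e * (B / (B + 1)).
    by rewrite /B; ring.
  by apply: ler_piMr; [exact: ltW|rewrite ler_pdivrMr //; lra].
have := lemx_qf x (SP k.+1); move: h1 h2 h3 h6; lra.
Qed.
End MomentMaps.

(** * Perturbation of the controller *)

Section Contraction.
Context {R : realType}.

(** Comparison principle. The strict supersolution [P] is contracted by [f] with the factor
    [q = 1 - h / p], so [f D <= D] gives [D + (a * q ^+ k) *: P >= 0] for all [k] by induction; let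
    [k] tend to infinity. *)
Lemma contraction_psd n (f : 'M[R]_n -> 'M[R]_n) P D h : linear f -> psdmap f ->
  psdmx P -> 0 < h -> lemx (f P + h%:M) P -> symmx D -> lemx (f D) D -> psdmx D.
Proof.
move=> lf pf pP h0 hP sD hD; have sP := psd_sym pP.
have hp : lemx h%:M P.
  by apply: lemx_trans hP; rewrite addrC; apply: lemx_addr; exact: pf.
pose p := mxabs P + h; have p0 : 0 < p by rewrite /p; have := mxabs_ge0 P; lra.
pose q := 1 - h / p.
have q0 : 0 <= q by rewrite /q subr_ge0 ler_pdivrMr // mul1r /p lerDr mxabs_ge0.
have q1 : q < 1 by rewrite /q ltrBlDr ltrDl divr_gt0.
have fq : lemx (f P) (q *: P).
  apply: (@lemx_trans _ _ (P - h%:M)).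
    by have := lemxD hP (lemx_refl (- h%:M)); rewrite addrK.
  apply: lemxP; [by apply: symmxB => //; exact: symmx_scalar|exact: symmxZ|].
  move=> x; rewrite qfBl qf_scalar qfZl /q mulrBl mul1r lerD2l lerN2.
  rewrite mulrAC ler_pdivrMr // -mulrA ler_pM2l // [dot x x * _]mulrC.
  apply: le_trans (lemx_qf x (symmx_lemxabs sP)) _.
  by rewrite qf_scalar ler_wpM2r ?dot_ge0 // /p lerDl ltW.
pose a := mxabs D / h; have a0 : 0 <= a by rewrite divr_ge0 ?mxabs_ge0 ?ltW.
have hk k : psdmx (D + (a * q ^+ k) *: P).
  elim: k => [|k IH].
    rewrite expr0 mulr1; split; first by apply: symmxD => //; exact: symmxZ.
    move=> x; rewrite -/(qf _ _) qfDl qfZl.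
    have := lemx_qf x (opb_ge sD (opb_mxabs D)); rewrite -scaleN1r qfZl qf_scalar.
    have := lemx_qf x hp; rewrite qf_scalar => hx.
    have : a * (h * dot x x) <= a * qf P x by rewrite ler_wpM2l.
    have ah : a * h = mxabs D by rewrite /a mulfVK ?gt_eqF.
    by rewrite (mulrA a) ah; lra.
  have aq : 0 <= a * q ^+ k by rewrite mulr_ge0 // exprn_ge0.
  have h1 := psdD (psdD hD (pf _ IH)) (psdZ aq fq).
  rewrite (lin_D lf) (lin_Z _ lf) in h1.
  suff -> : D + (a * q ^+ k.+1) *: P =
     D - f D + (f D + (a * q ^+ k) *: f P) + (a * q ^+ k) *: (q *: P - f P) by [].
  by apply/matrixP => i j; rewrite !mxE exprS; ring.
split=> // x; rewrite -/(qf _ _); apply/ler_addgt0Pr => e e0.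
pose b := a * qf P x; have b0 : 0 <= b by rewrite mulr_ge0 // psd_qf.
have : (fun k => b * q ^+ k) @ \oo --> (0 : R).
  rewrite -(mulr0 b); apply: cvgM; first exact: cvg_cst.
  by apply: cvg_expr; rewrite ger0_norm.
move=> /cvgrPdist_le/(_ e e0)[k _ /(_ k (leqnn k))].
rewrite /= sub0r normrN ger0_norm ?(mulr_ge0 b0 (exprn_ge0 _ q0)) // => he.
have := psd_qf x (hk k); rewrite qfDl qfZl mulrAC -/b; lra.
Qed.
End Contraction.

Section Perturbation.
Context {R : realType}.
Variables (nx nu nw : nat).
Variable M : 'I_nw -> 'M[R]_(nx, nx + nu).
Variables (Qx : 'M[R]_nx) (Ru : 'M[R]_nu).
Hypothesis pdH : pdmx (block_mx Qx 0 0 Ru).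
Let Hc := block_mx Qx 0 0 Ru.
Let J := Jmap M Qx Ru.

Lemma dr_controllerE (W : 'M[R]_nw) K : is_dr_controller M Qx Ru W K ->
  exists P, [/\ psdmx P, P = riccati M Qx Ru W P & K = kgain M Ru W P].
Proof. by move=> [P [pP eP eK]]; exists P; split => //; exact: pd_psd. Qed.

(** Supplies the strict inequality of [contraction_psd]: along [u = K x] the stage cost is at least
    [h] times the squared norm of [x]. *)
Lemma riccati_sol_ge h (W : 'M[R]_nw) P K : posnoise M W -> lemx h%:M Hc -> 0 <= h ->
  psdmx P -> lemx (J W K P) P -> lemx (cl K (madj M W P) + h%:M) P.
Proof.
move=> nW hH h0 pP hJ; apply: lemx_trans hJ.
rewrite /J /Jmap (lin_D (@cl_linear _ _ _ K)) addrC; apply: lemxD; last exact: lemx_refl.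
apply: lemx_trans (psdmap_lemx (@cl_linear _ _ _ K) (@cl_psd _ _ _ K) hH).
apply: lemxP => [||x]; [exact: symmx_scalar|by apply/cl_sym/symmx_scalar|].
by rewrite qf_cl !qf_scalar dot_col_mx ler_wpM2l // lerDl dot_ge0.
Qed.

Lemma clM_linear (W : 'M[R]_nw) K : linear (fun P => cl K (madj M W P)).
Proof. by move=> a u v; rewrite madj_linear cl_linear. Qed.

Lemma clM_psd (W : 'M[R]_nw) K : posnoise M W -> psdmap (fun P => cl K (madj M W P)).
Proof. by move=> [_ pW] P pP; apply/cl_psd/pW. Qed.

Lemma riccati_controller_exists (W : 'M[R]_nw) : posnoise M W -> stabilizable M W ->
  exists K, is_dr_controller M Qx Ru W K.
Proof.
move=> nW sW; have [P pP eP] := riccati_exists pdH nW sW.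
exists (kgain M Ru W P), P; split => //.
have [h h0 hH] := pd_ge pdH.
have eJ : J W (kgain M Ru W P) P = P by rewrite /J (Jmap_kgain pdH nW pP) -eP.
have := @riccati_sol_ge h W P (kgain M Ru W P) nW hH (ltW h0) pP; rewrite eJ.
move=> /(_ (lemx_refl _)) hP; apply: (pd_of_ge h0); first exact: psd_sym.
apply: lemx_trans hP; rewrite addrC; apply: lemx_addr.
exact: (@clM_psd W (kgain M Ru W P) nW P pP).
Qed.

(** At a nonzero [x] any input [u] is produced by a linear feedback, the rank-one gain
    [(dot x x)^-1 *: (u *m x^T)]. This gives the Bellman inequality for inputs that are not linear
    feedback. *)
Lemma riccati_le_all (W : 'M[R]_nw) P x u : posnoise M W -> psdmx P ->
  qf (riccati M Qx Ru W P) x <= qf (Hc + madj M W P) (col_mx x u).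
Proof.
move=> nW pP; have [->|x0] := eqVneq x 0.
  rewrite {1}qfE mulmx0 dot0r; apply: psd_qf; apply: pd_psd.
  exact: Hc_madj_pd.
pose K := (dot x x)^-1 *: (u *m x^T).
have Kx : K *m x = u.
  rewrite /K -scalemxAl -mulmxA [x^T *m x]mx11_scalar mul_mx_scalar scalerA.
  by rewrite -/(dot x x) mulVf ?scale1r // gt_eqF // dot_gt0.
by have := lemx_qf x (riccati_le_J pdH K nW pP); rewrite qf_cl Kx.
Qed.

(** First-order optimality of the minimizing input. *)
Lemma kgain_stationary (W : 'M[R]_nw) P x y : posnoise M W -> psdmx P ->
  dot (col_mx 0 y) ((Hc + madj M W P) *m col_mx x (kgain M Ru W P *m x)) = 0.
Proof.
move=> nW pP; have [sW _] := nW; have uS := pd_unit (RuG_pd pdH nW pP).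
rewrite (madj_block _ sW (psd_sym pP)) /Hc add_block_mx !add0r mul_block_col dot_col_mx.
rewrite dotC dot0r add0r /kgain mulNmx mulmxN -!mulmxA mulKVmx //.
by rewrite subrr dot0r.
Qed.

(** The deterministic core. The Bellman inequality for [Pst] bounds every feasible cost from below,
    the supersolution [U] bounds the cost of [K] from above, and the two differ by a multiple of
    [e ^+ 2]. *)
Lemma perturbation_bound (Wst : 'M[R]_nw) : posnoise M Wst ->
  exists Pst C e0, [/\ psdmx Pst, lemx (block_mx Pst 0 0 0) (Hc + madj M Wst Pst),
    0 <= C, 0 < e0 &
    forall (Wup : 'M[R]_nw) e, symmx Wup -> 0 <= e -> e <= e0 ->
      (forall P, psdmx P -> lemx (madj M Wst P) (madj M Wup P)) ->
      (forall P, psdmx P -> lemx (madj M Wup P) (madj M Wst P + e *: madj M 1%:M P)) ->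
      stabilizable M Wup ->
      (exists K, is_dr_controller M Qx Ru Wup K) /\
      forall K, is_dr_controller M Qx Ru Wup K -> exists U,
        [/\ psdmx U, lemx (J Wst K U) U & lemx U (Pst + (C * e ^+ 2)%:M)]].
Proof.
move=> nW; have [sW pW] := nW.
have [sHc pHc] : psdmx Hc by exact: pd_psd.
(* Stabilizability of [Wup] passes down to [Wst]; without it the claim on [Wup] is vacuous and
   [Pst = 0] satisfies the rest. *)
have [sst|nsst] := pselect (stabilizable M Wst); last first.
  exists 0, 0, 1; split => //.
  - exact: psd0.
  - rewrite block_mx0 (lin_0 (madj_linear _ _)) addr0; exact/lemx0/pd_psd.
  move=> Wup e _ _ _ h _ sW'; case: nsst; exact: stabilizable_mono sW' h.
have [Ps pPs ePs] := riccati_exists pdH nW sst.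
pose Ks := kgain M Ru Wst Ps.
have eJs : J Wst Ks Ps = Ps by rewrite /J (Jmap_kgain pdH nW pPs) -ePs.
have [h h0 hH] := pd_ge pdH; have h0' := ltW h0.
have sPs := psd_sym pPs.
pose p := mxabs Ps + 1; have p0 : 0 < p by rewrite /p; have := mxabs_ge0 Ps; lra.
have pp x : qf Ps x <= p * dot x x.
  apply: le_trans (lemx_qf x (symmx_lemxabs sPs)) _; rewrite qf_scalar.
  by rewrite ler_wpM2r ?dot_ge0 // lerDl.
have psd1 : psdmx (1%:M : 'M[R]_nw) by exact: psd_scalar.
pose N P := madj M 1%:M P.
have pN : psdmap N by exact: madj_psd.
pose n := mxabs (N Ps); have n0 : 0 <= n := mxabs_ge0 _.
have nn z : qf (N Ps) z <= n * dot z z.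
  have := lemx_qf z (symmx_lemxabs (psd_sym (pN _ pPs))); by rewrite qf_scalar.
pose m := mxabs (madj M Wst Ps); have m0 : 0 <= m := mxabs_ge0 _.
have mm z : qf (madj M Wst Ps) z <= m * dot z z.
  have := lemx_qf z (symmx_lemxabs (psd_sym (pW _ pPs))); by rewrite qf_scalar.
pose S := Ru + adjG M Wst Ps.
have pS : pdmx S by exact: (RuG_pd pdH nW pPs).
pose s := mxabs S; have s0 : 0 <= s := mxabs_ge0 _.
have ss y : qf S y <= s * dot y y.
  have := lemx_qf y (symmx_lemxabs (psd_sym (pd_psd pS))); by rewrite qf_scalar.
(* Raising [Ps] by the fraction [t = tau * e] gains at least [t * h = 2 * e * n] times [dot z z] in
   stage cost. For [t <= 1], ensured by the choice of [e0], this pays for the excess noise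
   [(1 + t) * e * n]. *)
pose tau := 2 * n / h; have tau0 : 0 <= tau by rewrite divr_ge0 // mulr_ge0.
pose xi := tau * m + 2 * n; have xi0 : 0 <= xi by apply: addr_ge0; apply: mulr_ge0.
pose cK := xi ^+ 2 * p / h ^+ 3.
have cK0 : 0 <= cK by rewrite divr_ge0 ?mulr_ge0 ?sqr_ge0 ?exprn_ge0 // ltW.
pose a := s * cK / h; have a0 : 0 <= a by apply: divr_ge0 => //; apply: mulr_ge0.
have HcE z : h * dot z z <= qf Hc z.
  by have := lemx_qf z hH; rewrite qf_scalar.
exists Ps, (a * (2 * p)), (tau + 1)^-1; split => //.
- apply: lemxP => [||z].
  + by rewrite /symmx tr_block_mx !trmx0 sPs.
  + by apply: symmxD => //; exact: madj_sym.
  rewrite -[z]vsubmxK; set x := usubmx z; set u := dsubmx z.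
  rewrite qf_row block_mxKul block_mxKur block_mxKdl block_mxKdr.
  rewrite !mul0mx !dot0r qf0l !addr0 {1}ePs; exact: riccati_le_all.
- by rewrite mulr_ge0 // mulr_ge0 // ltW.
- by rewrite invr_gt0; lra.
move=> Wup e sWu e0 ele hlo hup stab.
have nWu : posnoise M Wup by split=> // P pP; exact: lemx_psd (pW _ pP) (hlo _ pP).
split; first exact: riccati_controller_exists.
move=> K /dr_controllerE[Pb [pPb ePb eK]].
have sPb := psd_sym pPb.
have eJb : J Wup K Pb = Pb by rewrite /J eK (Jmap_kgain pdH nWu pPb) -ePb.
have JB W K' A B : J W K' A - J W K' B = cl K' (madj M W (A - B)).
  by rewrite (lin_B (clM_linear W K')) /J /Jmap !(lin_D (@cl_linear _ _ _ K'))
    opprD addrACA subrr add0r.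
have J_noise K' A : psdmx A -> lemx (J Wst K' A) (J Wup K' A).
  move=> pA; apply: (psdmap_lemx (@cl_linear _ _ _ K') (@cl_psd _ _ _ K')).
  by apply: lemxD; [exact: lemx_refl|exact: hlo].
have hL1 : lemx (cl K (madj M Wst Pb) + h%:M) Pb.
  have := @riccati_sol_ge h Wup Pb K nWu hH h0' pPb; rewrite eJb.
  move=> /(_ (lemx_refl _)); apply: lemx_trans; apply: lemxD; last exact: lemx_refl.
  by apply: (psdmap_lemx (@cl_linear _ _ _ K) (@cl_psd _ _ _ K)); exact: hlo.
(* [Pb] is a supersolution and [Ps] a subsolution of the evaluation of the same gain [K] under
   [Wst], so the comparison principle applies to [Pb - Ps]. *)
have lo : lemx Ps Pb.
  apply: (@contraction_psd _ _ (fun P => cl K (madj M Wst P)) Pb (Pb - Ps) h (clM_linear Wst K) (@clM_psd Wst K nW) pPb h0 hL1).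
    exact: symmxB.
  rewrite -JB; have h1 := J_noise K _ pPb; rewrite eJb in h1.
  have h2 := riccati_le_J pdH K nW pPs; rewrite -ePs -/J in h2.
  have := psdD h1 h2; rewrite /lemx; congr psdmx; rewrite /J.
  by apply/matrixP => i j; rewrite !mxE; ring.
pose t := tau * e; have t0 : 0 <= t by rewrite mulr_ge0.
have t1 : t <= 1.
  have tp : 0 < tau + 1 by lra.
  apply: (@le_trans _ _ (tau * (tau + 1)^-1)); first by rewrite ler_wpM2l.
  by rewrite ler_pdivrMr //; lra.
pose Ph := (1 + t) *: Ps.
have t10 : 0 <= 1 + t by lra.
have pPh : psdmx Ph by exact: psdZ.
have up_qf z : qf (madj M Wup Ps) z <= qf (madj M Wst Ps) z + e * (n * dot z z).
  apply: le_trans (lemx_qf z (hup _ pPs)) _.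
  by rewrite qfDl qfZl lerD2l ler_wpM2l.
have hPh : lemx (J Wup Ks Ph) Ph.
  apply: lemxP => [||x]; [exact/psd_sym/Jmap_psd|exact: psd_sym|].
  rewrite /J /Jmap qf_cl; set z := col_mx _ _.
  have e1 : qf Ps x = qf Hc z + qf (madj M Wst Ps) z.
    by rewrite -{1}eJs /J /Jmap qf_cl qfDl.
  rewrite qfDl (lin_Z _ (madj_linear _ _)) !qfZl e1.
  have h1 : (1 + t) * qf (madj M Wup Ps) z <= (1 + t) * (qf (madj M Wst Ps) z + e * (n * dot z z)).
    by rewrite ler_wpM2l.
  have w0 := dot_ge0 z; have en : 0 <= e * (n * dot z z) by rewrite !mulr_ge0.
  have h2 : t * (e * (n * dot z z)) <= e * (n * dot z z) by rewrite ler_piMl.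
  have h3 : t * (h * dot z z) <= t * qf Hc z by rewrite ler_wpM2l.
  have h4 : t * (h * dot z z) = 2 * (e * (n * dot z z)).
    by rewrite /t /tau; field; rewrite gt_eqF.
  lra.
have hi : lemx Pb Ph.
  have hc := @riccati_sol_ge h Wup Ph Ks nWu hH h0' pPh hPh.
  apply: (@contraction_psd _ _ (fun P => cl Ks (madj M Wup P)) Ph (Ph - Pb) h (clM_linear Wup Ks) (@clM_psd Wup Ks nWu) pPh h0 hc).
    by apply: symmxB => //; exact: psd_sym.
  rewrite -JB; have h2 := riccati_le_J pdH Ks nWu pPb; rewrite -ePb -/J in h2.
  have := psdD hPh h2; rewrite /lemx; congr psdmx; rewrite /J.
  by apply/matrixP => i j; rewrite !mxE; ring.
(* The change of the Bellman quadratic form caused by the overestimate: it lies between 0 and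
   [(xi * e)%:M]. *)
pose Xi := madj M Wup Pb - madj M Wst Ps.
have pXi : psdmx Xi.
  apply: (@lemx_trans _ _ (madj M Wst Pb)); last exact: hlo.
  exact: psdmap_lemx (madj_linear _ _) pW lo.
have Xi_le z : qf Xi z <= xi * e * dot z z.
  have h1 := lemx_qf z (psdmap_lemx (madj_linear _ _) nWu.2 hi).
  rewrite (lin_Z _ (madj_linear _ _)) qfZl in h1.
  have h2 : (1 + t) * qf (madj M Wup Ps) z <= (1 + t) * (qf (madj M Wst Ps) z + e * (n * dot z z)).
    by rewrite ler_wpM2l.
  have w0 := dot_ge0 z; have en : 0 <= e * (n * dot z z) by rewrite !mulr_ge0.
  have h3 : t * (e * (n * dot z z)) <= e * (n * dot z z) by rewrite ler_piMl.
  have h4 : t * qf (madj M Wst Ps) z <= t * (m * dot z z) by rewrite ler_wpM2l.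
  have h5 : xi * e * dot z z = t * (m * dot z z) + 2 * (e * (n * dot z z)).
    by rewrite /xi /t; ring.
  rewrite h5 /Xi qfBl; lra.
(* Subtracting the two stationarity conditions in the direction [y] leaves [qf (Hc + madj M Wup Pb)
   z0 = - dot z0 (Xi *m z)]. Cauchy-Schwarz for [Xi] then bounds [y] to first order in [e]. *)
have Kdiff x : dot ((K - Ks) *m x) ((K - Ks) *m x) <= cK * e ^+ 2 * dot x x.
  set y := (K - Ks) *m x; pose z := col_mx x (Ks *m x); pose z0 := col_mx 0 y : 'cV_(nx + nu).
  have zE : col_mx x (K *m x) = z + z0.
    by rewrite /z /z0 add_col_mx addr0 /y mulmxBl addrC subrK.
  have k1 := kgain_stationary x y nWu pPb; rewrite -eK zE mulmxDr dotDr -/z0 -qfE in k1.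
  have k2 := kgain_stationary x y nW pPs; rewrite -/Ks -/z -/z0 in k2.
  have k3 : Hc + madj M Wup Pb = Hc + madj M Wst Ps + Xi by rewrite /Xi addrA addrAC addrK addrC.
  rewrite {1}k3 [X in dot _ X]mulmxDl dotDr k2 add0r in k1.
  have z0E : dot z0 z0 = dot y y by rewrite dot_col_mx dot0r add0r.
  have h1 : h * dot y y <= qf (Hc + madj M Wup Pb) z0.
    by rewrite -z0E; apply: le_trans (HcE z0) _; rewrite qfDl lerDl; exact/psd_qf/(nWu.2).
  have h2 := psd_CS z0 z pXi.
  have h3 : h * dot z z <= p * dot x x.
    apply: le_trans (pp x); rewrite -[in leRHS]eJs /J /Jmap qf_cl -/z qfDl.
    by apply: le_trans (HcE z) _; rewrite lerDl; exact/psd_qf/pW.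
  have w0 := dot_ge0 z; have y0 := dot_ge0 y; have x0 := dot_ge0 x.
  have xe0 : 0 <= xi * e by rewrite mulr_ge0.
  have h4 : (h * dot y y) ^+ 2 <= (xi * e) ^+ 2 * (dot y y * dot z z).
    have -> : (xi * e) ^+ 2 * (dot y y * dot z z) = (xi * e * dot z0 z0) * (xi * e * dot z z).
      by rewrite z0E; ring.
    apply: (@le_trans _ _ (dot z0 (Xi *m z) ^+ 2)).
      have -> : dot z0 (Xi *m z) = - qf (Hc + madj M Wup Pb) z0 by lra.
      rewrite sqrrN ler_pXn2r ?nnegrE ?mulr_ge0 //.
      exact: le_trans (mulr_ge0 h0' y0) h1.
    apply: le_trans h2 _; apply: ler_pM; rewrite ?psd_qf ?Xi_le //.
  have [ye|yn] := eqVneq (dot y y) 0.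
    by rewrite ye mulr_ge0 // mulr_ge0 // sqr_ge0.
  have yp : 0 < dot y y by rewrite lt_neqAle eq_sym yn.
  have h5 : h ^+ 2 * dot y y <= (xi * e) ^+ 2 * dot z z.
    rewrite -(ler_pM2r yp); apply: le_trans (le_trans _ h4) _.
      by rewrite le_eqVlt; apply/orP; left; apply/eqP; ring.
    by rewrite le_eqVlt; apply/orP; left; apply/eqP; ring.
  have h6 : (xi * e) ^+ 2 * (h * dot z z) <= (xi * e) ^+ 2 * (p * dot x x).
    by rewrite ler_wpM2l // sqr_ge0.
  have h7 : h * (h ^+ 2 * dot y y) <= h * ((xi * e) ^+ 2 * dot z z) by rewrite ler_wpM2l.
  have -> : cK * e ^+ 2 * dot x x = (xi * e) ^+ 2 * (p * dot x x) / h ^+ 3.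
    by rewrite /cK; field; rewrite gt_eqF.
  rewrite ler_pdivlMr ?exprn_gt0 //.
  have -> : dot y y * h ^+ 3 = h * (h ^+ 2 * dot y y) by ring.
  lra.
have e20 : 0 <= e ^+ 2 by rewrite sqr_ge0.
have ae0 : 0 <= a * e ^+ 2 by rewrite mulr_ge0.
(* [Ps] violates the evaluation inequality for [K] only by the completed square, of order [e ^+ 2].
   The multiple of [Pb] absorbs this through its strict margin [h] from [hL1]. *)
have pU : psdmx (Ps + (a * e ^+ 2) *: Pb) by apply: psdD => //; exact: psdZ.
exists (Ps + (a * e ^+ 2) *: Pb); split => //.
- apply: lemxP => [||x]; [exact/psd_sym/Jmap_psd|exact: psd_sym|].
  have -> : qf (J Wst K (Ps + (a * e ^+ 2) *: Pb)) x
      = qf (J Wst K Ps) x + a * e ^+ 2 * qf (cl K (madj M Wst Pb)) x.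
    rewrite -qfZl -qfDl; congr qf; apply/eqP; rewrite -subr_eq0 opprD addrA JB.
    by rewrite [_ + _ *: _ - _]addrAC subrr add0r (lin_Z _ (clM_linear Wst K)) subrr.
  rewrite /J (Jmap_square pdH K nW pPs) -ePs -/Ks -/S !qfDl qfZl qf_congr -addrA lerD2l.
  have h1 : qf S ((K - Ks) *m x) <= s * (cK * e ^+ 2 * dot x x).
    by apply: le_trans (ss _) _; rewrite ler_wpM2l.
  have := lemx_qf x hL1; rewrite qfDl qf_scalar => h2.
  have h3 : a * e ^+ 2 * (qf (cl K (madj M Wst Pb)) x + h * dot x x) <= a * e ^+ 2 * qf Pb x.
    by rewrite ler_wpM2l.
  have h4 : a * e ^+ 2 * (h * dot x x) = s * (cK * e ^+ 2 * dot x x).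
    by rewrite /a; field; rewrite gt_eqF.
  lra.
apply: lemxD; first exact: lemx_refl.
apply: lemxP => [||x]; [exact: symmxZ|exact: symmx_scalar|].
rewrite qfZl qf_scalar.
have h1 := lemx_qf x hi; rewrite qfZl in h1.
have h2 : (1 + t) * qf Ps x <= 2 * (p * dot x x).
  by apply: ler_pM => //; [exact: psd_qf|lra].
have -> : a * (2 * p) * e ^+ 2 * dot x x = a * e ^+ 2 * (2 * (p * dot x x)) by ring.
by rewrite ler_wpM2l //; lra.
Qed.
End Perturbation.

(** * Bounds on the cost of the moment problem *)

Section MomentCosts.
Context {R : realType}.
Variables (nx nu nw : nat).
Variable M : 'I_nw -> 'M[R]_(nx, nx + nu).
Variables (Qx : 'M[R]_nx) (Ru : 'M[R]_nu).
Hypothesis pdH : pdmx (block_mx Qx 0 0 Ru).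
Let Hc := block_mx Qx 0 0 Ru.
Let J := Jmap M Qx Ru.
Variable W : 'M[R]_nw.
Hypothesis nW : posnoise M W.

Lemma stage_cost_ge0 (Z : 'M[R]_(nx + nu)) : psdmx Z -> 0 <= \tr (Z *m Hc).
Proof. by move=> pZ; apply: mxtrace_psdM => //; exact: pd_psd. Qed.

Lemma mxtrace_block_ul (A : 'M[R]_nx) (Z : 'M[R]_(nx + nu)) :
  \tr (block_mx A 0 0 0 *m Z) = \tr (A *m ulsubmx Z).
Proof.
rewrite -{1}[Z]submxK mulmx_block !mul0mx !addr0 mxtrace_block mxtrace0 addr0.
by [].
Qed.

(** Telescoping leaves a terminal term in [S]. As the cost matrix is positive definite, that term is
    at most a multiple of the stage cost, and a finite total cost has stage costs below any
    threshold. *)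
Lemma moment_cost_ge (S X0 : 'M[R]_nx) Z : psdmx S ->
  lemx (block_mx S 0 0 0) (Hc + madj M W S) -> moment_feasible M W X0 Z ->
  ((\tr (S *m X0))%:E <= moment_cost Qx Ru Z)%E.
Proof.
move=> pS hS [pZ Z0 Zs]; have [sW _] := nW.
pose c t := \tr (Z t *m Hc).
have c0 t : 0 <= c t by exact: stage_cost_ge0.
have step t : \tr (S *m ulsubmx (Z t)) <= c t + \tr (S *m ulsubmx (Z t.+1)).
  have := mxtrace_lemxM hS (pZ t); rewrite mxtrace_block_ul mulmxDl mxtraceD.
  rewrite ![\tr (_ *m Z t)]mxtrace_mulC -mxtrace_momE // -Zs.
  by rewrite [\tr (ulsubmx _ *m _)]mxtrace_mulC.
have tele T : \tr (S *m X0) <= \sum_(0 <= t < T) c t + \tr (S *m ulsubmx (Z T)).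
  elim: T => [|T IH]; first by rewrite big_geq // add0r Z0.
  by rewrite big_nat_recr //=; have := step T; lra.
have [h h0 hH] := pd_ge pdH.
have tail t : \tr (S *m ulsubmx (Z t)) <= mxabs S / h * c t.
  have h1 : lemx (block_mx S 0 0 0) ((mxabs S / h) *: Hc).
    apply: lemxP => [||z].
    - by rewrite /symmx tr_block_mx !trmx0 (psd_sym pS).
    - exact/symmxZ/pdH.1.
    rewrite -[z]vsubmxK qf_row block_mxKul block_mxKur block_mxKdl block_mxKdr.
    rewrite !mul0mx !dot0r qf0l !addr0 qfZl vsubmxK.
    apply: (@le_trans _ _ (mxabs S * dot (usubmx z) (usubmx z))).
      by rewrite -qf_scalar; apply/lemx_qf/symmx_lemxabs/psd_sym.
    rewrite -mulrA ler_wpM2l ?mxabs_ge0 // mulrC ler_pdivlMr // mulrC.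
    apply: le_trans (lemx_qf z hH); rewrite qf_scalar ler_pM2l //.
    by rewrite -{3 4}[z]vsubmxK dot_col_mx lerDl dot_ge0.
  have := mxtrace_lemxM h1 (pZ t); rewrite mxtrace_block_ul -scalemxAl mxtraceZ.
  by rewrite [\tr (Hc *m _)]mxtrace_mulC.
rewrite /moment_cost; set s := (X in (_ <= X)%E).
have part T : ((\sum_(0 <= t < T) c t)%:E <= s)%E.
  by rewrite -sumEFin; apply: nneseries_lim_ge => t _ _; rewrite lee_fin.
have s0 : (0 <= s)%E by have := part 0%N; rewrite big_geq.
move: s0 part; case: s => [s| |] s0 part; rewrite ?leey //.
have {}part T : \sum_(0 <= t < T) c t <= s by have := part T; rewrite lee_fin.
rewrite lee_fin; apply/ler_addgt0Pr => e e0.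
pose k := mxabs S / h + 1; have k0 : 0 < k.
  by have := divr_ge0 (mxabs_ge0 S) (ltW h0); rewrite /k; lra.
have [T hT] : exists T, c T <= e / k.
  apply: contrapT => /forallNP nT.
  have ek : 0 < e / k by rewrite divr_gt0.
  have lb T : T%:R * (e / k) <= \sum_(0 <= t < T) c t.
    elim: T => [|T IH]; first by rewrite mul0r big_geq.
    rewrite big_nat_recr //= -natr1 mulrDl mul1r lerD //.
    by rewrite ltW // ltNge; apply/negP.
  pose T := (Num.truncn (s / (e / k))).+1.
  have : s / (e / k) < T%:R by exact: truncnS_gt.
  by rewrite ltr_pdivrMr // => /lt_le_trans/(_ (lb T)) /lt_le_trans/(_ (part T)); rewrite ltxx.
apply: le_trans (tele T) _; apply: lerD => //; apply: le_trans (tail T) _.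
apply: (@le_trans _ _ (k * c T)); first by rewrite ler_wpM2r // lerDl.
by rewrite mulrC -ler_pdivlMr.
Qed.

Lemma liftKE X K : Defs.liftK K X = (row_mx 1%:M K^T)^T *m X *m row_mx 1%:M K^T :> 'M[R]_(nx + nu).
Proof. by rewrite tr_row_mx trmx1 trmxK. Qed.

Lemma closed_loop_psd X0 K t : psdmx X0 -> psdmx (iter t (momEK M K W) X0).
Proof.
have [sW pW] := nW; move=> pX0; elim: t => // t IH.
by rewrite iterS; apply: momE_psd => //; rewrite liftKE; exact: psd_congr.
Qed.

Lemma closed_loop_feasible X0 K : psdmx X0 ->
  moment_feasible M W X0 (closed_loop_moments M W X0 K).
Proof.
move=> pX0; have [sW pW] := nW.
have ul X : ulsubmx (Defs.liftK K X) = X.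
  rewrite /Defs.liftK mul_col_mx mul_col_row block_mxKul mul1mx mulmx1 //.
split.
- by move=> t; rewrite /closed_loop_moments liftKE; exact/psd_congr/closed_loop_psd.
- by rewrite /closed_loop_moments ul.
- by move=> t; rewrite /closed_loop_moments ul iterS.
Qed.

Lemma moment_cost_closed_loop_le U X0 K : psdmx U -> psdmx X0 -> lemx (J W K U) U ->
  (moment_cost Qx Ru (closed_loop_moments M W X0 K) <= (\tr (U *m X0))%:E)%E.
Proof.
move=> pU pX0 hU; have [sW _] := nW.
have [pZ Z0 Zs] := closed_loop_feasible K pX0.
set Z := closed_loop_moments _ _ _ _ in pZ Z0 Zs *.
pose c t := \tr (Z t *m Hc).
have c0 t : 0 <= c t by exact: stage_cost_ge0.
pose X t := iter t (momEK M K W) X0.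
have pX t : psdmx (X t) by exact: closed_loop_psd.
have step t : c t + \tr (U *m X t.+1) <= \tr (U *m X t).
  have := mxtrace_lemxM hU (pX t).
  rewrite /J /Jmap (lin_D (@cl_linear _ _ _ K)) mulmxDl mxtraceD mxtrace_cl_momEK //.
  suff -> : \tr (cl K Hc *m X t) = c t by [].
  rewrite /c /Z /closed_loop_moments /Defs.liftK -/(X t) /cl.
  have -> : row_mx 1%:M K^T = (col_mx 1%:M K)^T by rewrite tr_col_mx trmx1.
  by rewrite -(mulmxA _ (col_mx _ _) (X t)) mxtrace_mulC !mulmxA.
have tele T : \sum_(0 <= t < T) c t + \tr (U *m X T) <= \tr (U *m X0).
  elim: T => [|T IH]; first by rewrite big_geq // add0r.
  by rewrite big_nat_recr //=; have := step T; lra.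
rewrite /moment_cost; apply: lime_le.
  by apply: is_cvg_nneseries => t _ _; rewrite lee_fin; exact: c0.
apply: nearW => T; rewrite sumEFin lee_fin; apply: le_trans (tele T).
by rewrite lerDl; exact: mxtrace_psdM.
Qed.
End MomentCosts.

(** * Expectations and independence *)

Section Expectation.
Context {R : realType} {d : measure_display} {T : measurableType d}.
Variable P : probability T R.
Implicit Types X Y : T -> R.

Definition integ X := P.-integrable setT (EFin \o X).
Definition ex X : R := \int[P]_om X om.

Lemma exE X : integ X -> (ex X)%:E = (\int[P]_om (X om)%:E)%E.
Proof. by move=> iX; rewrite fineK //; exact: integrable_fin_num. Qed.

Lemma integ_meas X : integ X -> measurable_fun setT X.
Proof. by move=> /measurable_int/measurable_EFinP. Qed.

Lemma integD X Y : integ X -> integ Y -> integ (fun om => X om + Y om).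
Proof. by move=> iX iY; exact: (integrableD measurableT iX iY). Qed.
Lemma integZ a X : integ X -> integ (fun om => a * X om).
Proof. by move=> iX; exact: (integrableZl measurableT a iX). Qed.
Lemma integN X : integ X -> integ (fun om => - X om).
Proof. by move=> iX; under eq_fun do rewrite -mulN1r; exact: integZ. Qed.
Lemma integB X Y : integ X -> integ Y -> integ (fun om => X om - Y om).
Proof. by move=> iX /integN; exact: integD. Qed.
Lemma integ_cst a : integ (fun=> a).
Proof. exact: finite_measure_integrable_cst. Qed.
Lemma integ_sum I (r : seq I) (F : I -> T -> R) :
  (forall i, integ (F i)) -> integ (fun om => \sum_(i <- r) F i om).
Proof.
move=> h; elim: r => [|i r IH].
  by under eq_fun do rewrite big_nil; exact: integ_cst.
by under eq_fun do rewrite big_cons; exact: integD.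
Qed.
Lemma integ_dom X Y : measurable_fun setT X -> integ Y ->
  {ae P, forall om, `|X om| <= Y om} -> integ X.
Proof.
move=> mX iY h; apply/integrableP; split; first exact/measurable_EFinP.
have /integrableP[mY fY] := iY; apply: le_lt_trans fY.
apply: ae_ge0_le_integral => //.
- by apply: measurableT_comp => //; exact/measurable_EFinP.
- by apply: measurableT_comp => //; exact/measurable_EFinP.
apply: filterS h => om h _ /=; rewrite lee_fin; apply: le_trans h _.
exact: ler_norm.
Qed.
Lemma integ_bound X c : measurable_fun setT X ->
  {ae P, forall om, `|X om| <= c} -> integ X.
Proof. by move=> mX; apply: integ_dom => //; exact: integ_cst. Qed.

Lemma exD X Y : integ X -> integ Y -> ex (fun om => X om + Y om) = ex X + ex Y.
Proof. by move=> iX iY; rewrite /ex RintegralD. Qed.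
Lemma exZ a X : integ X -> ex (fun om => a * X om) = a * ex X.
Proof. by move=> iX; rewrite /ex RintegralZl. Qed.
Lemma exB X Y : integ X -> integ Y -> ex (fun om => X om - Y om) = ex X - ex Y.
Proof. by move=> iX iY; rewrite /ex RintegralB. Qed.
Lemma ex_cst a : ex (fun=> a) = a.
Proof.
apply: EFin_inj; rewrite exE; last exact: integ_cst.
by rewrite integral_cst //= probability_setT mule1.
Qed.
Lemma ex_sum I (r : seq I) (F : I -> T -> R) :
  (forall i, integ (F i)) -> ex (fun om => \sum_(i <- r) F i om) = \sum_(i <- r) ex (F i).
Proof.
move=> h; elim: r => [|i r IH].
  by under [in LHS]eq_fun do rewrite big_nil; rewrite ex_cst big_nil.
under [in LHS]eq_fun do rewrite big_cons.
by rewrite exD ?big_cons ?IH //; exact: integ_sum.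
Qed.
Lemma ex_le X Y : integ X -> integ Y -> {ae P, forall om, X om <= Y om} -> ex X <= ex Y.
Proof.
move=> iX iY h; rewrite -subr_ge0 -exB //.
rewrite (_ : ex _ = ex (fun om => `|Y om - X om|)); first exact: Rintegral_ge0.
have iB := integB iY iX; have mB := integ_meas iB.
congr fine; apply: ae_eq_integral => //.
- exact: (measurable_int _ iB).
- exact/measurable_EFinP/measurableT_comp.
by apply: filterS h => om h _ /=; rewrite ger0_norm // subr_ge0.
Qed.
Lemma ex_ge0 X : (forall om, 0 <= X om) -> 0 <= ex X.
Proof. by move=> h; apply: Rintegral_ge0. Qed.
Lemma ex_eq0_ae X : integ X -> (forall om, 0 <= X om) -> ex X = 0 ->
  {ae P, forall om, X om = 0}.
Proof.
move=> iX X0 eX; have : (\int[P]_om `|(X om)%:E| = 0)%E.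
  by under eq_integral => om _ do rewrite gee0_abs ?lee_fin //; rewrite -exE // eX.
move/ae_eq_integral_abs => /(_ measurableT (measurable_int _ iX)).
by apply: filterS => om /(_ Logic.I) [].
Qed.

Lemma ex_markov X a : integ X -> (forall om, 0 <= X om) -> 0 < a ->
  (P [set om | (a <= X om)%R] <= (ex X / a)%:E)%E.
Proof.
move=> iX X0 a0; have mX := integ_meas iX.
have mA : measurable [set om | a <= X om].
  by rewrite -[X in measurable X]setTI; apply: measurable_fun_le => //;
   exact: measurable_cst.
have fA : P [set om | a <= X om] \is a fin_num by rewrite fin_num_measure.
rewrite -(fineK fA) lee_fin ler_pdivlMr // mulrC.
rewrite -lee_fin EFinM fineK // exE // -integral_cst //.
rewrite [leLHS]integral_mkcond; apply: ge0_le_integral => //.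
- by move=> om _; rewrite patchE; case: ifP => _ //; rewrite lee_fin ltW.
- apply/(measurable_restrictT _ mA); exact: measurable_cst.
- exact/measurable_EFinP.
move=> om _; rewrite patchE; case: ifPn => [|_]; last by rewrite lee_fin.
by rewrite inE /= lee_fin.
Qed.

Definition indep2 (F G : set (set T)) :=
  forall A B, F A -> G B -> P (A `&` B) = (P A * P B)%E.

(** Measurability for a set system on [T], so that the sigma-algebra can vary without a change of
    type. *)
Definition fmeas (F : set (set T)) X := forall B, measurable B -> F (X @^-1` B).

Lemma fmeas_measurable F X : F `<=` measurable -> fmeas F X -> measurable_fun setT X.
Proof. by move=> sF h _ B mB; rewrite setTI; exact/sF/h. Qed.

Section JointLaw.
Variables (X Y : T -> R).
Hypotheses (mX : measurable_fun setT X) (mY : measurable_fun setT Y).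
Hypothesis iXY : forall A B, measurable A -> measurable B ->
  P ((X @^-1` A) `&` (Y @^-1` B)) = (P (X @^-1` A) * P (Y @^-1` B))%E.

Let pX : {mfun T >-> R} := HB.pack X (isMeasurableFun.Build _ _ _ _ X mX).
Let pY : {mfun T >-> R} := HB.pack Y (isMeasurableFun.Build _ _ _ _ Y mY).
Let mXY : measurable_fun setT (fun om => (X om, Y om)).
Proof. exact/measurable_fun_pair. Qed.

(** The joint law agrees with the product of the marginal laws on rectangles, hence everywhere; then
    Tonelli. *)
Lemma integral_indep_ge0 : (forall om, 0 <= X om) -> (forall om, 0 <= Y om) ->
  (\int[P]_om (X om * Y om)%:E = (\int[P]_om (X om)%:E) * (\int[P]_om (Y om)%:E))%E.
Proof.
move=> X0 Y0.
(* Truncation at 0 makes the integrand nonnegative on the whole plane and changes nothing on the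
   values of [X] and [Y]. *)
pose f (z : R * R) : \bar R := (Num.max z.1 0 * Num.max z.2 0)%:E.
pose g (x : R) : \bar R := (Num.max x 0)%:E.
have mg : measurable_fun setT g.
  by apply/measurable_EFinP; apply: measurable_maxr => //; exact: measurable_cst.
have mf : measurable_fun setT f.
  apply/measurable_EFinP; apply: measurable_funM.
    by apply: measurable_maxr => //; exact: measurable_cst.
  by apply: measurable_maxr => //; exact: measurable_cst.
have f0 z : (0 <= f z)%E by rewrite lee_fin mulr_ge0 // le_max lexx orbT.
have g0 z : (0 <= g z)%E by rewrite lee_fin le_max lexx orbT.
have eX : (\int[P]_om (X om)%:E = \int[distribution P pX]_x g x)%E.
  rewrite (ge0_integral_pushforward mX) //.
  by apply: eq_integral => om _; rewrite /g /= max_l.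
have eY : (\int[P]_om (Y om)%:E = \int[distribution P pY]_x g x)%E.
  rewrite (ge0_integral_pushforward mY) //.
  by apply: eq_integral => om _; rewrite /g /= max_l.
transitivity (\int[pushforward P (fun om => (X om, Y om))]_z f z)%E.
  rewrite (ge0_integral_pushforward mXY) //.
  by apply: eq_integral => om _; rewrite /f /= !max_l.
transitivity (\int[(distribution P pX \x distribution P pY)%E]_z f z)%E.
  apply: eq_measure_integral => A mA _; apply/esym.
  apply: (product_measure_unique (m' := pushforward P (fun om => (X om, Y om)))) => //.
rewrite fubini_tonelli1 // eX eY /fubini_F /f /=.
rewrite (eq_integral (fun x => g x * \int[distribution P pY]_y g y)%E); last first.
  by move=> x _; rewrite -ge0_integralZl //; apply: eq_integral => y _; rewrite -EFinM.
rewrite ge0_integralZr //.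
by apply: integral_ge0 => x _; exact: g0.
Qed.
End JointLaw.

Lemma ex_indep F G X Y : F `<=` measurable -> G `<=` measurable -> indep2 F G ->
  fmeas F X -> fmeas G Y -> integ X -> integ Y ->
  integ (fun om => X om * Y om) /\ ex (fun om => X om * Y om) = ex X * ex Y.
Proof.
move=> sF sG iFG fX fY iX iY.
have mX := integ_meas iX; have mY := integ_meas iY.
pose pos (Z : T -> R) om := Num.max (Z om) 0.
pose neg (Z : T -> R) om := Num.max (- Z om) 0.
have pos0 Z om : 0 <= pos Z om by rewrite /pos le_max lexx orbT.
have neg0 Z om : 0 <= neg Z om by rewrite /neg le_max lexx orbT.
have pnE Z om : Z om = pos Z om - neg Z om.
  rewrite /pos /neg; case: (boolP (0 <= Z om)) => [z0|]; last rewrite -ltNge => z0.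
    by rewrite max_l // max_r ?subr0 // oppr_le0.
  by rewrite max_r ?(ltW z0) // max_l ?opprK ?add0r // oppr_ge0 ltW.
have mpos Z : measurable_fun setT Z -> measurable_fun setT (pos Z).
  by move=> mZ; apply: measurable_maxr => //; exact: measurable_cst.
have mneg Z : measurable_fun setT Z -> measurable_fun setT (neg Z).
  move=> mZ; apply: measurable_maxr; last exact: measurable_cst.
  exact: measurable_funN.
have ipos Z : integ Z -> integ (pos Z).
  move=> iZ; apply: (@integ_dom _ (fun om => `|Z om|)); first exact/mpos/integ_meas.
    exact: (integrable_abse iZ).
  apply: aeW => om; rewrite ger0_norm // /pos ge_max ler_norm normr_ge0 //.
have ineg Z : integ Z -> integ (neg Z).
  move=> iZ; apply: (@integ_dom _ (fun om => `|Z om|)); first exact/mneg/integ_meas.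
    exact: (integrable_abse iZ).
  by apply: aeW => om; rewrite ger0_norm // /neg ge_max -normrN ler_norm normr_ge0.
have cmax (h : R -> R) : measurable_fun setT h -> forall F' Z, fmeas F' Z -> fmeas F' (h \o Z).
  move=> mh F' Z fZ B mB; rewrite comp_preimage; apply: fZ.
  by rewrite -[X in measurable X]setTI; exact: mh.
have mposR : measurable_fun setT (fun x : R => Num.max x 0).
  by apply: measurable_maxr => //; exact: measurable_cst.
have mnegR : measurable_fun setT (fun x : R => Num.max (- x) 0).
  apply: measurable_maxr; last exact: measurable_cst.
  exact: measurable_funN.
have key U V : fmeas F U -> fmeas G V -> integ U -> integ V ->
    (forall om, 0 <= U om) -> (forall om, 0 <= V om) ->
    integ (fun om => U om * V om) /\ ex (fun om => U om * V om) = ex U * ex V.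
  move=> fU fV iU iV U0 V0.
  have mU := integ_meas iU; have mV := integ_meas iV.
  have e : (\int[P]_om (U om * V om)%:E = (\int[P]_om (U om)%:E) * (\int[P]_om (V om)%:E))%E.
    apply: integral_indep_ge0 => // A B mA mB; apply: iFG; [exact: fU|exact: fV].
  split; last by rewrite /ex /Rintegral e fineM //; exact: integrable_fin_num.
  apply/integrableP; split; first exact/measurable_EFinP/measurable_funM.
  under eq_integral => om _ do rewrite /= ger0_norm ?mulr_ge0 //.
  by rewrite e -!exE // -EFinM ltry.
have [i1 e1] := key _ _ (cmax _ mposR _ _ fX) (cmax _ mposR _ _ fY) (ipos _ iX) (ipos _ iY) (pos0 X) (pos0 Y).
have [i2 e2] := key _ _ (cmax _ mposR _ _ fX) (cmax _ mnegR _ _ fY) (ipos _ iX) (ineg _ iY) (pos0 X) (neg0 Y).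
have [i3 e3] := key _ _ (cmax _ mnegR _ _ fX) (cmax _ mposR _ _ fY) (ineg _ iX) (ipos _ iY) (neg0 X) (pos0 Y).
have [i4 e4] := key _ _ (cmax _ mnegR _ _ fX) (cmax _ mnegR _ _ fY) (ineg _ iX) (ineg _ iY) (neg0 X) (neg0 Y).
have eXY : (fun om => X om * Y om) = (fun om => (pos X om * pos Y om - pos X om * neg Y om)
   - (neg X om * pos Y om - neg X om * neg Y om)).
  by apply/funext => om; rewrite {1}[X om]pnE {1}[Y om]pnE; ring.
split; first by rewrite eXY; apply: integB; exact: integB.
rewrite eXY exB ?exB //; [|exact: integB|exact: integB].
have eX : ex X = ex (pos X) - ex (neg X).
  by rewrite -exB; [congr ex; apply/funext => om; exact: pnE|exact: ipos|exact: ineg].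
have eY : ex Y = ex (pos Y) - ex (neg Y).
  by rewrite -exB; [congr ex; apply/funext => om; exact: pnE|exact: ipos|exact: ineg].
rewrite eX eY mulrBl !mulrBr -e1 -e2 -e3 -e4 //.
Qed.

(** Two finite measures, [P] restricted to [B] and [P] scaled by [P B], agree on a pi-system and
    hence on the sigma-algebra it generates. *)
Lemma indep_pi_system (C : set (set T)) B : C `<=` measurable -> setI_closed C -> C setT ->
  measurable B -> (forall A, C A -> P (A `&` B) = (P A * P B)%E) ->
  forall A, <<s C >> A -> P (A `&` B) = (P A * P B)%E.
Proof.
move=> mC IC CT mB h A sA.
have fB : P B \is a fin_num by rewrite fin_num_measure.
have p0 : 0 <= fine (P B) by rewrite fine_ge0.
pose m1 := mrestr P mB; pose m2 := mscale (NngNum p0) P.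
have e : m1 A = m2 A.
  apply: (g_sigma_algebra_measure_unique C mC (fun=> setT)) => //.
  - by rewrite bigcup_const.
  - by move=> A' CA'; rewrite /= /mrestr /mscale /= h // muleC fineK.
  - move=> _; rewrite /= /mrestr setTI; apply: le_lt_trans (probability_le1 _ mB) _.
    exact: ltry.
by move: e; rewrite /m1 /m2 /= /mrestr /mscale /= => ->; rewrite fineK // muleC.
Qed.

(** The pi-system consists of the finite intersections with one event of [F j] for each [j] in
    [s]. *)
Lemma indep_generated (I : eqType) (F : I -> set (set T)) (s : seq I) i :
  (forall j, sigma_algebra setT (F j)) -> (forall j, F j `<=` measurable) ->
  independent P F -> i \notin s ->
  indep2 <<s [set A | exists2 j, j \in s & F j A] >> (F i).
Proof.
(* [independent] speaks of sequences without repetition. *)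
move=> saF mF iF is'; wlog us : s is' / uniq s => [hw|].
  have := hw (undup s); rewrite mem_undup undup_uniq => /(_ is' isT).
  suff -> : [set A | exists2 j, j \in undup s & F j A] = [set A | exists2 j, j \in s & F j A] by [].
  by apply/seteqP; split => A [j js FA]; exists j => //; move: js; rewrite mem_undup.
pose C := [set A | exists2 f : I -> set T, (forall j, j \in s -> F j (f j)) &
    A = \big[setI/setT]_(j <- s) f j].
have FE j := measurable_g_measurableTypeE (saF j).
have FT j : F j setT by rewrite -FE; exact: measurableT.
have FI j A B : F j A -> F j B -> F j (A `&` B).
  by rewrite -(FE j); exact: measurableI.
have CB A B : C A -> F i B -> P (A `&` B) = (P A * P B)%E.
  move=> [f fs ->] FB.
  pose g j := if j == i then B else f j.
  have gs : \big[setI/setT]_(j <- s) g j = \big[setI/setT]_(j <- s) f j.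
    apply: eq_big_seq => j js; rewrite /g; case: eqP js is' => // -> ->; by [].
  have gp : (\prod_(j <- s) P (g j) = \prod_(j <- s) P (f j))%E.
    apply: eq_big_seq => j js; rewrite /g; case: eqP js is' => // -> ->; by [].
  have fg j : j \in i :: s -> F j (g j).
    by rewrite inE /g; case: eqP => [->//|_ /= js]; exact: fs.
  have := iF (i :: s) g; rewrite /= us is' => /(_ isT fg).
  rewrite !big_cons gs gp /g eqxx setIC => ->; rewrite muleC; congr (_ * _)%E.
  by apply/esym/iF.
move=> A B sA FB; apply: (@indep_pi_system C) => //.
- move=> _ [f fs ->]; rewrite big_seq; apply: bigsetI_measurable => j js; exact/mF/fs.
- move=> _ _ [f fs ->] [g gs ->]; exists (fun j => f j `&` g j).
    by move=> j js; apply: FI; [exact: fs|exact: gs].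
  by rewrite big_split.
- by exists (fun=> setT) => //; rewrite big1.
- exact: mF FB.
- by move=> A' CA'; exact: CB.
move: A sA {FB}; apply: sub_sigma_algebra2 => A [j js FA].
exists (fun k => if k == j then A else setT).
  by move=> k ks; case: eqP => [->|_] //.
rewrite (bigD1_seq j) //= eqxx big1 ?setIT //.
by move=> k /negbTE ->.
Qed.
End Expectation.

(** * Stochastic closed loop *)

Section RandomVectors.
Context {R : realType}.

Lemma vborel_coord n (i : 'I_n) (B : set R) : measurable B ->
  vborel [set x : 'cV[R]_n | B (x i 0)].
Proof.
move=> mB; apply: sub_sigma_algebra; rewrite (bigD1 i) //=; left.
by exists B => //; rewrite setTI.
Qed.

Lemma vborel_preimage d (T : measurableType d) n (X : T -> 'cV[R]_n) :
  (forall i, measurable_fun setT (fun om => X om i 0)) ->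
  forall A, vborel A -> measurable (X @^-1` A).
Proof.
move=> mX A; apply: (smallest_sub (X := [set B | measurable (X @^-1` B)])).
  split => /=; first by rewrite preimage_set0.
  - by move=> B mB; rewrite setTD preimage_setC; exact: measurableC.
  - by move=> F mF; rewrite preimage_bigcup; exact: bigcup_measurable.
apply: (big_ind (fun S : set (set _) => S `<=` [set B | measurable (X @^-1` B)])).
- by move=> ? [].
- by move=> S1 S2 h1 h2 B [/h1|/h2].
- move=> i _ _ [B mB <-]; rewrite setTI /=; have := mX i measurableT B mB.
  by rewrite setTI.
Qed.

Context {d : measure_display} {T : measurableType d}.

Lemma random_vectorP n (X : T -> 'cV[R]_n) :
  random_vector X <-> forall i, measurable_fun setT (fun om => X om i 0).
Proof.
split=> [h i _ B mB|h A]; last exact: vborel_preimage.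
by rewrite setTI; exact: h (vborel_coord i mB).
Qed.

Lemma sigma_of_salg n (X : T -> 'cV[R]_n) : sigma_algebra setT (sigma_of X).
Proof. by apply: sigma_algebra_preimage; exact: smallest_sigma_algebra. Qed.

Lemma sigma_of_measurable n (X : T -> 'cV[R]_n) :
  random_vector X -> sigma_of X `<=` measurable.
Proof. by move=> h _ [B mB <-]; rewrite setTI; exact: h. Qed.

Lemma fmeasP (G : set (set T)) (X : T -> R) :
  measurable_fun setT (X : g_sigma_algebraType G -> R) <-> fmeas <<s G >> X.
Proof.
split=> h; first by move=> B mB; have := h measurableT B mB; rewrite setTI.
by move=> _ B mB; rewrite setTI; exact: h.
Qed.

Lemma fmeas_sigma_of n (X : T -> 'cV[R]_n) (G : set (set T)) i :
  sigma_of X `<=` G -> fmeas G (fun om => X om i 0).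
Proof.
move=> h B mB; apply: h; exists [set x : 'cV[R]_n | B (x i 0)]; last by rewrite setTI.
exact: vborel_coord.
Qed.

Lemma sigma_of_fmeas n (X : T -> 'cV[R]_n) (G : set (set T)) :
  (forall i, fmeas <<s G >> (fun om => X om i 0)) -> sigma_of X `<=` <<s G >>.
Proof.
move=> h _ [B mB <-]; rewrite setTI.
apply: (@vborel_preimage _ (g_sigma_algebraType G) n X) => // i.
exact/fmeasP.
Qed.

Variable P : probability T R.

Lemma second_momentE n (X : T -> 'cV[R]_n) i j :
  second_moment P X i j = ex P (fun om => X om i 0 * X om j 0).
Proof. by rewrite mxE unlock. Qed.

Lemma square_integ_mul n (X : T -> 'cV[R]_n) i j :
  (forall k, measurable_fun setT (fun om => X om k 0)) ->
  square_integrable P X -> integ P (fun om => X om i 0 * X om j 0).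
Proof.
move=> mX sX; apply: (@integ_dom _ _ _ _ _ (fun om => X om i 0 ^+ 2 + X om j 0 ^+ 2)).
- exact: measurable_funM.
- by apply: integD; exact: sX.
apply: aeW => om; set a := X om i 0; set b := X om j 0.
have e1 : (a + b) ^+ 2 = a ^+ 2 + 2 * (a * b) + b ^+ 2 by ring.
have e2 : (a - b) ^+ 2 = a ^+ 2 - 2 * (a * b) + b ^+ 2 by ring.
rewrite ler_norml; have := sqr_ge0 (a + b); have := sqr_ge0 (a - b).
rewrite e1 e2; have := sqr_ge0 a; have := sqr_ge0 b; lra.
Qed.

Lemma qf_entries n (A : 'M[R]_n) x : qf A x = \sum_i \sum_j A i j * (x i 0 * x j 0).
Proof.
rewrite qfE dotE; apply: eq_bigr => i _; rewrite [X in _ * X]mxE mulr_sumr.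
by apply: eq_bigr => j _; ring.
Qed.

Lemma measurable_qf n (A : 'M[R]_n) (X : T -> 'cV[R]_n) :
  (forall i, measurable_fun setT (fun om => X om i 0)) ->
  measurable_fun setT (fun om => qf A (X om)).
Proof.
move=> mX; rewrite (_ : (fun om => _) = (fun om => \sum_i \sum_j A i j * (X om i 0 * X om j 0))).
  apply: measurable_sum => i; apply: measurable_sum => j.
  by apply: measurable_funM => //; exact: measurable_funM.
by apply/funext => om; exact: qf_entries.
Qed.

Lemma ex_qf n (X : T -> 'cV[R]_n) (A : 'M[R]_n) :
  (forall i j, integ P (fun om => X om i 0 * X om j 0)) ->
  integ P (fun om => qf A (X om)) /\
  ex P (fun om => qf A (X om)) = \tr (second_moment P X *m A).
Proof.
move=> iX.
have e : (fun om => qf A (X om)) = (fun om => \sum_i \sum_j A i j * (X om i 0 * X om j 0)).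
  by apply/funext => om; exact: qf_entries.
rewrite e; split.
  by apply: integ_sum => i; apply: integ_sum => j; exact: integZ.
rewrite ex_sum => [|i]; last by apply: integ_sum => j; exact: integZ.
have -> : \tr (second_moment P X *m A) = \sum_i \sum_j second_moment P X i j * A j i.
  by apply: eq_bigr => i _; rewrite mxE.
rewrite [RHS]exchange_big /=; apply: eq_bigr => i _.
rewrite ex_sum => [|j]; last exact: integZ.
apply: eq_bigr => j _; rewrite exZ // second_momentE mulrC; congr (ex P _ * _).
by apply/funext => om; rewrite mulrC.
Qed.

Lemma second_moment_psd n (X : T -> 'cV[R]_n) :
  (forall i j, integ P (fun om => X om i 0 * X om j 0)) -> psdmx (second_moment P X).
Proof.
move=> iX; split.
  apply/matrixP => i j; rewrite mxE !second_momentE; congr ex.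
  by apply/funext => om; rewrite mulrC.
move=> x; rewrite -/(qf _ _) -mxtrace_rank1M -(ex_qf _ iX).2; apply: ex_ge0 => om.
by rewrite qf_rank1 sqr_ge0.
Qed.
End RandomVectors.

(** * Second moments along the dynamics with multiplicative noise *)

Section Disturbance.
Context {R : realType}.
Variables (nx nu nv nw : nat).
Variable M : 'I_nw -> 'M[R]_(nx, nx + nu).
Variables (At : 'I_nv -> 'M[R]_nx) (Bt : 'I_nv -> 'M[R]_(nx, nu)).
Hypothesis rkM : \rank (unfold3 M) = nw.
Hypothesis rkMV :
  \rank (col_mx (unfold3 M) (unfold3 (fun i => row_mx (At i) (Bt i)))) = nw.
Let dist := disturbance M At Bt.

Lemma vec_inj m n : injective (@vec R m n).
Proof.
move=> X Y /matrixP h; apply/matrixP => i j.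
by have := h (mxtens_index (j, i)) 0; rewrite !mxE mxtens_indexK.
Qed.

Lemma vec_linear m n : linear (@vec R m n).
Proof. by move=> a u v; apply/colP => p; rewrite !mxE. Qed.

(** By the two rank conditions the rows of V_(3) lie in the row space of M_(3). The linear system
    for the coordinates is therefore solvable, and the pseudo-inverse solves it exactly. *)
Lemma dyn_disturbance (v : 'cV[R]_nv) :
  row_mx (dynA At v) (dynB Bt v) = \sum_k dist v k 0 *: M k.
Proof.
have uE k (N : 'I_k -> 'M[R]_(nx, nx + nu)) (w : 'cV[R]_k) :
    (unfold3 N)^T *m w = vec (\sum_i w i 0 *: N i).
  rewrite (lin_sum _ _ _ (@vec_linear nx (nx + nu))); apply/colP => p; rewrite mxE summxE.
  apply: eq_bigr => i _; rewrite (lin_Z _ (@vec_linear nx (nx + nu))) mxE [in RHS]mxE.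
  by rewrite mxE mulrC; congr (_ * _); rewrite mxE.
have := rkMV; set V := unfold3 (fun i => row_mx (At i) (Bt i)) => rkV.
have VM : (V <= unfold3 M)%MS.
  apply: submx_trans (addsmxSr (unfold3 M) V) _.
  have h : (unfold3 M <= unfold3 M + V)%MS by exact: addsmxSl.
  rewrite -(geq_leqif (mxrank_leqif_sup h)).
  by rewrite addsmxE rkV rkM.
have [D eD] := submxP VM.
have e : (unfold3 M)^T *m dist v = V^T *m v.
  rewrite /dist /disturbance -/V eD trmx_mul !mulmxA.
  by have [-> _ _ _] := mpinvP (unfold3 M)^T.
apply: vec_inj; rewrite -uE e /V uE; congr vec.
rewrite /dynA /dynB.
have -> : \sum_i v i 0 *: row_mx (At i) (Bt i) =
  \sum_i row_mx (v i 0 *: At i) (v i 0 *: Bt i) by apply: eq_bigr => i _; rewrite scale_row_mx.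
elim/big_rec3: _ => [|i a b c _ <-]; first by rewrite row_mx0.
by rewrite add_row_mx.
Qed.
End Disturbance.

Section MomentStep.
Context {R : realType} {d : measure_display} {T : measurableType d}.
Variable P : probability T R.
Variables (nx nu nv nw : nat).
Variable M : 'I_nw -> 'M[R]_(nx, nx + nu).
Variables (At : 'I_nv -> 'M[R]_nx) (Bt : 'I_nv -> 'M[R]_(nx, nu)).
Hypothesis rkM : \rank (unfold3 M) = nw.
Hypothesis rkMV :
  \rank (col_mx (unfold3 M) (unfold3 (fun i => row_mx (At i) (Bt i)))) = nw.
Let dist := disturbance M At Bt.

Lemma dyn_stepE v x u :
  dyn_step At Bt v x u = \sum_k dist v k 0 *: (M k *m col_mx x u).
Proof.
rewrite /dyn_step -mul_row_col (dyn_disturbance rkM rkMV) mulmx_suml.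
by apply: eq_bigr => k _; rewrite -scalemxAl.
Qed.

Lemma dyn_step_coord v x u a : dyn_step At Bt v x u a 0 =
  \sum_k \sum_i M k a i * (dist v k 0 * col_mx x u i 0).
Proof.
rewrite dyn_stepE summxE; apply: eq_bigr => k _; rewrite mxE [X in _ * X]mxE mulr_sumr.
by apply: eq_bigr => i _; ring.
Qed.

Lemma dist_coord v k : dist v k 0 =
  \sum_i (mpinv (unfold3 M)^T *m (unfold3 (fun i => row_mx (At i) (Bt i)))^T) k i * v i 0.
Proof. by rewrite /dist /disturbance mxE. Qed.

Variables (G : set (set T)) (v : T -> 'cV[R]_nv) (x : T -> 'cV[R]_nx) (u : T -> 'cV[R]_nu).
Let z om := col_mx (x om) (u om).
Variable rw : R.
Hypotheses (mG : <<s G >> `<=` measurable) (rv : random_vector v).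
Hypothesis iGv : indep2 P <<s G >> (sigma_of v).
Hypothesis fz : forall i, fmeas <<s G >> (fun om => z om i 0).
Hypothesis sz : square_integrable P z.
Hypothesis bv : {ae P, forall om, norm2 (dist (v om)) <= rw}.

Lemma fmeas_dist k : fmeas (sigma_of v) (fun om => dist (v om) k 0).
Proof.
have <- := sigma_algebra_id (sigma_of_salg v).
apply/fmeasP; under eq_fun do rewrite dist_coord.
apply: measurable_sum => i; apply: measurable_funM; first exact: measurable_cst.
by apply/fmeasP; apply: fmeas_sigma_of; exact: sub_sigma_algebra.
Qed.

Lemma dist_mul_integ k l :
  integ P (fun om => dist (v om) k 0 * dist (v om) l 0).
Proof.
have m1 k' : measurable_fun setT (fun om => dist (v om) k' 0).
  apply: (fmeas_measurable (sigma_of_measurable rv)); exact: fmeas_dist.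
apply: (@integ_bound _ _ _ _ _ (rw ^+ 2)); first exact: measurable_funM.
apply: filterS bv => om h; rewrite normrM expr2.
by apply: ler_pM => //; apply: le_trans (norm2_entry _ _) h.
Qed.

Lemma noise_state_product k l i j :
  integ P (fun om => (dist (v om) k 0 * dist (v om) l 0) * (z om i 0 * z om j 0)) /\
  ex P (fun om => (dist (v om) k 0 * dist (v om) l 0) * (z om i 0 * z om j 0)) =
  second_moment P (fun om => dist (v om)) k l * second_moment P z i j.
Proof.
rewrite !second_momentE.
have mz i' : measurable_fun setT (fun om => z om i' 0).
  exact: fmeas_measurable mG (fz i').
have iz := square_integ_mul i j mz sz.
have iw := dist_mul_integ k l.
have fz2 : fmeas <<s G >> (fun om => z om i 0 * z om j 0).
  by apply/fmeasP; apply: measurable_funM; apply/fmeasP; exact: fz.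
have fw2 : fmeas (sigma_of v) (fun om => dist (v om) k 0 * dist (v om) l 0).
  have <- := sigma_algebra_id (sigma_of_salg v).
  apply/fmeasP; apply: measurable_funM; apply/fmeasP;
  rewrite (sigma_algebra_id (sigma_of_salg v)); exact: fmeas_dist.
have [h1 h2] := ex_indep mG (sigma_of_measurable rv) iGv fz2 fw2 iz iw.
rewrite (_ : (fun om => _) = (fun om => z om i 0 * z om j 0 * (dist (v om) k 0 * dist (v om) l 0))).
  by split=> //; rewrite h2 mulrC.
by apply/funext => om; rewrite mulrC.
Qed.

(** Each entry is a sum of products of two noise and two state-input coordinates; independence of
    [v] from the past factors their expectations. *)
Lemma moment_step :
  square_integrable P (fun om => dyn_step At Bt (v om) (x om) (u om)) /\
  second_moment P (fun om => dyn_step At Bt (v om) (x om) (u om)) =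
  momE M (second_moment P (fun om => dist (v om))) (second_moment P z).
Proof.
have eE a b om : dyn_step At Bt (v om) (x om) (u om) a 0 * dyn_step At Bt (v om) (x om) (u om) b 0
  = \sum_k \sum_l \sum_i \sum_j (M k a i * M l b j) *
     ((dist (v om) k 0 * dist (v om) l 0) * (z om i 0 * z om j 0)).
  rewrite !dyn_step_coord mulr_suml; apply: eq_bigr => k _; rewrite mulr_sumr.
  apply: eq_bigr => l _; rewrite mulr_suml; apply: eq_bigr => i _; rewrite mulr_sumr.
  by apply: eq_bigr => j _; rewrite /z; ring.
have iE a b : integ P (fun om => \sum_k \sum_l \sum_i \sum_j (M k a i * M l b j) *
     ((dist (v om) k 0 * dist (v om) l 0) * (z om i 0 * z om j 0))).
  do 4 (apply: integ_sum => ?); apply: integZ; exact: (noise_state_product _ _ _ _).1.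
split.
  move=> a; have := iE a a; rewrite /integ; congr integrable.
  by apply/funext => om /=; rewrite expr2 eE.
apply/matrixP => a b; rewrite second_momentE; under eq_fun do rewrite eE.
rewrite ex_sum => [|k]; last first.
  do 3 (apply: integ_sum => ?); apply: integZ; exact: (noise_state_product _ _ _ _).1.
rewrite /momE summxE; apply: eq_bigr => k _.
rewrite ex_sum => [|l]; last first.
  do 2 (apply: integ_sum => ?); apply: integZ; exact: (noise_state_product _ _ _ _).1.
rewrite summxE; apply: eq_bigr => l _.
rewrite ex_sum => [|i]; last first.
  apply: integ_sum => ?; apply: integZ; exact: (noise_state_product _ _ _ _).1.
rewrite [RHS]mxE -mulmxA [X in _ = _ * X]mxE mulr_sumr; apply: eq_bigr => i _.
rewrite ex_sum => [|j]; last first.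
  apply: integZ; exact: (noise_state_product _ _ _ _).1.
rewrite [X in _ = _ * (_ * X)]mxE !mulr_sumr; apply: eq_bigr => j _.
rewrite exZ; last exact: (noise_state_product _ _ _ _).1.
by rewrite (noise_state_product _ _ _ _).2 [(M l)^T _ _]mxE; ring.
Qed.
End MomentStep.

Section Laws.
Context {R : realType}.

(** Column vectors as a measurable type whose measurable sets are [vborel n] by conversion. *)
Definition vspace n := g_sigma_algebraType
  (\big[setU/set0]_(i < n) preimage_set_system setT (fun x : 'cV[R]_n => x i 0) measurable).

Lemma vspace_coord n (i : 'I_n) : measurable_fun setT (fun x : vspace n => x i 0).
Proof. by move=> _ B mB; rewrite setTI; exact: vborel_coord. Qed.

Lemma vspace_random d (T : measurableType d) n (X : T -> 'cV[R]_n) :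
  random_vector X -> measurable_fun setT (X : T -> vspace n).
Proof. by move=> h _ B mB; rewrite setTI; exact: h. Qed.

Lemma measurable_norm2 d (T : measurableType d) n (X : T -> 'cV[R]_n) :
  (forall i, measurable_fun setT (fun om => X om i 0)) ->
  measurable_fun setT (fun om => norm2 (X om)).
Proof.
move=> h; apply: (measurableT_comp (f := @Num.sqrt R)); first by apply: continuous_measurable_fun; exact: sqrt_continuous.
by apply: measurable_sum => i; apply: measurable_funX; exact: h.
Qed.

Context {d1 : measure_display} {T1 : measurableType d1} (P1 : probability T1 R).
Context {d2 : measure_display} {T2 : measurableType d2} (P2 : probability T2 R).
Variables (n : nat) (X : T1 -> 'cV[R]_n) (Y : T2 -> 'cV[R]_n).
Hypotheses (rX : random_vector X) (rY : random_vector Y) (lXY : same_law P1 P2 X Y).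

Lemma law_ex (f : 'cV[R]_n -> R) : measurable_fun setT (f : vspace n -> R) ->
  integ P1 (fun om => f (X om)) ->
  integ P2 (fun om => f (Y om)) /\ ex P2 (fun om => f (Y om)) = ex P1 (fun om => f (X om)).
Proof.
move=> mf iX; have mX := vspace_random rX; have mY := vspace_random rY.
have eP (g : vspace n -> \bar R) : (\int[pushforward P1 (X : T1 -> vspace n)]_x g x =
    \int[pushforward P2 (Y : T2 -> vspace n)]_x g x)%E.
  by apply: eq_measure_integral => A mA _; exact: lXY.
have mfe : measurable_fun setT (fun x : vspace n => (f x)%:E) by exact/measurable_EFinP.
have iY : integ P2 (fun om => f (Y om)).
  apply/integrableP; split; first exact: (measurableT_comp mfe mY).
  have /integrableP[_] := iX; congr (_ < _)%E.
  transitivity (\int[pushforward P1 (X : T1 -> vspace n)]_x `|(f x)%:E|)%E.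
    by rewrite (ge0_integral_pushforward mX) //; exact: measurableT_comp.
  by rewrite eP (ge0_integral_pushforward mY) //; exact: measurableT_comp.
split => //; congr fine.
transitivity (\int[pushforward P2 (Y : T2 -> vspace n)]_x (f x)%:E)%E.
  by rewrite (integral_pushforward mY).
by rewrite -eP (integral_pushforward mX).
Qed.

Lemma law_ae_le (f : 'cV[R]_n -> R) c : measurable_fun setT (f : vspace n -> R) ->
  {ae P1, forall om, f (X om) <= c} -> {ae P2, forall om, f (Y om) <= c}.
Proof.
move=> mf hX.
have vB : vborel [set x : 'cV[R]_n | c < f x].
  have := measurable_fun_le measurableT mf (@measurable_cst _ _ (vspace n) R setT c).
  rewrite setTI => /measurableC; congr vborel; apply/seteqP.
  by split=> x /=; rewrite ltNge => /negP.
exists (Y @^-1` [set x | c < f x]); split.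
- exact: rY.
- rewrite -lXY //; have [N [mN N0 hN]] := hX.
  apply/eqP; rewrite eq_le measure_ge0 andbT -N0; apply: le_measure; rewrite ?inE //.
    exact: rX.
  by apply: subset_trans hN => om /= h; rewrite leNgt h.
by move=> om /=; rewrite ltNge => /negP.
Qed.
End Laws.

(** * The stochastic problem as a moment problem *)

Section StochasticProblem.
Context {R : realType} {d : measure_display} {T : measurableType d}.
Variable P : probability T R.
Variables (nx nu nv nw : nat).
Variable M : 'I_nw -> 'M[R]_(nx, nx + nu).
Variables (At : 'I_nv -> 'M[R]_nx) (Bt : 'I_nv -> 'M[R]_(nx, nu)).
Variables (Qx : 'M[R]_nx) (Ru : 'M[R]_nu) (rw : R).
Variables (x0 : T -> 'cV[R]_nx) (v : nat -> T -> 'cV[R]_nv).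
Hypothesis rkM : \rank (unfold3 M) = nw.
Hypothesis rkMV :
  \rank (col_mx (unfold3 M) (unfold3 (fun i => row_mx (At i) (Bt i)))) = nw.
Hypothesis pdH : pdmx (block_mx Qx 0 0 Ru).
Hypotheses (rx0 : random_vector x0) (sx0 : square_integrable P x0).
Hypothesis rv : forall t, random_vector (v t).
Hypothesis lv : forall t, same_law P P (v t) (v 0%N).
Let Fam (i : option nat) := if i is Some t then sigma_of (v t) else sigma_of x0.
Hypothesis iv : independent P Fam.
Let dist := disturbance M At Bt.
Hypothesis bv0 : {ae P, forall om, norm2 (dist (v 0%N om)) <= rw}.
Let Hc := block_mx Qx 0 0 Ru.
Let X0 := second_moment P x0.
Let W := second_moment P (fun om => dist (v 0%N om)).

Lemma dist_measurable_vspace k : measurable_fun setT (fun x : vspace nv => dist x k 0).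
Proof.
have -> : (fun x : vspace nv => dist x k 0) = (fun x : vspace nv => \sum_i
    (mpinv (unfold3 M)^T *m (unfold3 (fun i => row_mx (At i) (Bt i)))^T) k i * x i 0).
  by apply/funext => x; rewrite /dist dist_coord.
by apply: measurable_sum => i; apply: measurable_funM => //; exact: vspace_coord.
Qed.

Lemma dist_bounded t : {ae P, forall om, norm2 (dist (v t om)) <= rw}.
Proof.
apply: (law_ae_le (rv 0%N) (rv t) (f := fun x => norm2 (dist x)) _ _ bv0).
  by move=> A vA; rewrite lv.
by apply: measurable_norm2 => i; exact: dist_measurable_vspace.
Qed.

Lemma dist_second_moment t : second_moment P (fun om => dist (v t om)) = W.
Proof.
apply/matrixP => k l; rewrite !second_momentE.
have lvt : same_law P P (v 0%N) (v t) by move=> A vA; rewrite lv.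
have mf : measurable_fun setT (fun x : vspace nv => dist x k 0 * dist x l 0).
  by apply: measurable_funM; exact: dist_measurable_vspace.
by have [_ ->] := law_ex (rv 0%N) (rv t) lvt mf (dist_mul_integ (rv 0%N) bv0 k l).
Qed.

Lemma Wpsd : psdmx W.
Proof. by apply: second_moment_psd => i j; exact: (dist_mul_integ (rv 0%N) bv0). Qed.

Lemma W_posnoise : posnoise M W.
Proof. by split; [exact/psd_sym/Wpsd|exact/madj_psd/Wpsd]. Qed.

Lemma x0_measurable i : measurable_fun setT (fun om => x0 om i 0).
Proof. by move/random_vectorP: rx0. Qed.

Lemma X0psd : psdmx X0.
Proof.
by apply: second_moment_psd => i j; apply: square_integ_mul => // k; exact: x0_measurable.
Qed.

Definition joint (u : nat -> T -> 'cV[R]_nu) t om :=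
  col_mx (state At Bt x0 v u t om) (u t om).

Lemma stage_costE u t om : ((state At Bt x0 v u t om)^T *m Qx *m state At Bt x0 v u t om
      + (u t om)^T *m Ru *m u t om) 0 0 = qf Hc (joint u t om).
Proof.
rewrite /joint /Hc qf_row block_mxKul block_mxKur block_mxKdl block_mxKdr.
by rewrite !mul0mx !dot0r !addr0 mxE.
Qed.

Lemma stage_costs_integrable u :
  (forall t i, measurable_fun setT (fun om => joint u t om i 0)) ->
  slqr_cost P At Bt Qx Ru x0 v u = (\sum_(0 <= t <oo) \int[P]_om (qf Hc (joint u t om))%:E)%E.
Proof.
move=> mz; rewrite /slqr_cost -integral_nneseries //.
- by apply: eq_integral => om _; apply: eq_eseriesr => t _; rewrite stage_costE.
- by move=> t; apply/measurable_EFinP; exact: measurable_qf.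
- by move=> t om _; rewrite lee_fin; exact/psd_qf/pd_psd.
Qed.

Lemma slqr_cost_moments u :
  (forall t i, measurable_fun setT (fun om => joint u t om i 0)) ->
  (forall t, square_integrable P (joint u t)) ->
  slqr_cost P At Bt Qx Ru x0 v u = moment_cost Qx Ru (fun t => second_moment P (joint u t)).
Proof.
move=> mz sz; rewrite stage_costs_integrable //; apply: eq_eseriesr => t _.
have iz i j : integ P (fun om => joint u t om i 0 * joint u t om j 0).
  by apply: square_integ_mul.
by have [h1 h2] := ex_qf Hc iz; rewrite -exE // h2.
Qed.

Lemma second_moment_ul u t : ulsubmx (second_moment P (joint u t)) =
  second_moment P (state At Bt x0 v u t).
Proof.
by apply/matrixP => i j; rewrite !mxE /joint; under eq_fun do rewrite !col_mxEu.
Qed.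

Lemma history_mono (u : nat -> T -> 'cV[R]_nu) s t : (s <= t)%N -> history x0 v u s `<=` history x0 v u t.
Proof.
move=> st; apply: sub_sigma_algebra2 => A [[h|[r /= rs h]]|[r /= rs h]].
- by left; left.
- by left; right; exists r => //=; exact: leq_trans rs st.
- by right; exists r => //=; exact: leq_trans rs st.
Qed.

Lemma history_measurable (u : nat -> T -> 'cV[R]_nu) t : admissible P x0 v u -> history x0 v u t `<=` measurable.
Proof.
move=> hu; apply: smallest_sub; first exact: sigma_algebra_measurable.
move=> A [[h|[r /= rs h]]|[r /= rs h]].
- exact: sigma_of_measurable h.
- by apply: sigma_of_measurable h; exact: (hu r).1.
- exact: sigma_of_measurable h.
Qed.

Lemma history_joint u t i : admissible P x0 v u ->
  fmeas (history x0 v u t) (fun om => joint u t om i 0).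
Proof.
move=> hu.
have us s j : fmeas (history x0 v u s) (fun om => u s om j 0).
  apply: fmeas_sigma_of => A h; apply: sub_sigma_algebra; left; right; by exists s => //=.
have xs s j : fmeas (history x0 v u s) (fun om => state At Bt x0 v u s om j 0).
  elim: s j => [|s IH] j.
    by apply: fmeas_sigma_of => A h; apply: sub_sigma_algebra; left; left.
  have zs k : fmeas (history x0 v u s.+1) (fun om => joint u s om k 0).
    suff zs' : fmeas (history x0 v u s) (fun om => joint u s om k 0).
      by move=> B mB; apply: (history_mono (leqnSn s)); exact: zs'.
    rewrite /joint; case: (splitP k) => k' kE.
      have -> : k = lshift nu k' by apply/val_inj.
      by under [X in fmeas _ X]eq_fun do rewrite col_mxEu; exact: IH.
    have -> : k = rshift nx k' by apply/val_inj.
    by under [X in fmeas _ X]eq_fun do rewrite col_mxEd; exact: us.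
  apply/fmeasP; rewrite /=; under [X in measurable_fun _ X]eq_fun do rewrite (dyn_step_coord rkM rkMV).
  apply: measurable_sum => k; apply: measurable_sum => l; apply: measurable_funM => //.
  apply: measurable_funM; last by apply/fmeasP; exact: zs.
  under [X in measurable_fun _ X]eq_fun do rewrite /dist dist_coord; apply: measurable_sum => m.
  apply: measurable_funM => //; apply/fmeasP; apply: fmeas_sigma_of => A h.
  by apply: sub_sigma_algebra; right; exists s => //=.
rewrite /joint; case: (splitP i) => k' kE.
  have -> : i = lshift nu k' by apply/val_inj.
  by under [X in fmeas _ X]eq_fun do rewrite col_mxEu; exact: xs.
have -> : i = rshift nx k' by apply/val_inj.
by under [X in fmeas _ X]eq_fun do rewrite col_mxEd; exact: us.
Qed.

Lemma joint_measurable u t i : admissible P x0 v u ->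
  measurable_fun setT (fun om => joint u t om i 0).
Proof.
move=> hu; exact: (fmeas_measurable (@history_measurable u t hu) (@history_joint u t i hu)).
Qed.

Lemma admissible_feasible u : admissible P x0 v u ->
  (forall t, square_integrable P (joint u t)) ->
  moment_feasible M W X0 (fun t => second_moment P (joint u t)).
Proof.
move=> hu sz; split.
- move=> t; apply: second_moment_psd => i j; apply: square_integ_mul => // k.
  exact: joint_measurable.
- by rewrite second_moment_ul.
- move=> t; rewrite second_moment_ul -(dist_second_moment t).
  by have [_ ->] := moment_step rkM rkMV (@history_measurable u t hu) (rv t) (hu t).2
    (fun i => @history_joint u t i hu) (sz t) (dist_bounded t).
Qed.

(** A finite cost makes state and input square integrable, because the cost matrix is bounded below
    by a positive multiple of the identity. Their second moments are then feasible for the moment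
    problem, whose lower bound applies. *)
Lemma slqr_cost_ge (S : 'M[R]_nx) u : psdmx S ->
  lemx (block_mx S 0 0 0) (Hc + madj M W S) -> admissible P x0 v u ->
  ((\tr (S *m X0))%:E <= slqr_cost P At Bt Qx Ru x0 v u)%E.
Proof.
move=> pS hS hu; have mz t i := joint_measurable t i hu.
have [->|fin] := eqVneq (slqr_cost P At Bt Qx Ru x0 v u) +oo%E; first by rewrite leey.
have [h h0 hH] := pd_ge pdH.
have sz t : square_integrable P (joint u t).
  have q0 om : 0 <= qf Hc (joint u t om) by exact/psd_qf/pd_psd.
  have mq : measurable_fun setT (fun om => qf Hc (joint u t om)) by exact: measurable_qf.
  have iq : integ P (fun om => qf Hc (joint u t om)).
    apply/integrableP; split; first exact/measurable_EFinP.
    under eq_integral => om _ do rewrite /= ger0_norm //.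
    rewrite ltey; apply: contra fin => /eqP e; apply/eqP.
    rewrite stage_costs_integrable //.
    apply: (@nneseries_pinfty _ _ xpredT t) => // s _; apply: integral_ge0 => om _.
    by rewrite lee_fin; exact/psd_qf/pd_psd.
  move=> i; apply: (@integ_dom _ _ _ _ _ (fun om => h^-1 * qf Hc (joint u t om))).
  - exact: measurable_funX.
  - exact: integZ.
  apply: aeW => om; rewrite ger0_norm ?sqr_ge0 // ler_pdivlMl //.
  apply: le_trans (lemx_qf (joint u t om) hH); rewrite qf_scalar ler_pM2l // dotE.
  rewrite (bigD1 i) //= -expr2 lerDl sumr_ge0 // => j _.
  by rewrite -expr2 sqr_ge0.
rewrite slqr_cost_moments //.
exact: (moment_cost_ge pdH W_posnoise pS hS (admissible_feasible hu sz)).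
Qed.

Section Feedback.
Variable K : 'M[R]_(nu, nx).
Let u := feedback_input At Bt x0 v K.

Lemma state_feedback t om : state At Bt x0 v u t om = feedback_state At Bt x0 v K t om.
Proof. by elim: t => //= t ->. Qed.

(** Indices of the random vectors known at time [t]; [None] stands for [x0]. *)
Definition past t := None :: [seq Some s | s <- iota 0 t].

Lemma mem_past t s : (Some s \in past t) = (s < t)%N.
Proof. by rewrite /past in_cons /= mem_map ?mem_iota ?add0n // => a b []. Qed.

Let Gen t := [set A | exists2 j, j \in past t & Fam j A].

Lemma Fam_salg j : sigma_algebra setT (Fam j).
Proof. by case: j => [t|]; exact: sigma_of_salg. Qed.

Lemma Fam_measurable j : Fam j `<=` measurable.
Proof. by case: j => [t|]; exact: sigma_of_measurable. Qed.

Lemma Gen_measurable t : <<s Gen t >> `<=` measurable.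
Proof.
apply: smallest_sub; first exact: sigma_algebra_measurable.
by move=> A [j _]; exact: Fam_measurable.
Qed.

Lemma Gen_mono s t : (s <= t)%N -> <<s Gen s >> `<=` <<s Gen t >>.
Proof.
move=> st; apply: sub_sigma_algebra2 => A [j js h]; exists j => //.
by case: j js {h} => [r|//]; rewrite !mem_past => /leq_trans; exact.
Qed.

Lemma Gen_indep t : indep2 P <<s Gen t >> (sigma_of (v t)).
Proof.
apply: (@indep_generated _ _ _ P _ Fam (past t) (Some t)) => //.
- exact: Fam_salg.
- exact: Fam_measurable.
by rewrite mem_past ltnn.
Qed.

Lemma Gen_state t i : fmeas <<s Gen t >> (fun om => feedback_state At Bt x0 v K t om i 0).
Proof.
elim: t i => [|t IH] i.
  apply: fmeas_sigma_of => A h; by apply: sub_sigma_algebra; exists None => //.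
have IH' j : fmeas <<s Gen t.+1 >> (fun om => feedback_state At Bt x0 v K t om j 0).
  by move=> B mB; apply: (Gen_mono (leqnSn t)); exact: IH.
apply/fmeasP => /=; under [X in measurable_fun _ X]eq_fun do rewrite (dyn_step_coord rkM rkMV).
apply: measurable_sum => k; apply: measurable_sum => l; apply: measurable_funM => //.
apply: measurable_funM.
  under [X in measurable_fun _ X]eq_fun do rewrite /dist dist_coord; apply: measurable_sum => m.
  apply: measurable_funM => //; apply/fmeasP; apply: fmeas_sigma_of => A h.
  apply: sub_sigma_algebra; exists (Some t) => //.
  by rewrite mem_past.
case: (splitP l) => l' lE.
  have -> : l = lshift nu l' by apply/val_inj.
  by under [X in measurable_fun _ X]eq_fun do rewrite col_mxEu; apply/fmeasP; exact: IH'.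
have -> : l = rshift nx l' by apply/val_inj.
under [X in measurable_fun _ X]eq_fun do rewrite col_mxEd mxE.
apply: measurable_sum => j; apply: measurable_funM => //; apply/fmeasP; exact: IH'.
Qed.

Lemma Gen_input t i : fmeas <<s Gen t >> (fun om => u t om i 0).
Proof.
apply/fmeasP; under [X in measurable_fun _ X]eq_fun do rewrite /u /feedback_input mxE.
by apply: measurable_sum => j; apply: measurable_funM => //; apply/fmeasP; exact: Gen_state.
Qed.

(** Under feedback the inputs are functions of [x0] and of the past noise, so the history at time
    [t] lies in the sigma-algebra generated by [Gen t], which is independent of [v t]. *)
Lemma feedback_admissible : admissible P x0 v u.
Proof.
move=> t; split.
  apply/random_vectorP => i; exact: (fmeas_measurable (@Gen_measurable t) (@Gen_input t i)).
move=> A B hA sB; apply: (@Gen_indep t A B _ sB).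
move: A hA.
apply: smallest_sub; first exact: smallest_sigma_algebra.
move=> A [[h|[r /= rs h]]|[r /= rs h]].
- by apply: sub_sigma_algebra; exists None.
- apply: (Gen_mono rs); apply: sigma_of_fmeas h => i; exact: Gen_input.
- apply: sub_sigma_algebra; exists (Some r) => //.
  by rewrite mem_past.
Qed.

Lemma jointE t om : joint u t om = col_mx 1%:M K *m state At Bt x0 v u t om.
Proof. by rewrite /joint {2}/u /feedback_input -state_feedback mul_col_mx mul1mx. Qed.

Lemma joint_square_integrable t : square_integrable P (state At Bt x0 v u t) ->
  square_integrable P (joint u t) /\
  second_moment P (joint u t) = Defs.liftK K (second_moment P (state At Bt x0 v u t)).
Proof.
move=> sx.
have mx i : measurable_fun setT (fun om => state At Bt x0 v u t om i 0).
  under [X in measurable_fun _ X]eq_fun do rewrite state_feedback.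
  exact: (fmeas_measurable (@Gen_measurable t) (@Gen_state t i)).
have ix i j := square_integ_mul i j mx sx.
pose E := col_mx 1%:M K; have jE om : joint u t om = E *m state At Bt x0 v u t om := jointE t om.
have e a b om : joint u t om a 0 * joint u t om b 0 = \sum_i \sum_j (E a i * E b j) *
   (state At Bt x0 v u t om i 0 * state At Bt x0 v u t om j 0).
  rewrite jE !mxE mulr_suml; apply: eq_bigr => i _; rewrite mulr_sumr.
  by apply: eq_bigr => j _; ring.
have ie a b : integ P (fun om => joint u t om a 0 * joint u t om b 0).
  by under eq_fun do rewrite e; do 2 (apply: integ_sum => ?); exact: integZ.
split.
  move=> a; have := ie a a.
  rewrite /integ (_ : EFin \o _ = (fun om => (joint u t om a 0 ^+ 2)%:E)) //.
apply/matrixP => a b; rewrite second_momentE; under eq_fun do rewrite e.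
rewrite /Defs.liftK; have -> : row_mx 1%:M K^T = E^T by rewrite tr_col_mx trmx1.
rewrite -/E ex_sum => [|i]; last by apply: integ_sum => ?; exact: integZ.
rewrite -mulmxA [RHS]mxE; apply: eq_bigr => i _.
rewrite ex_sum => [|j]; last exact: integZ.
rewrite [X in _ = _ * X]mxE mulr_sumr; apply: eq_bigr => j _.
by rewrite exZ // second_momentE [E^T _ _]mxE; ring.
Qed.

Lemma feedback_moments t : square_integrable P (joint u t) /\
  second_moment P (joint u t) = closed_loop_moments M W X0 K t.
Proof.
suff h : square_integrable P (state At Bt x0 v u t) /\
    second_moment P (state At Bt x0 v u t) = iter t (momEK M K W) X0.
  by have [s1 s2] := h; have [j1 j2] := joint_square_integrable s1; rewrite j2 s2.
elim: t => [|t [s1 s2]]; first by split.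
have [j1 j2] := joint_square_integrable s1.
have fz i : fmeas <<s Gen t >> (fun om => joint u t om i 0).
  rewrite /joint; case: (splitP i) => l' lE.
    have -> : i = lshift nu l' by apply/val_inj.
    by under [X in fmeas _ X]eq_fun do rewrite col_mxEu state_feedback; exact: Gen_state.
  have -> : i = rshift nx l' by apply/val_inj.
  by under [X in fmeas _ X]eq_fun do rewrite col_mxEd; exact: Gen_input.
have [m1 m2] := moment_step rkM rkMV (@Gen_measurable t) (rv t) (@Gen_indep t) fz j1 (dist_bounded t).
split; first exact: m1.
by rewrite iterS -s2 /momEK -j2 -(dist_second_moment t); exact: m2.
Qed.

Lemma slqr_cost_feedback :
  slqr_cost P At Bt Qx Ru x0 v u = moment_cost Qx Ru (closed_loop_moments M W X0 K).
Proof.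
rewrite slqr_cost_moments.
- by congr moment_cost; apply/funext => t; exact: (feedback_moments t).2.
- by move=> t i; apply: joint_measurable; exact: feedback_admissible.
- by move=> t; exact: (feedback_moments t).1.
Qed.
End Feedback.
End StochasticProblem.

(** * Matrix Hoeffding inequality *)

Section TracePowers.
Context {R : realType}.
Variable n : nat.
Implicit Types A B X Y Z S : 'M[R]_n.

Lemma mxtrace_mulCr A B : \tr (A * B) = \tr (B * A).
Proof. exact: mxtrace_mulC. Qed.

Lemma mulrmxZl a A B : (a *: A) * B = a *: (A * B).
Proof. exact/esym/scalemxAl. Qed.

Lemma mulrmxZr a A B : A * (a *: B) = a *: (A * B).
Proof. exact/esym/scalemxAr. Qed.

Lemma mxtrace_powC A B k : \tr ((A * B) ^+ k) = \tr ((B * A) ^+ k).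
Proof.
case: k => [|k]; first by rewrite !expr0.
have e j : (A * B) ^+ j * A = A * (B * A) ^+ j.
  by elim: j => [|j IH]; rewrite ?expr0 ?mul1r ?mulr1 // !exprS -!mulrA IH.
rewrite exprSr mulrA e -mulrA mxtrace_mulCr -mulrA -exprSr //.
Qed.

Lemma trmx_pow A k : (A ^+ k)^T = (A^T) ^+ k.
Proof.
elim: k => [|k IH]; first by rewrite !expr0 trmx1.
by rewrite exprS exprSr -[_ * _]/(_ *m _) trmx_mul IH.
Qed.

Lemma symmx_pow A k : symmx A -> symmx (A ^+ k).
Proof. by move=> sA; rewrite /symmx trmx_pow sA. Qed.

Lemma psd_sqr A : symmx A -> psdmx (A * A).
Proof. by move=> sA; have := psd_gram A; rewrite sA. Qed.

Lemma psd_pow2 A k : symmx A -> psdmx (A ^+ (k.*2)).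
Proof. by move=> sA; rewrite -addnn exprD; apply/psd_sqr/symmx_pow. Qed.

Lemma mxtrace_AMGM A B : 2 * \tr (A^T * B) <= \tr (A^T * A) + \tr (B^T * B).
Proof.
have := mxtrace_psd_ge0 (psd_gram (A - B)).
have -> : (A - B)^T *m (A - B) = A^T * A + B^T * B - A^T * B - B^T * A.
  have -> : (A - B)^T = A^T - B^T by rewrite linearB.
  rewrite -[_ *m _]/(_ * _) mulrBl !mulrBr.
  by apply/matrixP => i j; rewrite !mxE; ring.
rewrite !raddfB raddfD /=.
have -> : \tr (B^T * A) = \tr (A^T * B).
  by rewrite -mxtrace_tr -[_ * _]/(_ *m _) trmx_mul trmxK.
lra.
Qed.

(* Golden-Thompson for powers: the two bounds feed each other in the induction on j. *)
Lemma mxtrace_pow_le j :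
  (forall X Y, symmx X -> symmx Y ->
     \tr ((X * Y) ^+ (2 ^ j)) <= \tr (X ^+ (2 ^ j) * Y ^+ (2 ^ j))) /\
  (forall Z, \tr (Z ^+ (2 ^ j.+1)) <= \tr ((Z * Z^T) ^+ (2 ^ j))).
Proof.
elim: j => [|j [IH1 IH2]].
  split=> [X Y _ _|Z]; first by rewrite expn0 !expr1.
  rewrite expn0 expn1 expr1 expr2; have := mxtrace_AMGM Z^T Z; rewrite !trmxK.
  by rewrite [\tr (Z^T * Z)]mxtrace_mulCr; lra.
(* For [Z = X * Y] the product [Z * Z^T] is [X * Y ^+ 2 * X], cyclically a product of [X ^+ 2] and
   [Y ^+ 2], to which the first bound applies. *)
have H1 X Y : symmx X -> symmx Y ->
     \tr ((X * Y) ^+ (2 ^ j.+1)) <= \tr (X ^+ (2 ^ j.+1) * Y ^+ (2 ^ j.+1)).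
  move=> sX sY; apply: le_trans (IH2 _) _.
  have -> : (X * Y)^T = Y * X by rewrite -[_ * _]/(_ *m _) trmx_mul sX sY.
  rewrite -mulrA mxtrace_powC [X in X ^+ _](_ : _ = (Y ^+ 2) * (X ^+ 2)); last first.
    by rewrite !expr2 !mulrA.
  rewrite mxtrace_powC; apply: le_trans (IH1 _ _ (symmx_pow 2 sX) (symmx_pow 2 sY)) _.
  by rewrite -!exprM -expnS.
split=> // Z; rewrite expnS exprM.
(* Here the second bound is used for [Z ^+ 2]. Cyclicity pairs [Z^T * Z] with [Z * Z^T], whose
   powers have equal traces. *)
apply: le_trans (IH2 _) _.
have -> : \tr ((Z ^+ 2 * (Z ^+ 2)^T) ^+ (2 ^ j)) = \tr (((Z^T * Z) * (Z * Z^T)) ^+ (2 ^ j)).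
  rewrite trmx_pow !expr2 -!mulrA mxtrace_powC -!mulrA mxtrace_powC !mulrA.
  by rewrite -!mulrA mxtrace_powC !mulrA.
have s1 : symmx (Z^T * Z) by rewrite /symmx -[_ * _]/(_ *m _) trmx_mul trmxK.
have s2 : symmx (Z * Z^T) by rewrite /symmx -[_ * _]/(_ *m _) trmx_mul trmxK.
apply: le_trans (IH1 _ _ s1 s2) _.
have := mxtrace_AMGM ((Z^T * Z) ^+ (2 ^ j)) ((Z * Z^T) ^+ (2 ^ j)).
rewrite !trmx_pow s1 s2 -!exprD addnn -mul2n -expnS [\tr ((Z^T * Z) ^+ _)]mxtrace_powC.
lra.
Qed.

Lemma opb_pow c A k : 0 <= c -> opb c A -> opb (c ^+ k) (A ^+ k).
Proof.
move=> c0 h; elim: k => [|k IH]; first by rewrite !expr0; exact: opb1.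
by rewrite !exprS; exact: opbM.
Qed.

Lemma opb_pow_diff c e A B k : 1 <= c -> 0 <= e -> opb c A -> opb c B -> opb e (A - B) ->
  opb (k%:R * c ^+ k * e) (A ^+ k - B ^+ k).
Proof.
move=> c1 e0 hA hB hAB; have c0 : 0 <= c by lra.
elim: k => [|k IH]; first by rewrite !expr0 subrr !mul0r; exact: opb0.
have -> : A ^+ k.+1 - B ^+ k.+1 = A * (A ^+ k - B ^+ k) + (A - B) * B ^+ k.
  by rewrite !exprS mulrBr mulrBl addrA subrK.
apply: opbW (opbD (opbM c0 hA IH) (opbM e0 hAB (opb_pow k c0 hB))).
have ck : 1 <= c ^+ k by rewrite exprn_ege1.
have : e * c ^+ k <= e * (c * c ^+ k) by rewrite ler_wpM2l // ler_peMl //; lra.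
by rewrite -natr1 exprS; lra.
Qed.

Lemma opb_trace c A : opb c A -> `|\tr A| <= n%:R * c.
Proof.
move=> h; rewrite /mxtrace (le_trans (ler_norm_sum _ _ _)) //.
apply: (@le_trans _ _ (\sum_(i < n) c)); first by apply: ler_sum => i _; exact: opb_entry.
by rewrite sumr_const card_ord mulr_natl.
Qed.

(* One step of the Golden-Thompson telescope, with the Lie product error. *)
Lemma mxtrace_step s b S B k (m := (2 ^ k)%N) : 0 <= s -> 0 <= b ->
  symmx S -> symmx B -> opb s S -> opb b B ->
  \tr ((1 + m%:R^-1 *: (S + B)) ^+ m) <=
  \tr ((1 + m%:R^-1 *: S) ^+ m * (1 + m%:R^-1 *: B) ^+ m)
    + n%:R * (s * b) * expR (s + b) / m%:R.
Proof.
move=> s0 b0 sS sB hS hB.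
have m0 : 0 < m%:R :> R by rewrite ltr0n expn_gt0.
have mi0 : 0 <= m%:R^-1 :> R by rewrite invr_ge0 ltW.
set X := 1 + m%:R^-1 *: S; set Y := 1 + m%:R^-1 *: B; set X' := 1 + _ *: (S + B).
have sX : symmx X by apply: symmxD; [exact: (symmx_scalar n 1)|exact: symmxZ].
have sY : symmx Y by apply: symmxD; [exact: (symmx_scalar n 1)|exact: symmxZ].
pose c := (1 + s / m%:R) * (1 + b / m%:R).
have sm : 0 <= s / m%:R by apply: divr_ge0 => //; exact: ltW.
have bm : 0 <= b / m%:R by apply: divr_ge0 => //; exact: ltW.
have c1 : 1 <= c by have := mulr_ge0 sm bm; rewrite /c; lra.
have oX : opb (1 + s / m%:R) X.
  apply: opbD; first exact: opb1.
  by have := opbZ m%:R^-1 hS; rewrite ger0_norm // mulrC.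
have oY : opb (1 + b / m%:R) Y.
  apply: opbD; first exact: opb1.
  by have := opbZ m%:R^-1 hB; rewrite ger0_norm // mulrC.
have oXY : opb c (X * Y) by apply: opbM => //; lra.
have oX' : opb c X'.
  apply: (@opbW _ _ _ (1 + (s + b) / m%:R)).
    by have := mulr_ge0 sm bm; rewrite /c mulrDl; lra.
  apply: opbD; first exact: opb1.
  by have := opbZ m%:R^-1 (opbD hS hB); rewrite ger0_norm // mulrC.
pose e := s / m%:R * (b / m%:R).
have e0 : 0 <= e by exact: mulr_ge0.
(* Constant and first-order terms cancel, which leaves a product of order 1 / m^2. The m-th power
   multiplies it by at most m times [expR (s + b)], so the total error is of order 1 / m. *)
have od : opb e (X' - X * Y).
  have -> : X' - X * Y = - ((m%:R^-1 *: S) * (m%:R^-1 *: B)).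
    rewrite /X' /X /Y mulrDl !mulrDr !mul1r !mulr1 scalerDr.
    by apply/matrixP => i j; rewrite !mxE; ring.
  apply: opbN; apply: opbM => //.
    by have := opbZ m%:R^-1 hS; rewrite ger0_norm // mulrC.
  by have := opbZ m%:R^-1 hB; rewrite ger0_norm // mulrC.
have := opb_trace (opb_pow_diff m c1 e0 oX' oXY od).
rewrite raddfB /= => h.
have h2 : \tr ((X * Y) ^+ m) <= \tr (X ^+ m * Y ^+ m) := (mxtrace_pow_le k).1 _ _ sX sY.
have cm : c ^+ m <= expR (s + b).
  have -> : expR (s + b) = (expR (s / m%:R) * expR (b / m%:R)) ^+ m.
    rewrite -expRD -expRM_natl; congr expR; field; exact: lt0r_neq0.
  apply: lerXn2r; rewrite ?nnegrE; [lra|by rewrite mulr_ge0 ?expR_ge0|].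
  by apply: ler_pM; rewrite ?expR_ge1Dx //; lra.
have h3 : n%:R * (m%:R * c ^+ m * e) <= n%:R * (s * b) * expR (s + b) / m%:R.
  have -> : n%:R * (m%:R * c ^+ m * e) = n%:R * (s * b) * c ^+ m / m%:R.
    by rewrite /e; field; exact: lt0r_neq0.
  rewrite ler_wpM2r // ler_wpM2l // mulr_ge0 ?mulr_ge0 //.
have := le_trans (ler_norm _) (le_trans h h3).
lra.
Qed.

(** Coefficients [(a, g)] of the chord [a + g * y] of [y ^+ j] over the interval from [1 - h] to
    [1 + h]. The recursion multiplies by [y] and reduces modulo [y^2 - 2 y + (1 + h) (1 - h)], whose
    roots are the endpoints. *)
Fixpoint chord_coefs (h : R) j : R * R :=
  if j is i.+1 then let: (a, g) := chord_coefs h i in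
    (- (g * ((1 + h) * (1 - h))), a + g * 2)
  else (1, 0).

Lemma chord_coefsE h j :
  (chord_coefs h j).1 + (chord_coefs h j).2 * (1 + h) = (1 + h) ^+ j /\
  (chord_coefs h j).1 + (chord_coefs h j).2 * (1 - h) = (1 - h) ^+ j.
Proof.
elim: j => [|j [IH1 IH2]] /=; first by rewrite !mul0r !addr0 !expr0.
case: (chord_coefs h j) IH1 IH2 => a g /= IH1 IH2.
by rewrite !exprS -IH1 -IH2; split; ring.
Qed.

Lemma chord_mean h j :
  (chord_coefs h j).1 + (chord_coefs h j).2 = ((1 + h) ^+ j + (1 - h) ^+ j) / 2.
Proof. by have [<- <-] := chord_coefsE h j; field. Qed.

(** The upper bound is crude; it serves to keep the martingale weights bounded. *)
Lemma chord_slope_ge0 h j : 0 <= h <= 1 -> 0 <= (chord_coefs h j).2 /\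
  (chord_coefs h j).2 <= 4 ^+ j.
Proof.
move=> /andP[h0 h1].
have u0 i : 0 <= (1 - h) ^+ i <= 1 by rewrite exprn_ge0 ?exprn_ile1 //; lra.
have step i : (chord_coefs h i.+1).2 = (1 + h) * (chord_coefs h i).2 + (1 - h) ^+ i.
  have [_ <-] := chord_coefsE h i; rewrite /=; case: (chord_coefs h i) => a g /=; ring.
elim: j => [|j [IH0 IH1]]; first by rewrite /= expr0.
rewrite step; have /andP[v0 v1] := u0 j; split.
  by rewrite addr_ge0 // mulr_ge0 //; lra.
have g2 : (1 + h) * (chord_coefs h j).2 <= 2 * 4 ^+ j by apply: ler_pM => //; lra.
have : 1 <= 4 ^+ j :> R by rewrite exprn_ege1 //; lra.
by rewrite exprS; lra.
Qed.

(** Discrete form of cosh x <= exp (x^2 / 2), the scalar Hoeffding bound. The odd part [q] is at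
    most [j * h] times the even part [p], so each step multiplies [p] by at most
    [1 + j * h ^+ 2]. *)
Lemma chord_mean_le (h : R) j : 0 <= h <= 1 ->
  ((1 + h) ^+ j + (1 - h) ^+ j) / 2 <= expR (h ^+ 2 * (j%:R ^+ 2) / 2).
Proof.
move=> /andP[h0 h1].
pose p i := ((1 + h) ^+ i + (1 - h) ^+ i) / 2; pose q i := ((1 + h) ^+ i - (1 - h) ^+ i) / 2.
have pS i : p i.+1 = p i + h * q i by rewrite /p /q !exprS; field.
have qS i : q i.+1 = q i + h * p i by rewrite /p /q !exprS; field.
have p0 i : 0 <= p i by rewrite divr_ge0 // addr_ge0 // exprn_ge0; lra.
have qp i : 0 <= q i /\ q i <= i%:R * h * p i.
  elim: i => [|i [IH0 IH1]]; first by rewrite /q !expr0 subrr !mul0r.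
  split; first by rewrite qS addr_ge0 // mulr_ge0.
  rewrite qS pS; have hh : 0 <= i.+1%:R * h * (h * q i) by apply: mulr_ge0; apply: mulr_ge0.
  by rewrite mulrDr; move: hh; rewrite -natr1; lra.
rewrite -/(p j); elim: j => [|j IH].
  by rewrite /p !expr0 -[1 + 1]/(2) divff // expr0n /= mulr0 mul0r expR0.
have : p j.+1 <= p j * (1 + j%:R * h ^+ 2).
  have := ler_wpM2l h0 (qp j).2; rewrite pS; lra.
move=> /le_trans; apply.
have -> : h ^+ 2 * j.+1%:R ^+ 2 / 2 = h ^+ 2 * j%:R ^+ 2 / 2 + (j%:R * h ^+ 2 + h ^+ 2 / 2).
  by rewrite -natr1; field.
rewrite expRD; apply: ler_pM => //.
  by rewrite addr_ge0 // mulr_ge0 // sqr_ge0.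
apply: le_trans (expR_ge1Dx _) _; rewrite ler_expR; have := sqr_ge0 h; lra.
Qed.

(** Convexity of the power on the interval, proved by induction on the exponent: the gap [D] between
    chord and power obeys [D i.+1 = Y * D i + g *: C] with [g] the chord slope and [C] the product
    of the distances of [Y] to the endpoints. *)
Lemma chord_psd h Y j : 0 <= h <= 1 -> symmx Y ->
  lemx ((1 - h)%:M) Y -> lemx Y ((1 + h)%:M) ->
  lemx (Y ^+ j) ((chord_coefs h j).1 *: (1 : 'M[R]_n) + (chord_coefs h j).2 *: Y).
Proof.
move=> /[dup] h01 /andP[h0 h1] sY hl hu.
pose A := Y - (1 - h)%:M; pose B := (1 + h)%:M - Y; pose C := A * B.
have sA : symmx A by apply: symmxB => //; exact: symmx_scalar.
have sB : symmx B by apply: symmxB => //; exact: symmx_scalar.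
have scE (a : R) : a%:M = a *: (1 : 'M[R]_n) by rewrite scalemx1.
have AB : A * B = B * A.
  by rewrite /A /B !scE !mulrBl !mulrBr !mulrmxZl !mulrmxZr !mul1r !mulr1;
    apply/matrixP => i k; rewrite !mxE; ring.
have pABA : psdmx (A * B * A) by have := psd_congr A hu; rewrite sA.
have pBAB : psdmx (B * A * B) by have := psd_congr B hl; rewrite sB.
have hAB : A + B = (2 * h) *: (1 : 'M[R]_n).
  by rewrite /A /B !scE; apply/matrixP => i k; rewrite !mxE; ring.
have pY : psdmx Y.
  apply: lemx_psd hl; apply: psd_scalar; lra.
have [h00|hn0] := eqVneq h 0.
  have YE : Y = 1 :> 'M[R]_n.
    apply: lemx_anti; first by move: hu; rewrite h00 addr0.
    by move: hl; rewrite h00 subr0.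
  rewrite YE expr1n -scalerDl chord_mean h00 subr0 addr0 !expr1n -[1 + 1]/2.
  by rewrite divff // scale1r; exact: lemx_refl.
have hp : 0 < h by rewrite lt_neqAle eq_sym hn0.
(* Positivity of the product of two commuting positive matrices, from [A + B = 2 h]; this is why
   [h = 0] is treated apart. *)
have CE : (2 * h) *: C = A * B * A + B * A * B.
  have -> : (2 * h) *: C = C * (A + B) by rewrite hAB mulrmxZr mulr1.
  by rewrite mulrDr /C [in X in _ + X]AB.
have pC : psdmx C.
  have -> : C = (2 * h)^-1 *: (A * B * A + B * A * B).
    by rewrite -CE scalerA mulVf ?scale1r // mulf_neq0.
  by apply: psdZ; [rewrite invr_ge0 mulr_ge0|exact: psdD].
have YA : Y = A + (1 - h) *: (1 : 'M[R]_n) by rewrite /A scE subrK.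
have YC : Y * C = C * Y.
  have -> : Y * C = A * (A * B) + (1 - h) *: (A * B).
    by rewrite {1}YA mulrDl mulrmxZl mul1r.
  have -> : C * Y = A * B * A + (1 - h) *: (A * B).
    by rewrite {1}YA mulrDr mulrmxZr mulr1.
  by rewrite -mulrA -AB.
have pYC : psdmx (Y * C).
  have -> : Y * C = A * B * A + (1 - h) *: C.
    by rewrite YC {1}YA mulrDr mulrmxZr mulr1.
  apply: psdD => //.
  by apply: psdZ => //; lra.
have CY : C = 2 *: Y - Y ^+ 2 - ((1 + h) * (1 - h)) *: (1 : 'M[R]_n).
  rewrite /C /A /B !scE mulrBl !mulrBr !mulrmxZl !mulrmxZr !mul1r !mulr1 expr2.
  by apply/matrixP => i k; rewrite !mxE; ring.
clearbody C.
have pYkC k : psdmx (Y ^+ k * C).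
  have Yk i : Y ^+ i * C = C * Y ^+ i.
    by elim: i => [|i IH]; rewrite ?expr0 ?mul1r ?mulr1 // exprS -mulrA IH mulrA YC -mulrA.
  have sYi i := symmx_pow i sY.
  have -> : Y ^+ k * C = Y ^+ k./2 * (Y ^+ odd k * C) * Y ^+ k./2.
    rewrite -!mulrA -Yk !mulrA -!exprD; congr (Y ^+ _ * C).
    by rewrite -{1}(odd_double_half k) -addnn; lia.
  have p : psdmx (Y ^+ odd k * C) by case: (odd k); rewrite ?expr1 ?expr0 ?mul1r.
  by have := psd_congr (Y ^+ k./2) p; rewrite sYi.
pose D i := (chord_coefs h i).1 *: (1 : 'M[R]_n) + (chord_coefs h i).2 *: Y - Y ^+ i.
(* The recursion multiplies [D i] by [Y], so the induction carries an arbitrary power of [Y]. *)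
suff H i k : psdmx (Y ^+ k * D i) by have := H j 0%N; rewrite expr0 mul1r.
elim: i k => [|i IH] k.
  by rewrite /D /= expr0 scale1r scale0r addr0 subrr mulr0; exact: psd0.
have -> : D i.+1 = Y * D i + (chord_coefs h i).2 *: C.
  rewrite /D /= CY; case: (chord_coefs h i) => a g /=.
  have -> : Y * (a *: (1 : 'M[R]_n) + g *: Y - Y ^+ i) = a *: Y + g *: Y ^+ 2 - Y ^+ i.+1.
    by rewrite mulrBr mulrDr !mulrmxZr mulr1 -exprS.
  by apply/matrixP => r t; rewrite !mxE; ring.
rewrite mulrDr mulrA -exprSr mulrmxZr; apply: psdD => //.
by apply: psdZ => //; exact: (chord_slope_ge0 i h01).1.
Qed.

(** If [qf S y > t] for a unit vector [y], then repeated squaring with Cauchy-Schwarz gives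
    [qf A y ^+ m <= qf (A ^+ m) y], which the trace dominates because [A ^+ m] is positive for even
    [m]. *)
Lemma mxtrace_pow_ge S t k (m := (2 ^ k)%N) : (0 < k)%N -> 0 <= t -> symmx S ->
  \tr ((1 + m%:R^-1 *: S) ^+ m) < (1 + t / m%:R) ^+ m -> lemx S t%:M.
Proof.
move=> k0 t0 sS h; have m0 : 0 < m%:R :> R by rewrite ltr0n expn_gt0.
set A := 1 + _ in h; have sA : symmx A by apply: symmxD; [exact: (symmx_scalar n 1)|exact: symmxZ].
apply: lemxP => // [|x]; first exact: symmx_scalar.
rewrite qf_scalar; have [->|x0] := eqVneq x 0; first by rewrite dot0r qfE mulmx0 dot0r mulr0.
pose y := (norm2 x)^-1 *: x.
have nx : 0 < dot x x by exact: dot_gt0.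
have nx2 : norm2 x != 0 by apply: contra x0 => /eqP/norm2_eq0 ->.
have yy : dot y y = 1.
  by rewrite /y dotZl dotZr -norm2_sqr mulrA -expr2 exprVn mulVf // expf_neq0.
have qy : qf S y = qf S x / dot x x.
  by rewrite /y !qfE -scalemxAr dotZl dotZr -norm2_sqr mulrA -expr2 exprVn mulrC.
suff : qf S y <= t by rewrite qy ler_pdivrMr.
rewrite leNgt; apply/negP => hy; move: h; apply/negP; rewrite -leNgt.
have qA : 1 + t / m%:R <= qf A y.
  rewrite /A qfDl qfZl.
  have -> : qf (1 : 'M[R]_n) y = 1 by rewrite -[1]/(1%:M) qf_scalar mul1r.
  by rewrite lerD2l mulrC ler_pM2l ?invr_gt0 // ltW.
have tm : 0 <= t / m%:R by apply: divr_ge0 => //; exact: ltW.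
have qpow i : qf A y ^+ (2 ^ i) <= qf (A ^+ (2 ^ i)) y.
  elim: i => [|i IH]; first by rewrite expn0 !expr1.
  rewrite expnS mulnC !exprM.
  have -> : qf ((A ^+ (2 ^ i)) ^+ 2) y = dot (A ^+ (2 ^ i) *m y) (A ^+ (2 ^ i) *m y).
    by rewrite expr2 -qf_gram (symmx_pow _ sA).
  have := dot_CS y (A ^+ (2 ^ i) *m y); rewrite yy mul1r -qfE.
  apply: le_trans; apply: lerXn2r; rewrite ?nnegrE //; last first.
    by apply: le_trans IH; rewrite exprn_ge0 //; lra.
  by rewrite exprn_ge0 //; lra.
apply: le_trans (_ : qf A y ^+ m <= _).
  by apply: lerXn2r; rewrite ?nnegrE; lra.
apply: le_trans (qpow k) _.
have pA : psdmx (A ^+ m).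
  by rewrite /m -(prednK k0) expnS mul2n; exact: psd_pow2.
by have := lemx_qf y (psd_le_tr pA); rewrite qf_scalar yy mulr1.
Qed.
End TracePowers.

(** * Measurability of random matrices *)

Section MatrixMeasurability.
Context {R : realType} {d : measure_display} {T : measurableType d}.

Lemma measurable_inv : measurable_fun setT (@GRing.inv R).
Proof.
have -> : [set: R] = [set x | x != 0] `|` [set 0].
  by apply/seteqP; split => // x _ /=; have [->|] := eqVneq x 0; [right|left].
have o : open [set x : R | x != 0] by exact: open_neq.
apply/measurable_funU => //; first exact: open_measurable.
split; last exact: measurable_fun_set1.
apply: open_continuous_measurable_fun => // x; rewrite inE /= => x0.
exact: inv_continuous.
Qed.

Definition mxmeas m n (A : T -> 'M[R]_(m, n)) :=
  forall i j, measurable_fun setT (fun om => A om i j).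

Lemma mxmeas_cst m n (A : 'M[R]_(m, n)) : mxmeas (fun=> A).
Proof. by move=> i j; exact: measurable_cst. Qed.

Lemma mxmeasD m n (A B : T -> 'M[R]_(m, n)) :
  mxmeas A -> mxmeas B -> mxmeas (fun om => A om + B om).
Proof. by move=> hA hB i j; under eq_fun do rewrite mxE; exact: measurable_funD. Qed.

Lemma mxmeasZ m n (a : T -> R) (A : T -> 'M[R]_(m, n)) :
  measurable_fun setT a -> mxmeas A -> mxmeas (fun om => a om *: A om).
Proof. by move=> ha hA i j; under eq_fun do rewrite mxE; exact: measurable_funM. Qed.

Lemma mxmeasM m n p (A : T -> 'M[R]_(m, n)) (B : T -> 'M[R]_(n, p)) :
  mxmeas A -> mxmeas B -> mxmeas (fun om => A om *m B om).
Proof.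
move=> hA hB i j; under eq_fun do rewrite mxE.
by apply: measurable_sum => k; exact: measurable_funM.
Qed.

Lemma mxmeas_tr m n (A : T -> 'M[R]_(m, n)) : mxmeas A -> mxmeas (fun om => (A om)^T).
Proof. by move=> hA i j; under eq_fun do rewrite mxE; exact: hA. Qed.

Lemma mxmeas_sum m n (I : eqType) (r : seq I) (A : I -> T -> 'M[R]_(m, n)) :
  (forall k, k \in r -> mxmeas (A k)) -> mxmeas (fun om => \sum_(k <- r) A k om).
Proof.
elim: r => [|k r IH] hA; first by under eq_fun do rewrite big_nil; exact: mxmeas_cst.
under eq_fun do rewrite big_cons; apply: mxmeasD; first by apply: hA; rewrite inE eqxx.
by apply: IH => l lr; apply: hA; rewrite inE lr orbT.
Qed.

Lemma measurable_sum_seq (I : eqType) (r : seq I) (f : I -> T -> R) :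
  (forall i, i \in r -> measurable_fun setT (f i)) ->
  measurable_fun setT (fun om => \sum_(i <- r) f i om).
Proof.
elim: r => [|k r IH] hA; first by under eq_fun do rewrite big_nil; exact: measurable_cst.
under eq_fun do rewrite big_cons; apply: measurable_funD; first by apply: hA; rewrite inE eqxx.
by apply: IH => l lr; apply: hA; rewrite inE lr orbT.
Qed.

Lemma mxmeas_pow n (A : T -> 'M[R]_n) k : mxmeas A -> mxmeas (fun om => A om ^+ k).
Proof.
move=> hA; elim: k => [|k IH].
  by under eq_fun do rewrite expr0; exact: mxmeas_cst.
by under eq_fun do rewrite exprS; exact: mxmeasM.
Qed.

Lemma measurable_trace n (A : T -> 'M[R]_n) : mxmeas A ->
  measurable_fun setT (fun om => \tr (A om)).
Proof. by move=> hA; apply: measurable_sum => i; exact: hA. Qed.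

Lemma measurable_det n (A : T -> 'M[R]_n) : mxmeas A ->
  measurable_fun setT (fun om => \det (A om)).
Proof.
move=> hA; apply: measurable_sum => s; apply: measurable_funM; first exact: measurable_cst.
by apply: measurable_prod => i _; exact: hA.
Qed.

Lemma mxmeas_invmx n (A : T -> 'M[R]_n) : mxmeas A -> mxmeas (fun om => invmx (A om)).
Proof.
move=> hA i j; have md := measurable_det hA.
pose U := [set om | \det (A om) = 0].
have mU : measurable U.
  by have := md measurableT [set 0] (measurable_set1 0); rewrite setTI.
(* [invmx] returns a singular matrix unchanged; elsewhere it is given by Cramer's rule. *)
have -> : (fun om => invmx (A om) i j) = (fun om =>
    if om \in U then A om i j else (\det (A om))^-1 * \adj (A om) i j).
  apply/funext => om; rewrite /invmx unitmxE unitfE.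
  case: ifPn => [d0|/negPn/eqP d0].
    by rewrite memNset ?mxE //= => e; move/eqP: d0.
  by rewrite mem_set.
apply: measurable_fun_ifT.
- by apply: (measurable_fun_bool true); rewrite setTI preimage_mem_true.
- exact: hA.
apply: measurable_funM.
  exact: (measurableT_comp measurable_inv).
under eq_fun do rewrite mxE /cofactor.
apply: measurable_funM; first exact: measurable_cst.
by apply: measurable_det => k l; under eq_fun do rewrite !mxE; exact: hA.
Qed.
End MatrixMeasurability.

Section RealEstimates.
Context {R : realType}.

(** From [expR (y / (1 + y)) <= 1 + y] at [y = L / k], raised to the power [k]. *)
Lemma expR_le_compound (L : R) k : 0 <= L -> (0 < k)%N ->
  expR (L - L ^+ 2 / k%:R) <= (1 + L / k%:R) ^+ k.
Proof.
move=> L0 k0; set m : R := k%:R; have m0 : 0 < m by rewrite ltr0n.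
have Lm : 0 <= L / m by rewrite divr_ge0 // ltW.
have e1 : expR (L / m / (1 + L / m)) <= 1 + L / m.
  have := expR_ge1Dx (- (L / m / (1 + L / m))).
  have -> : 1 - L / m / (1 + L / m) = (1 + L / m)^-1 by field; apply/andP; split; lra.
  by rewrite expRN lef_pV2 ?posrE ?expR_gt0 //; lra.
apply: (@le_trans _ _ (expR (L / m / (1 + L / m)) ^+ k)).
  rewrite -expRM_natl ler_expR -/m.
  have -> : m * (L / m / (1 + L / m)) = L - L ^+ 2 / m / (1 + L / m).
    by field; apply/andP; split; lra.
  rewrite lerD2l lerN2 ler_pdivrMr; last lra.
  have y0 : 0 <= L ^+ 2 / m by rewrite divr_ge0 ?sqr_ge0 // ltW.
  by rewrite ler_peMr //; lra.
by apply: lerXn2r; rewrite ?nnegrE ?expR_ge0 //; lra.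
Qed.

(** Origin of the factor 3/2: the conditions on [m] give [expR (- (L ^+ 2 / m)) >= 3/4] and
    [w / m <= p / 8], and 1 + 1/8 = 3/2 times 3/4. *)
Lemma compound_slack (L m p w : R) : 0 < m -> 0 < p -> 4 * L ^+ 2 <= m -> 8 * w / p <= m ->
  p * expR L + w / m * expR L <= 3 / 2 * p * expR (L - L ^+ 2 / m).
Proof.
move=> m0 p0 hL hw; have eL := expR_gt0 L.
have y4 : L ^+ 2 / m <= 4^-1 by rewrite ler_pdivrMr //; lra.
have ey := expR_ge1Dx (- (L ^+ 2 / m)).
have wm : w / m <= p / 8 by move: hw; rewrite !ler_pdivrMr //; lra.
have h1 := ler_wpM2r (ltW eL) wm.
have h2 : 3 / 4 * expR L <= expR L * expR (- (L ^+ 2 / m)) by rewrite mulrC ler_pM2l //; lra.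
by rewrite expRD; have := ler_wpM2l (ltW p0) h2; lra.
Qed.

End RealEstimates.

(** * Trace supermartingale and tail bound *)

Section Hoeffding.
Context {R : realType} {d : measure_display} {T : measurableType d}.
Variable P : probability T R.
Variables (n N : nat) (L : R).
Variables (B : nat -> T -> 'M[R]_n) (b : nat -> T -> R).
(** [G i] generates the information before step [i]. It contains the increments [B j] with [j < i]
    and, from the start, all the weights [b]. *)
Variable G : nat -> set (set T).
Hypothesis mG : forall i, (i < N)%N -> <<s G i >> `<=` measurable.
Hypothesis symB : forall i om, symmx (B i om).
Hypothesis mB : forall i, (i < N)%N -> mxmeas (B i).
Hypothesis mbG : forall i j, (i < N)%N -> (j < N)%N -> fmeas <<s G i >> (b j).
Hypothesis mBG : forall i j k l, (j < i < N)%N -> fmeas <<s G i >> (fun om => B j om k l).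
Hypothesis b0 : forall i om, 0 <= b i om.
Hypothesis bL : forall om, \sum_(i < N) b i om ^+ 2 <= L.
Hypothesis hB : forall i, (i < N)%N -> {ae P, forall om, opb (b i om) (B i om)}.
(** Conditional mean zero, stated by bounded test variables instead of a conditional expectation. *)
Hypothesis mart : forall i k l (A : T -> R) (c : R), (i < N)%N -> fmeas <<s G i >> A ->
  {ae P, forall om, `|A om| <= c} -> ex P (fun om => A om * B i om k l) = 0.

Let S i om := \sum_(0 <= j < i) B j om.
Let beta := Num.sqrt L.

Lemma L_ge0 : 0 <= L.
Proof. by apply: le_trans (bL point); apply: sumr_ge0 => i _; exact: sqr_ge0. Qed.

Lemma b_le i om : (i < N)%N -> b i om <= beta.
Proof.
move=> iN; rewrite -(ger0_norm (b0 i om)) -sqrtr_sqr; apply: ler_wsqrtr.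
apply: le_trans (bL om); rewrite (bigD1 (Ordinal iN)) //= lerDl.
by apply: sumr_ge0 => j _; exact: sqr_ge0.
Qed.

Lemma beta_ge0 : 0 <= beta. Proof. exact: sqrtr_ge0. Qed.

Lemma S_sym i om : symmx (S i om).
Proof. by apply: symmx_sum. Qed.

Lemma S_opb i : (i <= N)%N -> {ae P, forall om, opb (i%:R * beta) (S i om)}.
Proof.
elim: i => [_|i IH iN].
  by apply: aeW => om; rewrite mul0r /S big_geq //; exact: opb0.
have := hB iN; have := IH (ltnW iN); apply: filterS2 => om h1 h2.
rewrite /S big_nat_recr //= -natr1 mulrDl mul1r.
apply: opbD; first exact: h1.
exact: opbW (b_le om iN) h2.
Qed.

Let tail i om := \sum_(i <= j < N) b j om ^+ 2.

Lemma tail_le i om : 0 <= tail i om <= L.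
Proof.
apply/andP; split; first by apply: sumr_ge0 => j _; exact: sqr_ge0.
apply: le_trans (bL om); rewrite -(big_mkord xpredT (fun i => b i om ^+ 2)) /tail.
case: (leqP i N) => iN.
  by rewrite (big_cat_nat (leq0n i) iN) /= lerDr sumr_ge0 // => j _; exact: sqr_ge0.
rewrite [leLHS]big_geq; last exact: ltnW.
by apply: sumr_ge0 => j _; exact: sqr_ge0.
Qed.

Lemma b_measurable i : (i < N)%N -> measurable_fun setT (b i).
Proof. by move=> iN; apply: (fmeas_measurable (mG iN)); exact: mbG. Qed.

Lemma tail_fmeas i i' : (i < N)%N -> fmeas <<s G i >> (tail i').
Proof.
move=> iN; apply/fmeasP; apply: measurable_sum_seq => j.
rewrite mem_index_iota => /andP[_ jN].
by apply: measurable_funX; apply/fmeasP; exact: mbG.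
Qed.

Lemma tail_measurable i' : measurable_fun setT (tail i').
Proof.
apply: measurable_sum_seq => j; rewrite mem_index_iota => /andP[_ jN].
by apply: measurable_funX; exact: b_measurable.
Qed.

Section Power.
Variable k : nat.
Let m := (2 ^ k)%N.
Hypothesis k0 : (0 < k)%N.
Hypothesis mbeta : beta <= m%:R.

Let X i om : 'M[R]_n := 1 + m%:R^-1 *: S i om.
(** A supermartingale up to [err]. A step multiplies the trace by at most [expR (b i om ^+ 2 / 2)]
    in mean, and the decrease of [tail] gives this back; the factor stays inside the expectation
    because the weights are random. *)
Let F i om := \tr (X i om ^+ m) * expR (tail i om / 2).
(** The error of [mxtrace_step] at the largest possible arguments, times the largest value of the
    exponential factor. *)
Let err := n%:R * (N%:R * beta * beta) * expR (N%:R * beta + beta) / m%:R * expR (L / 2).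

Lemma m_gt0 : 0 < m%:R :> R. Proof. by rewrite ltr0n expn_gt0. Qed.

Lemma X_sym i om : symmx (X i om).
Proof. by apply: symmxD; [exact: (symmx_scalar n 1)|exact/symmxZ/S_sym]. Qed.

Lemma X_opb i : (i <= N)%N -> {ae P, forall om, opb (expR (N%:R * beta)) (X i om ^+ m)}.
Proof.
move=> iN; apply: filterS (S_opb iN) => om h.
have ib : 0 <= i%:R * beta by rewrite mulr_ge0 // beta_ge0.
have c0 : 0 <= 1 + i%:R * beta / m%:R.
  by rewrite addr_ge0 // mulr_ge0 // invr_ge0 ltW // m_gt0.
apply: (@opbW _ _ _ ((1 + i%:R * beta / m%:R) ^+ m)).
  apply: (@le_trans _ _ (expR (i%:R * beta / m%:R) ^+ m)).
    by apply: lerXn2r; rewrite ?nnegrE ?expR_ge0 // expR_ge1Dx.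
  rewrite -expRM_natl ler_expR mulrCA mulfV ?mulr1 ?lt0r_neq0 ?m_gt0 //.
  by rewrite ler_wpM2r ?beta_ge0 // ler_nat.
apply: opb_pow => //; apply: opbD; first exact: opb1.
have := opbZ m%:R^-1 h; rewrite ger0_norm ?invr_ge0 ?(ltW m_gt0) //.
by rewrite mulrC.
Qed.

Lemma X_pow_fmeas i j l : (i < N)%N -> fmeas <<s G i >> (fun om => (X i om ^+ m) j l).
Proof.
move=> iN; apply/fmeasP.
suff : @mxmeas R _ (g_sigma_algebraType (G i)) n n (fun om => X i om ^+ m) by exact.
apply: mxmeas_pow; apply: mxmeasD; first exact: mxmeas_cst.
apply: mxmeasZ; first exact: measurable_cst.
apply: mxmeas_sum => r; rewrite mem_index_iota => /andP[_ ri] a c.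
by apply/fmeasP; apply: mBG; rewrite ri iN.
Qed.

Lemma X_mxmeas i : (i <= N)%N -> mxmeas (X i).
Proof.
move=> iN; apply: mxmeasD; first exact: mxmeas_cst.
apply: mxmeasZ; first exact: measurable_cst.
apply: mxmeas_sum => r; rewrite mem_index_iota => /andP[_ ri].
by apply: mB; exact: leq_trans ri iN.
Qed.

Lemma X_pow_psd i om : psdmx (X i om ^+ m).
Proof. by rewrite /m -(prednK k0) expnS mul2n; apply: psd_pow2; exact: X_sym. Qed.

Lemma F_ge0 i om : 0 <= F i om.
Proof. by apply: mulr_ge0; [exact/mxtrace_psd_ge0/X_pow_psd|exact: expR_ge0]. Qed.

Lemma F_integ i : (i <= N)%N -> integ P (F i).
Proof.
move=> iN; apply: (@integ_bound _ _ _ _ _ (n%:R * expR (N%:R * beta) * expR (L / 2))).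
  apply: measurable_funM; first exact/measurable_trace/mxmeas_pow/X_mxmeas.
  apply: (measurableT_comp (@measurable_expR R)).
  by apply: measurable_funM => //; exact: tail_measurable.
apply: filterS (X_opb iN) => om h; rewrite normrM; apply: ler_pM => //.
  exact: opb_trace.
rewrite ger0_norm ?expR_ge0 // ler_expR ler_pM2r ?invr_gt0 //.
by have /andP[] := tail_le i om.
Qed.

Lemma F_step i : (i < N)%N -> ex P (F i.+1) <= ex P (F i) + err.
Proof.
move=> iN; pose h om := b i om / m%:R.
pose g om := (chord_coefs (h om) m).2.
pose c om := g om / m%:R * expR (tail i.+1 om / 2).
(* The part of the increment linear in [B i]. Its coefficients are measurable for [G i] and bounded,
   so [mart] gives it mean zero. *)
pose Xi om := c om * \tr (X i om ^+ m * B i om).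
have h01 om : 0 <= h om <= 1.
  rewrite divr_ge0 ?b0 ?(ltW m_gt0) //= ler_pdivrMr ?m_gt0 // mul1r.
  exact: le_trans (b_le om iN) mbeta.
have tS om : tail i om = b i om ^+ 2 + tail i.+1 om by rewrite /tail big_ltn.
have pw : {ae P, forall om, F i.+1 om <= F i om + Xi om + err}.
  apply: filterS2 (S_opb (ltnW iN)) (hB iN) => om hS hb.
  have ibeta : 0 <= i%:R * beta by rewrite mulr_ge0 // beta_ge0.
  have st := mxtrace_step k ibeta (b0 i om) (S_sym i om) (symB i om) hS hb.
  have SE : S i.+1 om = S i om + B i om by rewrite /S big_nat_recr.
  rewrite -/m -SE -/(X i.+1 om) -/(X i om) in st.
  set Y := 1 + _ *: B i om in st.
  have pX := X_pow_psd i om.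
  have oY : opb (h om) (m%:R^-1 *: B i om).
    have := opbZ m%:R^-1 hb; rewrite ger0_norm ?invr_ge0 ?(ltW m_gt0) //.
    by rewrite mulrC.
  have sB' : symmx (m%:R^-1 *: B i om) by exact: symmxZ.
  have sY : symmx Y by apply: symmxD => //; exact: (symmx_scalar n 1).
  have Yl : lemx ((1 - h om)%:M) Y.
    rewrite [_%:M]raddfB; apply: lemxD; first exact: lemx_refl.
    exact: opb_ge sB' oY.
  have Yu : lemx Y ((1 + h om)%:M).
    rewrite [_%:M]raddfD; apply: lemxD; first exact: lemx_refl.
    exact: opb_le sB' oY.
  have ch := chord_psd m (h01 om) sY Yl Yu.
  have tr1 : \tr (X i om ^+ m * Y ^+ m) <= expR (b i om ^+ 2 / 2) * \tr (X i om ^+ m)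
      + g om / m%:R * \tr (X i om ^+ m * B i om).
    have := mxtrace_lemxM ch pX; rewrite mxtrace_mulC -[_ *m _]/(_ * _) => /le_trans; apply.
    have -> : (chord_coefs (h om) m).1 *: (1 : 'M[R]_n) + (chord_coefs (h om) m).2 *: Y
      = (((1 + h om) ^+ m + (1 - h om) ^+ m) / 2) *: (1 : 'M[R]_n) + (g om / m%:R) *: B i om.
      rewrite -chord_mean /Y scalerDr addrA -scalerDl scalerA.
      by [].
    rewrite mulmxDl mxtraceD -!scalemxAl !mxtraceZ mul1mx.
    rewrite [\tr (B i om *m _)]mxtrace_mulC lerD // ler_wpM2r ?mxtrace_psd_ge0 //.
    apply: le_trans (chord_mean_le _ (h01 om)) _.
    rewrite ler_expR /h; have -> : (b i om / m%:R) ^+ 2 * m%:R ^+ 2 = b i om ^+ 2 :> R.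
      by field; exact/lt0r_neq0/m_gt0.
    by [].
  have t0 : 0 < expR (tail i.+1 om / 2) by exact: expR_gt0.
  have tX := mxtrace_psd_ge0 pX.
  have er : n%:R * (i%:R * beta * b i om) * expR (i%:R * beta + b i om) / m%:R
       * expR (tail i.+1 om / 2) <= err.
    have bb := b_le om iN; have nn : 0 <= n%:R :> R by [].
    have iNb : i%:R * beta <= N%:R * beta.
      by rewrite ler_wpM2r ?beta_ge0 // ler_nat ltnW.
    have mi : 0 <= m%:R^-1 :> R by rewrite invr_ge0 ltW // m_gt0.
    have bi := b0 i om; have eb := beta_ge0.
    rewrite /err; apply: ler_pM; rewrite ?expR_ge0 //.
    - by apply: mulr_ge0 => //; apply: mulr_ge0; rewrite ?expR_ge0 //; do 2 apply: mulr_ge0 => //.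
    - rewrite ler_wpM2r //; apply: ler_pM; rewrite ?expR_ge0 //.
      + by apply: mulr_ge0 => //; exact: mulr_ge0.
      + by rewrite ler_wpM2l //; apply: ler_pM.
      + by rewrite ler_expR; exact: lerD.
    by rewrite ler_expR ler_pM2r ?invr_gt0 //; have /andP[] := tail_le i.+1 om.
  rewrite /F /Xi /c.
  have -> : expR (tail i om / 2) = expR (b i om ^+ 2 / 2) * expR (tail i.+1 om / 2).
    by rewrite -expRD tS mulrDl.
  have := ler_wpM2r (ltW t0) st; have := ler_wpM2r (ltW t0) tr1.
  rewrite !mulrDl; lra.
have gm j : measurable_fun setT (fun om : g_sigma_algebraType (G i) => (chord_coefs (h om) j).1) /\
    measurable_fun setT (fun om : g_sigma_algebraType (G i) => (chord_coefs (h om) j).2).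
  have mh : measurable_fun setT (h : g_sigma_algebraType (G i) -> R).
    by apply: measurable_funM => //; apply/fmeasP; exact: mbG.
  elim: j => [|j [IH1 IH2]]; first by split; exact: measurable_cst.
  split.
    have -> : (fun om => (chord_coefs (h om) j.+1).1) =
      (fun om => - ((chord_coefs (h om) j).2 * ((1 + h om) * (1 - h om)))).
      by apply/funext => om /=; case: (chord_coefs (h om) j).
    apply: measurable_funN; apply: measurable_funM => //; apply: measurable_funM.
      exact: measurable_funD.
    exact: measurable_funB.
  have -> : (fun om => (chord_coefs (h om) j.+1).2) =
      (fun om => (chord_coefs (h om) j).1 + (chord_coefs (h om) j).2 * 2).
    by apply/funext => om /=; case: (chord_coefs (h om) j).
  by apply: measurable_funD => //; exact: measurable_funM.
pose A j l om := c om * (X i om ^+ m) j l.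
pose K := 4 ^+ m / m%:R * expR (L / 2).
have cK om : `|c om| <= K.
  have [g0 g4] := chord_slope_ge0 m (h01 om).
  have mi : 0 <= m%:R^-1 :> R by rewrite invr_ge0 ltW // m_gt0.
  rewrite ger0_norm; last by apply: mulr_ge0; [exact: mulr_ge0|exact: expR_ge0].
  apply: ler_pM; rewrite ?expR_ge0 //; first exact: mulr_ge0.
    by rewrite ler_wpM2r.
  by rewrite ler_expR ler_pM2r ?invr_gt0 //; have /andP[] := tail_le i.+1 om.
have fA j l : fmeas <<s G i >> (A j l).
  apply/fmeasP; apply: measurable_funM; last by apply/fmeasP; exact: X_pow_fmeas.
  apply: measurable_funM; first by apply: measurable_funM => //; exact: (gm m).2.
  apply: (measurableT_comp (@measurable_expR R)); apply: measurable_funM => //.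
  by apply/fmeasP; exact: tail_fmeas.
have bA j l : {ae P, forall om, `|A j l om| <= K * expR (N%:R * beta)}.
  apply: filterS (X_opb (ltnW iN)) => om hX; rewrite normrM; apply: ler_pM => //.
  exact: opb_entry.
have iA j l : integ P (fun om => A j l om * B i om l j).
  apply: (@integ_bound _ _ _ _ _ (K * expR (N%:R * beta) * beta)).
    by apply: measurable_funM; [exact: fmeas_measurable (mG iN) (fA j l)|exact: mB].
  apply: filterS2 (bA j l) (hB iN) => om h1 h2; rewrite normrM; apply: ler_pM => //.
  by apply: le_trans (opb_entry _ _ h2) (b_le om iN).
have XiE : Xi = (fun om => \sum_j \sum_l A j l om * B i om l j).
  apply/funext => om; rewrite /Xi /mxtrace mulr_sumr; apply: eq_bigr => j _.
  by rewrite mxE mulr_sumr; apply: eq_bigr => l _; rewrite /A mulrA.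
have iXi : integ P Xi by rewrite XiE; do 2 (apply: integ_sum => ?).
have eXi : ex P Xi = 0.
  rewrite XiE ex_sum => [|j]; last by apply: integ_sum.
  rewrite big1 // => j _; rewrite ex_sum // big1 // => l _.
  exact: mart iN (fA j l) (bA j l).
have iF := F_integ (ltnW iN); have iF' := F_integ iN.
apply: le_trans (ex_le iF' _ pw) _.
  by apply: integD; [exact: integD|exact: integ_cst].
rewrite exD ?exD ?eXi ?ex_cst ?addr0 //; [exact: integD|exact: integ_cst].
Qed.

Lemma F_last : ex P (F N) <= n%:R * expR (L / 2) + N%:R * err.
Proof.
have h i : (i <= N)%N -> ex P (F i) <= n%:R * expR (L / 2) + i%:R * err.
  elim: i => [_|i IH iN].
    rewrite mul0r addr0 -[leRHS](ex_cst P); apply: ex_le; [exact: F_integ|exact: integ_cst|].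
    apply: aeW => om; rewrite /F /X /S big_geq // scaler0 addr0 expr1n mxtrace1.
    rewrite ler_wpM2l // ler_expR ler_pM2r ?invr_gt0 //.
    by have /andP[] := tail_le 0 om.
  by apply: le_trans (F_step iN) _; rewrite -[i.+1%:R]natr1 mulrDl mul1r addrA lerD2r IH // ltnW.
exact: h.
Qed.

(** Markov's inequality at the level at which [mxtrace_pow_ge] turns the trace bound into an order
    bound. *)
Lemma hoeffding_power : exists A, [/\ measurable A,
  ((1 - (n%:R * expR (L / 2) + N%:R * err) / (1 + L / m%:R) ^+ m)%:E <= P A)%E &
  forall om, A om -> lemx (S N om) L%:M].
Proof.
pose a := (1 + L / m%:R) ^+ m.
have a0 : 0 < a.
  by apply: exprn_gt0; have := divr_ge0 L_ge0 (ltW m_gt0); lra.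
have mF := integ_meas (F_integ (leqnn N)).
have mk := ex_markov (F_integ (leqnn N)) (F_ge0 N) a0.
have mC : measurable [set om | a <= F N om].
  by rewrite -[X in measurable X]setTI; apply: measurable_fun_le.
exists (~` [set om | a <= F N om]); split; first exact: measurableC.
- rewrite probability_setC // EFinB leeB //; apply: le_trans mk _.
  by rewrite lee_fin ler_pM2r ?invr_gt0 //; exact: F_last.
move=> om /= /negP; rewrite -ltNge => h.
apply: (mxtrace_pow_ge k0 L_ge0 (S_sym N om)).
move: h; rewrite /F /a /X /tail big_geq // mul0r expR0 mulr1; exact.
Qed.
End Power.

(* The factor 3/2 absorbs the error of the discretised exponential. *)
Theorem matrix_hoeffding : (0 < n)%N -> exists A, [/\ measurable A,
  ((1 - 3 / 2 * (n%:R * expR (- (L / 2))))%:E <= P A)%E &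
  forall om, A om -> lemx (\sum_(0 <= j < N) B j om) L%:M].
Proof.
move=> n0; pose kap := n%:R * (N%:R * beta * beta) * expR (N%:R * beta + beta) * expR (L / 2).
pose p := n%:R * expR (- (L / 2)) : R.
have p0 : 0 < p by rewrite mulr_gt0 ?expR_gt0 // ltr0n.
have eb := beta_ge0; have L0 := L_ge0.
have kap0 : 0 <= kap.
  apply: mulr_ge0 _ (expR_ge0 _); apply: mulr_ge0 _ (expR_ge0 _).
  by apply: mulr_ge0 => //; apply: mulr_ge0 => //; exact: mulr_ge0.
(* [beta] keeps the steps [b / m] below 1; the next two terms are the requirements of
   [compound_slack]. *)
pose q := beta + 4 * L ^+ 2 + 8 * (N%:R * kap * expR (- L)) / p + 1.
have w0 : 0 <= N%:R * kap * expR (- L) by apply: mulr_ge0 _ (expR_ge0 _); exact: mulr_ge0.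
have w1 : 0 <= 8 * (N%:R * kap * expR (- L)) / p by apply: divr_ge0; [exact: mulr_ge0|exact: ltW].
have L2 : 0 <= L ^+ 2 by exact: sqr_ge0.
pose k := (Num.truncn q).+1.
have mq : q <= (2 ^ k)%:R.
  by apply: ltW; apply: lt_trans (truncnS_gt _) _; rewrite ltr_nat -/k ltn_expl.
have mb : beta <= (2 ^ k)%:R by apply: le_trans mq; rewrite /q; lra.
have [A [mA PA hA]] := hoeffding_power (ltn0Sn _ : (0 < k)%N) mb.
exists A; split=> //; apply: le_trans PA; rewrite lee_fin lerD2l lerN2.
move: mq mb; set m : R := (2 ^ k)%:R => mq mb; rewrite -/p.
have m0 : 0 < m by rewrite ltr0n expn_gt0.
have low : expR (L - L ^+ 2 / m) <= (1 + L / m) ^+ (2 ^ k) by apply: expR_le_compound; rewrite ?expn_gt0.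
rewrite ler_pdivrMr; last exact: lt_le_trans (expR_gt0 _) low.
have p32 : 0 <= 3 / 2 * p by apply: mulr_ge0 => //; exact: ltW.
apply: le_trans (ler_wpM2l p32 low).
have -> : n%:R * expR (L / 2) = p * expR L.
  by rewrite /p -mulrA -expRD; congr (_ * expR _); field.
have -> : N%:R * (n%:R * (N%:R * beta * beta) * expR (N%:R * beta + beta) / m * expR (L / 2))
   = (N%:R * kap * expR (- L)) / m * expR L.
  by rewrite /kap expRN; have e0 := expR_gt0 L; field; rewrite !gt_eqF.
have q1 : 4 * L ^+ 2 <= m by apply: le_trans mq; rewrite /q -!addrA ler_wpDl // lerDl addr_ge0.
have q2 : 8 * (N%:R * kap * expR (- L)) / p <= m.
  by apply: le_trans mq; rewrite /q addrAC lerDr !addr_ge0 // mulr_ge0.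
exact: compound_slack.
Qed.
End Hoeffding.

(** * Quadratic forms vanishing almost surely *)

Section NullSets.
Context {R : realType}.

Lemma grid_cell (r t : R) K : 0 < r -> (0 < K)%N -> `|t| <= r ->
  exists k : 'I_K, - r + 2 * r * k%:R / K%:R <= t <= - r + 2 * r * k.+1%:R / K%:R.
Proof.
move=> r0 K0 tr; have K0' : 0 < K%:R :> R by rewrite ltr0n.
have /andP[t1 t2] : - r <= t <= r by rewrite -ler_norml.
pose u := (t + r) * K%:R / (2 * r).
have r2 : 0 < 2 * r by lra.
have tu : t = - r + 2 * r * u / K%:R by rewrite /u; field; rewrite !gt_eqF.
have mono a b : a <= b -> - r + 2 * r * a / K%:R <= - r + 2 * r * b / K%:R.
  by move=> ab; rewrite lerD2l ler_pM2r ?invr_gt0 // ler_pM2l.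
have u0 : 0 <= u by rewrite /u divr_ge0 ?mulr_ge0 //; lra.
have uK : u <= K%:R by rewrite /u ler_pdivrMr // [leRHS]mulrC ler_pM2r //; lra.
have [h1 h2] : (Num.truncn u)%:R <= u /\ u < (Num.truncn u).+1%:R.
  by split; [rewrite truncn_le|exact: truncnS_gt].
case: (ltnP (Num.truncn u) K) => hK.
  exists (Ordinal hK); rewrite tu /=; apply/andP; split; apply: mono => //.
  exact: ltW.
have K1 : (K.-1 < K)%N by rewrite prednK.
(* The right endpoint is the one point whose integer part leaves the grid; it goes to the last
   cell. *)
have uE : u = K%:R.
  by apply/eqP; rewrite eq_le uK /=; apply: le_trans h1; rewrite ler_nat.
exists (Ordinal K1); rewrite tu /= prednK //; apply/andP; split; apply: mono.
  by rewrite uE ler_nat leq_pred.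
exact: uK.
Qed.

(* Over a grid of mesh 2 r / K in the other coordinates, a Lipschitz graph is covered
   by one box of height O(1 / K) per cell. *)
Lemma lipschitz_graph_null n (i : 'I_n) (A : set 'cV[R]_n) (r L : R) : 0 < r -> 0 <= L ->
  (forall x, A x -> forall j, `|x j 0| <= r) ->
  (forall x y eta, 0 <= eta -> A x -> A y -> (forall j, j != i -> `|x j 0 - y j 0| <= eta) ->
     `|x i 0 - y i 0| <= L * eta) ->
  lebesgue_null A.
Proof.
move=> r0 L0 Ar AL e e0.
(* There are K^(n-1) cells, each with a box of base (2 r / K)^(n-1) and height 4 r L / K, so the
   total volume is [vol0 / K%:R]. *)
pose vol0 := (2 * r) ^+ n.-1 * (4 * r * L).
have vol0_ge : 0 <= vol0 by rewrite mulr_ge0 ?exprn_ge0 ?mulr_ge0 //; lra.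
pose K := (Num.truncn (vol0 / e)).+1.
have K0 : (0 < K)%N by [].
have KR : 0 < K%:R :> R by rewrite ltr0n.
have volK : vol0 / K%:R <= e.
  rewrite ler_pdivrMr // mulrC -ler_pdivrMr //; apply/ltW; exact: truncnS_gt.
pose c0 : 'I_K := Ordinal K0.
pose Q (j : 'I_n) : {pred 'I_K} := if j == i then pred1 c0 else predT.
pose cell (c : {ffun 'I_n -> 'I_K}) := [set x : 'cV[R]_n | A x /\ forall j, j != i ->
  - r + 2 * r * (c j)%:R / K%:R <= x j 0 <= - r + 2 * r * (c j).+1%:R / K%:R].
(* A point of [A] in the cell fixes the height of the box. Over an empty cell the default 0 gives a
   box that covers nothing needed and is counted in the total. *)
pose y c := xget (0 : 'cV[R]_n) (cell c).
pose lo c : 'cV[R]_n := \col_j (if j == i then y c i 0 - L * (2 * r / K%:R)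
   else - r + 2 * r * (c j)%:R / K%:R).
pose hi c : 'cV[R]_n := \col_j (if j == i then y c i 0 + L * (2 * r / K%:R)
   else - r + 2 * r * (c j).+1%:R / K%:R).
pose s := enum (family Q).
pose d0 : {ffun 'I_n -> 'I_K} := [ffun=> c0].
(* The finite cover is padded by degenerate boxes of volume 0. *)
pose a k := if (k < size s)%N then lo (nth d0 s k) else 0.
pose b k := if (k < size s)%N then hi (nth d0 s k) else 0.
have rK : 0 <= 2 * r / K%:R by rewrite divr_ge0 ?ltW //; lra.
have len c j : hi c j 0 - lo c j 0 = if j == i then 2 * L * (2 * r / K%:R) else 2 * r / K%:R.
  rewrite !mxE; case: (j == i); first by ring.
  by rewrite -[(c j).+1%:R]natr1; ring.
have len0 c j : 0 <= hi c j 0 - lo c j 0.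
  by rewrite len; case: (j == i) => //; rewrite mulr_ge0 // mulr_ge0.
exists a, b; split.
- by move=> k j; rewrite /a /b; case: ifP => _ //; rewrite -subr_ge0.
- move=> x Ax.
  have hc j : exists k : 'I_K, - r + 2 * r * k%:R / K%:R <= x j 0 <= - r + 2 * r * k.+1%:R / K%:R.
    by apply: grid_cell => //; exact: Ar.
  pose c : {ffun 'I_n -> 'I_K} := [ffun j => if j == i then c0 else projT1 (cid (hc j))].
  have cj j : j != i -> - r + 2 * r * (c j)%:R / K%:R <= x j 0 <= - r + 2 * r * (c j).+1%:R / K%:R.
    by move=> ji; rewrite ffunE (negbTE ji); exact: (projT2 (cid (hc j))).
  have cs : c \in s.
    rewrite mem_enum; apply/familyP => j; rewrite /Q ffunE; case: ifP => //.
  have cx : cell c x by split.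
  have [Ay cy] : cell c (y c) by exact: (@xgetPex _ 0 (cell c) (ex_intro _ x cx)).
  exists (index c s) => //= j; rewrite /a /b index_mem cs nth_index // !mxE.
  case: (eqVneq j i) => [->|ji]; last exact: cj.
  have : `|x i 0 - y c i 0| <= L * (2 * r / K%:R).
    apply: AL => // l li; have /andP[u1 u2] := cj l li; have /andP[v1 v2] := cy l li.
    have e2 : 2 * r * (c l).+1%:R / K%:R = 2 * r * (c l)%:R / K%:R + 2 * r / K%:R.
      by rewrite -natr1; ring.
    rewrite e2 in u2 v2; rewrite ler_norml; apply/andP; split; lra.
  by rewrite ler_norml => /andP[h1 h2]; apply/andP; split; lra.
pose f k := \prod_j (b k j 0 - a k j 0).
have f0 k : 0 <= f k.
  by apply: prodr_ge0 => j _; rewrite /a /b; case: ifP => _; rewrite ?subrr.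
have tot : \sum_(0 <= k < size s) f k <= e.
  have -> : \sum_(0 <= k < size s) f k = \sum_(c <- s) \prod_j (hi c j 0 - lo c j 0).
    rewrite [RHS](big_nth d0); apply: eq_big_nat => k /andP[_ ks].
    by rewrite /f /a /b ks.
  rewrite /s big_enum /=.
  pose F (j : 'I_n) (_ : 'I_K) : R := if j == i then 2 * L * (2 * r / K%:R) else 2 * r / K%:R.
  rewrite (eq_bigr (fun c : {ffun 'I_n -> 'I_K} => \prod_j F j (c j))); last first.
    by move=> c _; apply: eq_bigr => j _; rewrite len.
  rewrite -(bigA_distr_big_dep Q F) (bigD1 i) //= /Q eqxx big_pred1_eq /F eqxx.
  rewrite (eq_bigr (fun=> 2 * r)); last first.
    move=> j ji; rewrite (negbTE ji) sumr_const card_ord -mulr_natr; field.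
    by rewrite gt_eqF.
  rewrite prodr_const (_ : #|_| = n.-1); last first.
    by have := cardC1 i; rewrite card_ord => <-; apply: eq_card.
  apply: le_trans volK; rewrite /vol0 le_eqVlt; apply/orP; left; apply/eqP; ring.
apply: lime_le.
  by apply: is_cvg_nneseries => k _ _; rewrite lee_fin; exact: f0.
apply: nearW => N; rewrite sumEFin lee_fin; apply: le_trans tot.
case: (leqP N (size s)) => hN.
  by rewrite (big_cat_nat (leq0n N) hN) /= lerDl sumr_ge0.
rewrite (big_cat_nat (leq0n (size s)) (ltnW hN)) /= gerDl.
rewrite big_nat_cond big1 // => k; rewrite andbT => /andP[sk _].
rewrite (bigD1 i) //= /a /b ltnNge sk /= subrr mul0r //.
Qed.

Lemma dominated_ae d (T : measurableType d) (P : probability T R) n (z : T -> 'cV[R]_n) A :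
  random_vector z -> dominated_by_lebesgue P z -> vborel A -> lebesgue_null A ->
  {ae P, forall om, ~ A (z om)}.
Proof.
move=> rz dz vA nA; exists (z @^-1` A); split; [exact: rz|exact: dz|].
by move=> om /= /contrapT.
Qed.

Lemma vborel_meas n (A : set 'cV[R]_n) : measurable (A : set (vspace n)) -> vborel A.
Proof. by []. Qed.

Lemma measurable_bounded n (k : R) : measurable [set x : vspace n | forall j, `|x j 0| <= k].
Proof.
rewrite (_ : mkset _ = \bigcap_(j in [set: 'I_n]) [set x : vspace n | `|x j 0| <= k]).
  apply: fin_bigcap_measurable => [|j _]; first exact: finite_finset.
  rewrite -[X in measurable X]setTI; apply: measurable_fun_le => //.
  by apply: measurableT_comp => //; exact: vspace_coord.
by apply/seteqP; split => x /= h j => [_|]; exact: h.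
Qed.

Lemma measurable_mulmx_coord m n (S : 'M[R]_(m, n)) i :
  measurable_fun setT (fun x : vspace n => (S *m (x : 'cV[R]_n)) i 0).
Proof.
have -> : (fun x : vspace n => (S *m (x : 'cV[R]_n)) i 0) =
  (fun x : vspace n => \sum_j S i j * x j 0) by apply/funext => x; rewrite mxE.
by apply: measurable_sum => j; apply: measurable_funM => //; exact: vspace_coord.
Qed.

(** For [S != 0], the zero set of the form is a countable union of bounded Lipschitz graphs
    [A i k s], where coordinate [i] of [S *m x] is bounded away from 0, and of bounded pieces [H k]
    of a hyperplane, which contain the points with [S *m x = 0]. *)
Lemma quadratic_ae_zero d (T : measurableType d) (P : probability T R) n (z : T -> 'cV[R]_n)
    (S : 'M[R]_n) : random_vector z -> dominated_by_lebesgue P z -> symmx S ->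
  {ae P, forall om, qf S (z om) = 0} -> S = 0.
Proof.
move=> rz dz sS hS; apply: contrapT => S0.
have [p [q Spq]] : exists p q, S p q != 0.
  apply: contrapT => h; apply: S0; apply/matrixP => p q; rewrite mxE.
  by apply/eqP/negPn/negP => hp; apply: h; exists p, q.
pose sg := mxabs S; have sg0 : 0 <= sg := mxabs_ge0 S.
have Sb (x : 'cV[R]_n) k j : (forall l, `|x l 0| <= k) -> `|(S *m x) j 0| <= sg * k.
  move=> hx.
  rewrite mxE (le_trans (ler_norm_sum _ _ _)) //.
  apply: (@le_trans _ _ (\sum_l `|S j l| * k)).
    by apply: ler_sum => l _; rewrite normrM ler_wpM2l.
  have k0 : 0 <= k by apply: le_trans (hx j).
  rewrite -mulr_suml ler_wpM2r // /sg /mxabs [leRHS](bigD1 j) //= lerDl.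
  by apply: sumr_ge0 => i _; exact: sumr_ge0.
(* With the sign fixed by [s], the coordinates of [S *m x] and [S *m y] add up without
   cancellation. *)
pose A (i : 'I_n) (k : nat) (s : bool) := [set x : 'cV[R]_n |
  (forall j, `|x j 0| <= k.+1%:R) /\ qf S x = 0 /\ k.+1%:R^-1 <= (-1) ^+ s * (S *m x) i 0].
pose H (k : nat) := [set x : 'cV[R]_n | (forall j, `|x j 0| <= k.+1%:R) /\ (S *m x) p 0 = 0].
have k1 k : 0 < k.+1%:R :> R by rewrite ltr0n.
have mA i k s : vborel (A i k s).
  apply: vborel_meas; rewrite (_ : A i k s = [set x : vspace n | forall j, `|x j 0| <= k.+1%:R] `&`
     ((fun x : vspace n => qf S x) @^-1` [set 0] `&` [set x : vspace n | k.+1%:R^-1 <= (-1) ^+ s * (S *m (x : 'cV[R]_n)) i 0])).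
    apply: measurableI; first exact: measurable_bounded.
    apply: measurableI.
      rewrite -[X in measurable X]setTI; apply: measurable_qf => //.
      by move=> j; exact: vspace_coord.
    rewrite -[X in measurable X]setTI; apply: measurable_fun_le => //.
    by apply: measurable_funM => //; exact: measurable_mulmx_coord.
  by apply/seteqP; split.
have mH k : vborel (H k).
  apply: vborel_meas; rewrite (_ : H k = [set x : vspace n | forall j, `|x j 0| <= k.+1%:R] `&`
     ((fun x : vspace n => (S *m (x : 'cV[R]_n)) p 0) @^-1` [set 0])).
    apply: measurableI; first exact: measurable_bounded.
    by rewrite -[X in measurable X]setTI; exact: measurable_mulmx_coord.
  by apply/seteqP; split.
have dotE' (u w : 'cV[R]_n) i : dot u w = u i 0 * w i 0 + \sum_(j | j != i) u j 0 * w j 0.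
  by rewrite dotE (bigD1 i).
have sumb (u w : 'cV[R]_n) i c eta : 0 <= c -> 0 <= eta -> (forall j, `|u j 0| <= c) ->
    (forall j, j != i -> `|w j 0| <= eta) -> dot u w = 0 ->
    `|u i 0| * `|w i 0| <= n%:R * (c * eta).
  move=> c0 eta0 hu hw; rewrite (dotE' _ _ i) => /eqP; rewrite addr_eq0 => /eqP e.
  rewrite -normrM e normrN (le_trans (ler_norm_sum _ _ _)) //.
  apply: (@le_trans _ _ (\sum_(j | j != i) c * eta)).
    by apply: ler_sum => j ji; rewrite normrM; apply: ler_pM => //; exact: hw.
  apply: (@le_trans _ _ (\sum_(j < n) c * eta)).
    by rewrite [leRHS](bigD1 i) //= lerDr mulr_ge0.
  by rewrite sumr_const card_ord mulr_natl.
have nA i k s : lebesgue_null (A i k s).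
  pose c := sg * (2 * k.+1%:R).
  have c0 : 0 <= c by rewrite mulr_ge0 // mulr_ge0 // ltW.
  apply: (@lipschitz_graph_null n i _ k.+1%:R (k.+1%:R / 2 * (n%:R * c))) => //.
  - by rewrite mulr_ge0 ?mulr_ge0 // divr_ge0 // ltW.
  - by move=> x [].
  move=> x y eta eta0 [bx [qx gx]] [by_ [qy gy]] hxy.
  pose u := S *m (x + y); pose w := x - y.
  have hu j : `|u j 0| <= c.
    apply: Sb => l; rewrite mxE (le_trans (ler_normD _ _)) //.
    by have := bx l; have := by_ l; lra.
  (* Difference of squares: [dot (S *m (x + y)) (x - y) = qf S x - qf S y]. Solving for coordinate
     [i] of [x - y] gives the Lipschitz bound. *)
  have uw : dot u w = 0.
    rewrite /u /w mulmxDr dotDl !dotDr !dotNr -[dot (S *m x) x]dotC -[dot (S *m y) y]dotC.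
    rewrite -!qfE qx qy [dot (S *m x) y]dotC [dot y _]dot_mulr sS.
    by rewrite add0r subr0 addrC subrr.
  have hw j : j != i -> `|w j 0| <= eta by move=> ji; rewrite !mxE; exact: hxy.
  have := sumb u w i c eta c0 eta0 hu hw uw.
  have -> : w i 0 = x i 0 - y i 0 by rewrite !mxE.
  have ui : 2 / k.+1%:R <= `|u i 0|.
    have -> : `|u i 0| = `|(-1) ^+ s * u i 0| by rewrite normrM normr_sign mul1r.
    apply: le_trans (ler_norm _).
    have -> : u i 0 = (S *m x) i 0 + (S *m y) i 0 by rewrite /u mulmxDr; exact: mxE.
    by rewrite mulrDr mulr_natl mulr2n; exact: lerD.
  move=> h; have : 2 / k.+1%:R * `|x i 0 - y i 0| <= n%:R * (c * eta).
    by apply: le_trans h; rewrite ler_wpM2r.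
  rewrite mulrAC ler_pdivrMr // => h'.
  have -> : k.+1%:R / 2 * (n%:R * c) * eta = n%:R * (c * eta) * k.+1%:R / 2 by field.
  by rewrite ler_pdivlMr //; lra.
have nH k : lebesgue_null (H k).
  have aq : 0 < `|S p q| by rewrite normr_gt0.
  apply: (@lipschitz_graph_null n q _ k.+1%:R (n%:R * sg / `|S p q|)) => //.
  - by rewrite divr_ge0 // mulr_ge0.
  - by move=> x [].
  move=> x y eta eta0 [bx hx] [by_ hy] hxy.
  pose u := (row p S)^T; pose w := x - y.
  have hu j : `|u j 0| <= sg by rewrite !mxE; exact: mxabs_entry.
  have hw j : j != q -> `|w j 0| <= eta by move=> ji; rewrite !mxE; exact: hxy.
  have uw : dot u w = 0.
    rewrite /dot /u trmxK -row_mul mxE /w mulmxBr [LHS]mxE [X in _ + X]mxE hx hy.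
    by rewrite subrr.
  have := sumb u w q sg eta sg0 eta0 hu hw uw.
  have -> : w q 0 = x q 0 - y q 0 by rewrite !mxE.
  have -> : u q 0 = S p q by rewrite !mxE.
  move=> h; rewrite mulrAC ler_pdivlMr //; move: h; rewrite mulrC mulrA //.
have aeA : {ae P, forall om, forall k i s, ~ A i k s (z om)}.
  apply: ae_foralln => k; apply: filter_forall => i; apply: filter_forall => s.
  exact: dominated_ae.
have aeH : {ae P, forall om, forall k, ~ H k (z om)}.
  by apply: ae_foralln => k; exact: dominated_ae.
have : {ae P, forall om : T, False}.
  apply: filterS3 hS aeA aeH => om q0 hA hH.
  pose k0 := Num.truncn (norm2 (z om)).
  have zk k : (k0 <= k)%N -> forall j, `|z om j 0| <= k.+1%:R.
    move=> kk j; apply: le_trans (norm2_entry _ _) _; apply: ltW.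
    by apply: lt_le_trans (truncnS_gt _) _; rewrite ler_nat ltnS.
  have Sz i : (S *m z om) i 0 = 0.
    apply: contrapT => /eqP nz.
    pose k := maxn k0 (Num.truncn `|(S *m z om) i 0|^-1).
    apply: (hA k i ((S *m z om) i 0 < 0)); split; first by apply: zk; exact: leq_maxl.
    split => //; have -> : (-1) ^+ ((S *m z om) i 0 < 0)%R * (S *m z om) i 0 = `|(S *m z om) i 0|.
      case: (ltP ((S *m z om) i 0) 0) => h; first by rewrite expr1 mulN1r ltr0_norm.
      by rewrite expr0 mul1r ger0_norm.
    rewrite -[leRHS]invrK lef_pV2 ?posrE ?invr_gt0 ?normr_gt0 //; apply: ltW.
    by apply: lt_le_trans (truncnS_gt _) _; rewrite ler_nat ltnS leq_maxr.
  by apply: (hH k0); split; [exact: zk|exact: Sz].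
case=> N [mN N0 /= hN].
have : P [set: T] = 0%E.
  by apply/eqP; rewrite eq_le measure_ge0 andbT -N0; apply: le_measure; rewrite ?inE // => om _; exact: hN.
by rewrite probability_setT => /eqP; rewrite eqe oner_eq0.
Qed.
End NullSets.

(** * Least squares *)

Section OperatorNorm.
Context {R : realType}.

Lemma opnorm2_ub m n (A : 'M[R]_(m, n)) x : norm2 x <= 1 -> norm2 (A *m x) <= opnorm2 A.
Proof.
move=> x1; apply: ub_le_sup; last by exists x.
exists (mxabs A) => _ [y /= y1 <-]; apply: le_trans (opb_mxabs A y) _.
by rewrite ler_piMr // mxabs_ge0.
Qed.

Lemma opnorm2_ge0 m n (A : 'M[R]_(m, n)) : 0 <= opnorm2 A.
Proof. by have := @opnorm2_ub m n A 0; rewrite mulmx0 !norm2_0; apply. Qed.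

Lemma opb_opnorm2 m n (A : 'M[R]_(m, n)) : opb (opnorm2 A) A.
Proof.
move=> x; have [->|x0] := eqVneq x 0; first by rewrite mulmx0 !norm2_0 mulr0.
have p : 0 < norm2 x.
  by rewrite lt0r norm2_ge0 andbT; apply: contra x0 => /eqP/norm2_eq0 ->.
have := opnorm2_ub A (_ : norm2 ((norm2 x)^-1 *: x) <= 1).
rewrite -scalemxAr !norm2Z gtr0_norm ?invr_gt0 // mulVf ?gt_eqF // lexx => /(_ isT).
by rewrite mulrC ler_pdivrMr.
Qed.

Lemma opnorm2_le m n (A : 'M[R]_(m, n)) c : 0 <= c -> opb c A -> opnorm2 A <= c.
Proof.
move=> c0 h; apply: ge_sup; first by exists (norm2 (A *m 0)), 0; rewrite //= norm2_0.
by move=> _ [x /= x1 <-]; apply: le_trans (h x) _; rewrite ler_piMr.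
Qed.

Lemma mxabs_opnorm2 m n (A : 'M[R]_(m, n)) : mxabs A <= m%:R * n%:R * opnorm2 A.
Proof.
apply: (@le_trans _ _ (\sum_(i < m) \sum_(j < n) opnorm2 A)).
  by apply: ler_sum => i _; apply: ler_sum => j _; apply: opb_entry; exact: opb_opnorm2.
by rewrite !sumr_const !card_ord -[leLHS]mulr_natl -[_ *+ n]mulr_natl mulrA.
Qed.

Lemma mxabsM m n p (A : 'M[R]_(m, n)) (B : 'M[R]_(n, p)) : mxabs (A *m B) <= mxabs A * mxabs B.
Proof.
rewrite /mxabs mulr_suml; apply: ler_sum => i _.
apply: (@le_trans _ _ (\sum_j \sum_k `|A i k| * `|B k j|)).
  by apply: ler_sum => j _; rewrite mxE (le_trans (ler_norm_sum _ _ _)) //; apply: ler_sum => k _; rewrite normrM.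
rewrite exchange_big mulr_suml; apply: ler_sum => k _ /=.
rewrite -mulr_sumr ler_wpM2l // [leRHS](bigD1 k) //= lerDl.
by apply: sumr_ge0 => l _; exact: sumr_ge0.
Qed.

(** For [H = est_H M N zs i] this is the map whose norm is [est_Hnorm], which is then
    [svec_map_norm H] by conversion. *)
Definition svec_map n (H : 'M[R]_(sdim n)) (X : 'M[R]_n) : 'M[R]_n := smat (H *m svec X).

Definition svec_map_norm n (H : 'M[R]_(sdim n)) : R :=
  sup [set opnorm2 (svec_map H X) | X in [set X : 'M[R]_n | symmx X /\ opnorm2 X <= 1]].

Lemma svec_map_linear n (H : 'M[R]_(sdim n)) : linear (svec_map H).
Proof.
move=> a u v; rewrite /svec_map (svec_linear a u v) mulmxDr -scalemxAr.
exact: smat_linear.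
Qed.

Lemma svec_map_linearl n (X : 'M[R]_n) : linear (fun H => svec_map H X).
Proof. by move=> a u v; rewrite /svec_map mulmxDl -scalemxAl; exact: smat_linear. Qed.

Lemma svec_map_bound n : exists2 c, 0 <= c &
  forall (H : 'M[R]_(sdim n)) X, opnorm2 X <= 1 -> opnorm2 (svec_map H X) <= c * mxabs H.
Proof.
have [c1 c10 h1] := lin_mxabs (@smat_linear R n).
have [c2 c20 h2] := lin_mxabs (@svec_linear R n).
have n0 : 0 <= n%:R * n%:R :> R by rewrite mulr_ge0.
exists (c1 * (c2 * (n%:R * n%:R))).
  by apply: mulr_ge0 => //; exact: mulr_ge0.
move=> H X X1; apply: opnorm2_le.
  by apply: mulr_ge0; [apply: mulr_ge0 => //; exact: mulr_ge0|exact: mxabs_ge0].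
apply: (opbW _ (opb_mxabs _)); apply: le_trans (h1 _) _.
rewrite -mulrA ler_wpM2l //; apply: le_trans (mxabsM _ _) _.
rewrite mulrC ler_wpM2r ?mxabs_ge0 //; apply: le_trans (h2 _) _.
rewrite ler_wpM2l //; apply: le_trans (mxabs_opnorm2 _) _.
by rewrite ler_piMr.
Qed.

Lemma svec_map_norm_ub n (H : 'M[R]_(sdim n)) X :
  symmx X -> opnorm2 X <= 1 -> opnorm2 (svec_map H X) <= svec_map_norm H.
Proof.
move=> sX X1; have [c c0 hc] := svec_map_bound n.
apply: ub_le_sup; last by exists X.
by exists (c * mxabs H) => _ [Y /= [_ Y1] <-]; exact: hc.
Qed.

Lemma opnorm2_0 m n : opnorm2 (0 : 'M[R]_(m, n)) = 0.
Proof. by apply/eqP; rewrite eq_le opnorm2_ge0 andbT; apply: opnorm2_le => //; exact: opb0. Qed.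

Lemma svec_map_norm_le n (H : 'M[R]_(sdim n)) c :
  (forall X, symmx X -> opnorm2 X <= 1 -> opnorm2 (svec_map H X) <= c) -> svec_map_norm H <= c.
Proof.
move=> h; apply: ge_sup; last by move=> _ [X /= [sX X1] <-]; exact: h.
by exists (opnorm2 (svec_map H 0)), 0; split; rewrite ?opnorm2_0 //; exact: symmx0.
Qed.

Lemma svec_map_norm_ge0 n (H : 'M[R]_(sdim n)) : 0 <= svec_map_norm H.
Proof.
apply: le_trans (opnorm2_ge0 _) (@svec_map_norm_ub n H 0 _ _); first exact: symmx0.
by rewrite opnorm2_0.
Qed.

Lemma opb_svec_map n (H : 'M[R]_(sdim n)) X c : symmx X -> 0 <= c -> opb c X ->
  opb (c * svec_map_norm H) (svec_map H X).
Proof.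
move=> sX; rewrite le0r => /orP[/eqP -> h|c0 h].
  have -> : X = 0.
    apply/matrixP => i j; rewrite mxE; apply/eqP; rewrite -normr_le0.
    exact: opb_entry.
  by rewrite (lin_0 (@svec_map_linear n H)) mul0r; exact: opb0.
have -> : svec_map H X = c *: svec_map H (c^-1 *: X).
  by rewrite (lin_Z _ (@svec_map_linear n H)) scalerA mulfV ?gt_eqF // scale1r.
rewrite -{1}(gtr0_norm c0); apply: opbZ; apply: opbW (opb_opnorm2 _).
apply: svec_map_norm_ub; first exact: symmxZ.
apply: opnorm2_le => //; rewrite -(mulVf (lt0r_neq0 c0)).
by rewrite -{1}(@gtr0_norm _ c^-1) ?invr_gt0 //; exact: opbZ.
Qed.

Lemma opnorm2D m n (A B : 'M[R]_(m, n)) : opnorm2 (A + B) <= opnorm2 A + opnorm2 B.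
Proof.
apply: opnorm2_le; first by apply: addr_ge0; exact: opnorm2_ge0.
by apply: opbD; exact: opb_opnorm2.
Qed.

(** Needed for measurability: the norm is a supremum over uncountably many matrices. *)
Lemma svec_map_norm_lipschitz n : exists2 c, 0 <= c &
  forall A B : 'M[R]_(sdim n), svec_map_norm A <= svec_map_norm B + c * mxabs (A - B).
Proof.
have [c c0 hc] := svec_map_bound n; exists c => // A B.
apply: svec_map_norm_le => X sX X1.
have -> : svec_map A X = svec_map B X + svec_map (A - B) X.
  by rewrite -(lin_D (@svec_map_linearl n X)) addrC subrK.
by apply: le_trans (opnorm2D _ _) _; apply: lerD; [exact: svec_map_norm_ub|exact: hc].
Qed.

Lemma svec_map_norm_bound n : exists2 c, 0 <= c &
  forall A : 'M[R]_(sdim n), svec_map_norm A <= c * mxabs A.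
Proof.
by have [c c0 hc] := svec_map_bound n; exists c => // A; apply: svec_map_norm_le => X _; exact: hc.
Qed.

End OperatorNorm.

(** * Pseudo-inverse and normal equations *)

Section LeastSquares.
Context {R : realType}.

Lemma mpinv_sym n (S : 'M[R]_n) : S^T = S -> (mpinv S)^T = mpinv S.
Proof.
move=> sS; have [b1 b2 b3 b4] := mpinvP S.
apply: (@mpinv_uniq _ _ _ S) (mpinvP S); split.
- by rewrite -{1 3}sS -!trmx_mul mulmxA b1.
- by rewrite -{2}sS -!trmx_mul mulmxA b2.
- by rewrite trmx_mul trmxK sS -b4 trmx_mul sS.
- by rewrite trmx_mul trmxK sS -b3 trmx_mul sS.
Qed.

(** The right side satisfies the Penrose equations. The point is [A *m (mpinv S *m S) = A], which
    holds because the difference of the two sides has zero Gram matrix. *)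
Lemma mpinv_gram m n (A : 'M[R]_(m, n)) : mpinv A = mpinv (A^T *m A) *m A^T.
Proof.
pose S := A^T *m A; have sS : S^T = S by rewrite trmx_mul trmxK.
have [a1 a2 a3 a4] := mpinvP A; have [b1 b2 b3 b4] := mpinvP S.
have ATS : A *m (mpinv S *m S) = A.
  have e : (A *m (1%:M - mpinv S *m S))^T *m (A *m (1%:M - mpinv S *m S)) = 0.
    rewrite trmx_mul -!mulmxA (mulmxA A^T) -/S mulmxBr mulmx1 (mulmxA S) b1 subrr.
    by rewrite mulmx0.
  have z : A *m (1%:M - mpinv S *m S) = 0.
    apply/matrixP => i j; rewrite [RHS]mxE; have := congr1 (fun B : 'M[R]_n => B j j) e.
    set B := _ *m (_ - _); rewrite [LHS]mxE [RHS]mxE => h; apply/eqP; rewrite -sqrf_eq0; apply/eqP.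
    apply: (@psumr_eq0P _ _ _ (fun k => B k j ^+ 2) _ _ i isT) => [k _|]; first exact: sqr_ge0.
    by rewrite -[RHS]h; apply: eq_bigr => k _; rewrite [X in X * _]mxE expr2.
  by move: z; rewrite mulmxBr mulmx1 => /eqP; rewrite subr_eq0 => /eqP <-.
have sT := mpinv_sym sS.
apply: mpinv_uniq (mpinvP A) _; split.
- by rewrite -!mulmxA -/S ATS.
- by rewrite -!mulmxA (mulmxA A^T) -/S (mulmxA S) (mulmxA (mpinv S) (S *m _)) (mulmxA (mpinv S) S) b2.
- by rewrite mulmxA !trmx_mul trmxK sT mulmxA.
- by rewrite -mulmxA -/S b4.
Qed.

(** Normal equations: the stacked least-squares problem in terms of sums over the samples. *)
Lemma mpinv_mxcol m n N (A : 'I_N -> 'M[R]_(m, n)) p (y : 'I_N -> 'M[R]_(m, p)) :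
  mpinv (\mxcol_(i < N) A i) *m \mxcol_(i < N) y i =
  mpinv (\sum_(i < N) (A i)^T *m A i) *m \sum_(i < N) (A i)^T *m y i.
Proof. by rewrite mpinv_gram tr_mxcol -mulmxA !mul_mxrow_mxcol. Qed.

(* [K] is the orthogonal projection onto the kernel of [S]. *)
Lemma mpinv_kernel n (S K : 'M[R]_n) c : c != 0 -> S^T = S -> K^T = K -> K *m K = K ->
  S *m K = 0 -> S + c *: K \in unitmx ->
  mpinv S = invmx (S + c *: K) - c^-1 *: K.
Proof.
move=> c0 sS sK KK SK uU; set U := S + c *: K.
have SE : S = U - c *: K by rewrite /U addrK.
have KS : K *m S = 0 by rewrite -sS -{1}sK -trmx_mul SK trmx0.
have KU : K *m U = c *: K by rewrite mulmxDr KS add0r -scalemxAr KK.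
have UK : U *m K = c *: K by rewrite mulmxDl SK add0r -scalemxAl KK.
have iK : invmx U *m K = c^-1 *: K.
  by rewrite -{1}[K]scale1r -(mulVf c0) -scalerA -UK -scalemxAr mulKmx.
have Ki : K *m invmx U = c^-1 *: K.
  by rewrite -{1}[K]scale1r -(mulVf c0) -scalerA -KU -scalemxAl mulmxK.
set T := _ - _.
have KT : K *m T = 0 by rewrite /T mulmxBr -scalemxAr KK Ki subrr.
have TS : T *m S = 1%:M - K.
  rewrite mulmxBl -scalemxAl KS scaler0 subr0 [X in _ *m X]SE.
  by rewrite mulmxBr mulVmx // -scalemxAr iK scalerA mulfV // scale1r.
have ST : S *m T = 1%:M - K.
  rewrite mulmxBr -scalemxAr SK scaler0 subr0 [X in X *m _]SE.
  by rewrite mulmxBl mulmxV // -scalemxAl Ki scalerA mulfV // scale1r.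
apply: mpinv_uniq (mpinvP S) _; split.
- by rewrite ST mulmxBl mul1mx KS subr0.
- rewrite TS mulmxBl mul1mx {2}/T mulmxBr -scalemxAr KK Ki subrr subr0 //.
- by rewrite ST linearB /= trmx1 sK.
- by rewrite TS linearB /= trmx1 sK.
Qed.

End LeastSquares.

Section Gram.
Context {R : realType} (nx nu nw : nat).
Variable M : 'I_nw -> 'M[R]_(nx, nx + nu).

Definition gram_at (z : 'cV[R]_(nx + nu)) : 'M[R]_(sdim nw) :=
  (skron (model_at M z))^T *m skron (model_at M z).

Lemma gram_at_sym z : (gram_at z)^T = gram_at z.
Proof. by rewrite trmx_mul trmxK. Qed.

Lemma gram_at_psd z : psdmx (gram_at z).
Proof.
by split; [exact: gram_at_sym|move=> x; rewrite -/(qf _ _) qf_gram; exact: dot_ge0].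
Qed.

Lemma mxabs_tens m n p q (A : 'M[R]_(m, n)) (B : 'M[R]_(p, q)) :
  mxabs (A *t B) <= (m * p)%:R * ((n * q)%:R * (mxabs A * mxabs B)).
Proof.
rewrite /mxabs -/(mxabs A) -/(mxabs B).
apply: (@le_trans _ _ (\sum_(i < m * p) \sum_(j < n * q) mxabs A * mxabs B)).
  apply: ler_sum => i _; apply: ler_sum => j _.
  rewrite mxE normrM; apply: ler_pM => //; exact: mxabs_entry.
by rewrite !sumr_const !card_ord -[leLHS]mulr_natl -[_ *+ (n * q)]mulr_natl.
Qed.

Lemma gram_at_bounded r : exists2 c, 0 <= c &
  forall z, norm2 z <= r -> mxabs (gram_at z) <= c.
Proof.
pose q := nx%:R * nw%:R * ((\sum_k mxabs (M k)) * `|r|).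
have sM : 0 <= \sum_k mxabs (M k) by apply: sumr_ge0 => k _; exact: mxabs_ge0.
have q0 : 0 <= q by apply: mulr_ge0; [exact: mulr_ge0|exact: mulr_ge0].
pose b := mxabs (Qsym nx : 'M[R]__) * ((nx * nx)%:R * ((nw * nw)%:R * (q * q))) * mxabs (Qsym nw : 'M[R]__)^T.
have b0 : 0 <= b.
  apply: mulr_ge0 (mxabs_ge0 _); apply: mulr_ge0 (mxabs_ge0 _) _.
  by apply: mulr_ge0 => //; apply: mulr_ge0 => //; exact: mulr_ge0.
exists (b * b); first exact: mulr_ge0.
move=> z zr.
have hm : mxabs (model_at M z) <= q.
  apply: (@le_trans _ _ (\sum_(a < nx) \sum_(k < nw) (\sum_k mxabs (M k)) * `|r|)).
    apply: ler_sum => a _; apply: ler_sum => k _; rewrite mxE.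
    apply: le_trans (norm2_entry _ _) _; apply: le_trans (opb_mxabs _ _) _.
    apply: ler_pM; [exact: mxabs_ge0|exact: norm2_ge0| |exact: le_trans (ler_norm r)].
    by rewrite (bigD1 k) //= lerDl; apply: sumr_ge0 => l _; exact: mxabs_ge0.
  by rewrite !sumr_const !card_ord -[leLHS]mulr_natl -[_ *+ nw]mulr_natl mulrA.
have hs : mxabs (skron (model_at M z)) <= b.
  apply: le_trans (mxabsM _ _) _; apply: ler_pM; [exact: mxabs_ge0|exact: mxabs_ge0| |by []].
  apply: le_trans (mxabsM _ _) _; rewrite ler_wpM2l ?mxabs_ge0 //.
  apply: le_trans (mxabs_tens _ _) _; rewrite ler_wpM2l // ler_wpM2l //.
  by apply: ler_pM => //; exact: mxabs_ge0.
apply: le_trans (mxabsM _ _) _; apply: ler_pM => //; try exact: mxabs_ge0.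
apply: le_trans hs; rewrite /mxabs exchange_big /=.
by apply: ler_sum => i _; apply: ler_sum => j _; rewrite mxE.
Qed.

Lemma mxmeas_gram_at : @mxmeas R _ (vspace (nx + nu)) _ _ (fun z => gram_at z).
Proof.
have mm : @mxmeas R _ (vspace (nx + nu)) _ _ (fun z => model_at M z).
  move=> a k; rewrite (_ : (fun _ => _) = fun z : 'cV[R]_(nx + nu) => (M k *m z) a 0).
    exact: measurable_mulmx_coord.
  by apply/funext => z; rewrite mxE.
have ms : @mxmeas R _ (vspace (nx + nu)) _ _ (fun z => skron (model_at M z)).
  apply: mxmeasM; last exact: mxmeas_cst.
  apply: mxmeasM; first exact: mxmeas_cst.
  move=> i j; pose f (z : 'cV[R]_(nx + nu)) := model_at M z (mxtens_unindex i).1 (mxtens_unindex j).1 *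
    model_at M z (mxtens_unindex i).2 (mxtens_unindex j).2.
  rewrite (_ : (fun _ => _) = f); first by apply: measurable_funM; exact: mm.
  by apply/funext => z; rewrite mxE.
by apply: mxmeasM => //; exact: mxmeas_tr.
Qed.

Lemma skron_model_kernel z (K0 : 'M[R]_nw) : symmx K0 -> gram_at z *m svec K0 = 0 ->
  model_at M z *m K0 *m (model_at M z)^T = 0.
Proof.
move=> sK h; set U := model_at M z.
have hs : skron U *m svec K0 = 0.
  apply: trmx_mul_eq0; rewrite trmx_mul.
  transitivity ((svec K0)^T *m (gram_at z *m svec K0)); first by rewrite !mulmxA.
  by rewrite h mulmx0.
have sU : symmx (U *m K0 *m U^T) by rewrite /symmx !trmx_mul trmxK sK mulmxA.
by rewrite -(smat_svec sU) -skron_svec // hs (lin_0 (@smat_linear R _)).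
Qed.

Lemma qf_madj (K0 : 'M[R]_nw) P z : symmx K0 ->
  qf (madj M K0 P) z = \tr (model_at M z *m K0 *m (model_at M z)^T *m P).
Proof.
move=> sK; rewrite -mxtrace_rank1M mxtrace_mulC -mxtrace_momE //; congr (\tr (_ *m _)).
apply/matrixP => a b; rewrite summxE [RHS]mxE.
rewrite (eq_bigr (fun k => \sum_l K0 k l * ((M k *m z) a 0 * (M l *m z) b 0))); last first.
  move=> k _; rewrite summxE; apply: eq_bigr => l _; rewrite mxE; congr (_ * _).
  rewrite mulmxA -mulmxA -trmx_mul mxE big_ord1; congr (_ * _); exact: mxE.
rewrite exchange_big /=; apply: eq_bigr => l _; rewrite [X in X * _]mxE mulr_suml.
apply: eq_bigr => k _; rewrite [X in _ = X * _ * _]mxE [X in _ = _ * X]mxE.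
by rewrite [X in _ = _ * X]mxE mulrCA mulrA.
Qed.

(** The form of [madj M K0 S] at [z] is a trace of [M(z) K0 M(z)^T] against [S], hence zero almost
    surely, and [quadratic_ae_zero] removes the dependence on [z]. *)
Lemma madj_unidentifiable d (T : measurableType d) (P : probability T R)
    (z : T -> 'cV[R]_(nx + nu)) (K0 : 'M[R]_nw) (S : 'M[R]_nx) :
  random_vector z -> dominated_by_lebesgue P z -> symmx K0 -> symmx S ->
  {ae P, forall om, gram_at (z om) *m svec K0 = 0} -> madj M K0 S = 0.
Proof.
move=> rz dz sK sS h; apply: (quadratic_ae_zero rz dz); first exact: madj_sym.
apply: filterS h => om h; rewrite qf_madj //.
by rewrite skron_model_kernel // mul0mx mxtrace0.
Qed.

Section Estimate.
Variables (N : nat) (xs : nat -> 'cV[R]_nx) (zs : nat -> 'cV[R]_(nx + nu)).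
Variables (ws : nat -> 'cV[R]_nw) (K : 'M[R]_(sdim nw)).
Hypothesis xsE : forall i, xs i = model_at M (zs i) *m ws i.

(** The Gram sum filled in on its kernel. It is invertible for typical samples, and [invmx] of it
    replaces the pseudo-inverse, whose measurability is less direct. The factor [N%:R] makes both
    terms grow at the same rate. *)
Definition gram_reg := \sum_(j < N) gram_at (zs j) + N%:R *: K.
Definition hat_map i := invmx gram_reg *m gram_at (zs i).

Hypothesis N0 : (0 < N)%N.
Hypothesis sK : K^T = K.
Hypothesis KK : K *m K = K.
Hypothesis gK : forall i, (i < N)%N -> gram_at (zs i) *m K = 0.
Hypothesis uU : gram_reg \in unitmx.

Let S := \sum_(j < N) gram_at (zs j).

Lemma gram_sum_kernel : S *m K = 0.
Proof. by rewrite mulmx_suml big1 // => j _; exact: gK. Qed.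

Lemma gram_sum_mpinv : mpinv S = invmx gram_reg - N%:R^-1 *: K.
Proof.
apply: mpinv_kernel => //; first by rewrite pnatr_eq0 -lt0n.
  by rewrite linear_sum; apply: eq_bigr => j _; exact: gram_at_sym.
exact: gram_sum_kernel.
Qed.

Lemma est_hat_map i : (i < N)%N -> est_H M N zs i = hat_map i.
Proof.
move=> iN; rewrite /est_H gram_sum_mpinv mulmxBl -scalemxAl.
rewrite -[gram M zs i]/(gram_at (zs i)) (_ : K *m gram_at (zs i) = 0); last first.
  by rewrite -sK -gram_at_sym -trmx_mul gK // trmx0.
by rewrite scaler0 subr0.
Qed.

Lemma hat_map_sum : \sum_(i < N) hat_map i = 1%:M - K.
Proof.
have -> : \sum_(i < N) hat_map i = invmx gram_reg *m S by rewrite mulmx_sumr.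
have e : S = gram_reg *m (1%:M - K).
  rewrite mulmxBr mulmx1 mulmxDl gram_sum_kernel add0r -scalemxAl KK.
  by rewrite /gram_reg addrK.
by rewrite [X in _ *m X]e mulKmx.
Qed.

(** The weights [hat_map] sum to [1%:M - K], so subtracting the identifiable part of [W] centers
    every sample. *)
Lemma estimation_error (W : 'M[R]_nw) : symmx W ->
  What M N xs zs - smat ((1%:M - K) *m svec W) =
  \sum_(i < N) svec_map (hat_map i) (ws i *m (ws i)^T - W).
Proof.
move=> sW; rewrite /What mpinv_mxcol.
have -> : \sum_(i < N) (skron (model_at M (zs i)))^T *m svec (xs i *m (xs i)^T) =
    \sum_(i < N) gram_at (zs i) *m svec (ws i *m (ws i)^T).
  apply: eq_bigr => i _; rewrite -mulmxA skron_svec; last by rewrite /symmx trmx_mul trmxK.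
  by rewrite xsE (trmx_mul _ (ws i)) !mulmxA.
rewrite mulmx_sumr -hat_map_sum mulmx_suml -(lin_B (@smat_linear R _)).
rewrite -sumrB (lin_sum _ _ _ (@smat_linear R _)); apply: eq_bigr => i _.
rewrite /svec_map (lin_B (@svec_linear R _)) mulmxBr mulmxA -[mpinv _ *m _]/(est_H M N zs i).
by rewrite est_hat_map.
Qed.

Lemma zeta_hat_map : zetaW M N zs = Num.sqrt (\sum_(i < N) svec_map_norm (hat_map i) ^+ 2).
Proof.
by congr (Num.sqrt _); apply: eq_bigr => i _; rewrite -est_hat_map.
Qed.

End Estimate.
End Gram.

(** * Law of large numbers for the Gram matrix *)

Section MeasurableLipschitz.
Context {R : realType} {d : measure_display} {T : measurableType d}.

Lemma rat_matrix_dense m n (A : 'M[R]_(m, n)) e : 0 < e ->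
  exists Q : 'M[rat]_(m, n), mxabs (A - map_mx ratr Q) < e.
Proof.
move=> e0; pose h := e / (m%:R * n%:R + 1).
have c0 : 0 < m%:R * n%:R + 1 :> R by apply: ltr_wpDl => //; apply: mulr_ge0.
have h0 : 0 < h by apply: divr_gt0.
have hq i j : {q : rat | `|A i j - ratr q| <= h}.
  apply: cid; have [|q] := @rat_in_itvoo R (A i j - h) (A i j + h); first by lra.
  rewrite in_itv /= => /andP[q1 q2]; exists q; rewrite ler_norml; apply/andP; split; lra.
exists (\matrix_(i, j) projT1 (hq i j)).
apply: (@le_lt_trans _ _ (\sum_(i < m) \sum_(j < n) h)).
  by apply: ler_sum => i _; apply: ler_sum => j _; rewrite !mxE; exact: projT2 (hq i j).
rewrite !sumr_const !card_ord -[ltLHS]mulr_natl -[h *+ n]mulr_natl mulrA.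
rewrite /h mulrA ltr_pdivrMr // mulrC ltr_pM2l //; lra.
Qed.

(* The sublevel sets of a Lipschitz [f] are countable unions of balls around rational matrices. *)
Lemma measurable_lipschitz m n (f : 'M[R]_(m, n) -> R) c (A : T -> 'M[R]_(m, n)) : 0 <= c ->
  (forall X Y, f X <= f Y + c * mxabs (X - Y)) -> mxmeas A ->
  measurable_fun setT (fun om => f (A om)).
Proof.
move=> c0 hf mA; apply: (measurability _ (RGenInftyO.measurableE R)) => _ [_ [y ->] <-].
rewrite setTI; pose E (Q : 'M[rat]_(m, n)) :=
  [set om | f (map_mx ratr Q) + c * mxabs (A om - map_mx ratr Q) < y].
rewrite (_ : _ @^-1` _ = \bigcup_Q E Q).
  apply: countable_bigcupT_measurable => [|Q]; first exact: countableP.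
  have : measurable_fun setT (fun om => f (map_mx ratr Q) + c * mxabs (A om - map_mx ratr Q)).
    apply: measurable_funD => //; apply: measurable_funM => //.
    apply: measurable_sum => i; apply: measurable_sum => j.
    apply: measurableT_comp => //.
    under eq_fun do rewrite mxE; apply: measurable_funD; first exact: mA.
    exact: measurable_cst.
  move=> /(_ measurableT `]-oo, y[%classic (measurable_itv _)); rewrite setTI.
  by congr measurable; apply/seteqP; split => om /=; rewrite in_itv.
apply/seteqP; split => om /=; rewrite in_itv /=.
  move=> lt; pose e := (y - f (A om)) / (2 * c + 1).
  have c1 : 0 < 2 * c + 1 by lra.
  have e0 : 0 < e by apply: divr_gt0 => //; rewrite subr_gt0.
  have [Q hQ] := rat_matrix_dense (A om) e0; exists Q => //.
  rewrite /E /=; have := hf (map_mx ratr Q) (A om).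
  rewrite -(mxabsN (_ - A om)) opprB => h.
  have : 2 * c * mxabs (A om - map_mx ratr Q) <= 2 * c * e.
    by apply: ler_wpM2l; [apply: mulr_ge0|exact: ltW].
  have : e * (2 * c + 1) = y - f (A om) by rewrite /e mulfVK // gt_eqF.
  lra.
by move=> [Q _]; apply: le_lt_trans; exact: hf.
Qed.

End MeasurableLipschitz.

Section WeakLaw.
Context {R : realType} {d : measure_display} {T : measurableType d} (P : probability T R).

Lemma fmeas_comp_sigma_of n (X : T -> 'cV[R]_n) (g : 'cV[R]_n -> R) :
  measurable_fun setT (g : vspace n -> R) -> fmeas (sigma_of X) (fun om => g (X om)).
Proof.
move=> mg B mB; exists (g @^-1` B); last by rewrite setTI.
by have := mg measurableT _ mB; rewrite setTI.
Qed.

Lemma measurable_comp_vector n (X : T -> 'cV[R]_n) (g : 'cV[R]_n -> R) : random_vector X ->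
  measurable_fun setT (g : vspace n -> R) -> measurable_fun setT (fun om => g (X om)).
Proof. by move=> rX mg; exact: (fmeas_measurable (sigma_of_measurable rX) (fmeas_comp_sigma_of X mg)). Qed.

Lemma ex_sum_sq_orthogonal (F : nat -> T -> R) c N : 0 <= c ->
  (forall i, measurable_fun setT (F i)) -> (forall i, {ae P, forall om, `|F i om| <= c}) ->
  (forall i j, i != j -> ex P (fun om => F i om * F j om) = 0) ->
  integ P (fun om => (\sum_(i < N) F i om) ^+ 2) /\
  ex P (fun om => (\sum_(i < N) F i om) ^+ 2) <= N%:R * c ^+ 2.
Proof.
move=> c0 mF bF oF.
have iFF i j : integ P (fun om => F i om * F j om).
  apply: (@integ_bound _ _ _ _ _ (c * c)); first by apply: measurable_funM; exact: mF.
  by apply: filterS2 (bF i) (bF j) => om h1 h2; rewrite normrM ler_pM.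
have isum k : integ P (fun om => \sum_(i < k) F i om * F k om) by apply: integ_sum => i; exact: iFF.
elim: N => [|N [IH1 IH2]].
  have -> : (fun om => (\sum_(i < 0) F i om) ^+ 2) = (fun=> 0).
    by apply/funext => om; rewrite big_ord0 expr0n.
  by split; [exact: integ_cst|rewrite ex_cst mul0r].
have e : (fun om => (\sum_(i < N.+1) F i om) ^+ 2) =
    (fun om => ((\sum_(i < N) F i om) ^+ 2 + 2 * \sum_(i < N) F i om * F N om) + F N om * F N om).
  apply/funext => om; rewrite big_ord_recr /= -mulr_suml; ring.
have i1 := integZ 2 (isum N); have i2 := integD IH1 i1.
rewrite e; split; first exact: (integD i2 (iFF N N)).
rewrite (exD i2 (iFF N N)) (exD IH1 i1) exZ //.
rewrite (ex_sum _ (fun i => iFF _ _)) big1 ?mulr0 ?addr0; last first.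
  by move=> i _; apply: oF; rewrite ltn_eqF.
rewrite -natr1 mulrDl mul1r; apply: lerD => //.
rewrite -(ex_cst P (c ^+ 2)); apply: ex_le (integ_cst _ _) _ => //.
by apply: filterS (bF N) => om h; rewrite -expr2 -real_normK ?num_real // lerXn2r ?nnegrE.
Qed.

Lemma centered_sum_sq n (z : nat -> T -> 'cV[R]_n) (g : 'cV[R]_n -> R) c N :
  (forall i, random_vector (z i)) -> (forall i, same_law P P (z i) (z 0%N)) ->
  (forall i j, i != j -> indep2 P (sigma_of (z i)) (sigma_of (z j))) ->
  measurable_fun setT (g : vspace n -> R) -> 0 <= c ->
  (forall i, {ae P, forall om, `|g (z i om)| <= c}) ->
  let mu := ex P (fun om => g (z 0%N om)) in
  integ P (fun om => (\sum_(i < N) (g (z i om) - mu)) ^+ 2) /\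
  ex P (fun om => (\sum_(i < N) (g (z i om) - mu)) ^+ 2) <= N%:R * (2 * c) ^+ 2.
Proof.
move=> rz lz iz mg c0 bg mu.
have mgz i : measurable_fun setT (fun om => g (z i om)) by exact: measurable_comp_vector.
have ig i : integ P (fun om => g (z i om)) by exact: integ_bound (bg i).
have mu_c : `|mu| <= c.
  have h1 : mu <= c.
    rewrite -(ex_cst P c); apply: ex_le => //; first exact: integ_cst.
    by apply: filterS (bg 0%N) => om; exact/le_trans/ler_norm.
  have h2 : - c <= mu.
    rewrite -(ex_cst P (- c)); apply: ex_le => //; first exact: integ_cst.
    by apply: filterS (bg 0%N) => om; rewrite ler_norml => /andP[].
  by rewrite ler_norml h1 h2.
have exg i : ex P (fun om => g (z i om) - mu) = 0.
  rewrite exB ?ex_cst //; last exact: integ_cst.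
  have lzi : same_law P P (z 0%N) (z i) by move=> A vA; rewrite lz.
  by have [_ ->] := law_ex (rz _) (rz _) lzi mg (ig 0%N); rewrite subrr.
apply: (@ex_sum_sq_orthogonal (fun i om => g (z i om) - mu)).
- exact: mulr_ge0.
- by move=> i; apply: measurable_funB => //; exact: measurable_cst.
- move=> i; apply: filterS (bg i) => om h; apply: le_trans (ler_normB _ _) _; lra.
move=> i j ij.
have mg' : measurable_fun setT ((fun x => g x - mu) : vspace n -> R).
  by apply: measurable_funB => //; exact: measurable_cst.
have ib k : integ P (fun om => g (z k om) - mu) by apply: integB => //; exact: integ_cst.
have [_ ->] := ex_indep (sigma_of_measurable (rz i)) (sigma_of_measurable (rz j)) (iz _ _ ij)
  (fmeas_comp_sigma_of (z i) mg') (fmeas_comp_sigma_of (z j) mg') (ib i) (ib j).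
by rewrite exg mul0r.
Qed.

End WeakLaw.

Section KernelProjection.
Context {R : realType}.

(** Orthogonal projection onto the kernel of [S]. *)
Definition kproj n (S : 'M[R]_n) : 'M[R]_n := 1%:M - mpinv S *m S.

Lemma kproj_sym n (S : 'M[R]_n) : (kproj S)^T = kproj S.
Proof. by have [_ _ _ h] := mpinvP S; rewrite linearB /= trmx1 h. Qed.

Lemma mul_kproj n (S : 'M[R]_n) : S *m kproj S = 0.
Proof. by have [h _ _ _] := mpinvP S; rewrite mulmxBr mulmx1 mulmxA h subrr. Qed.

Lemma kproj_idem n (S : 'M[R]_n) : kproj S *m kproj S = kproj S.
Proof. by rewrite {1}/kproj mulmxBl mul1mx -mulmxA mul_kproj mulmx0 subr0. Qed.

Lemma psd_qf0 n (A : 'M[R]_n) x : psdmx A -> qf A x = 0 -> A *m x = 0.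
Proof.
move=> pA h; have := psd_CS (A *m x) x pA; rewrite h mulr0 => h'.
apply: dot_eq0; apply/eqP; rewrite -sqrf_eq0; apply/eqP.
by apply/eqP; rewrite eq_le h' sqr_ge0.
Qed.

Lemma pd_kproj n (S : 'M[R]_n) : psdmx S -> pdmx (S + kproj S).
Proof.
move=> pS; have qk x : qf (kproj S) x = dot (kproj S *m x) (kproj S *m x).
  by rewrite -{1}kproj_idem -{1}kproj_sym qf_gram.
split; first by rewrite /symmx linearD /= kproj_sym (psd_sym pS).
move=> x x0; rewrite -/(qf _ _) qfDl qk; have h1 := pS.2 x; have h2 := dot_ge0 (kproj S *m x).
rewrite lt0r addr_ge0 // andbT; apply: contra x0.
rewrite paddr_eq0 // => /andP[/eqP /(psd_qf0 pS) Sx] /eqP /dot_eq0 /eqP.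
by rewrite /kproj mulmxBl mul1mx -mulmxA Sx mulmx0 subr0.
Qed.

Lemma invmx_opb n c (A : 'M[R]_n) : 0 < c -> symmx A -> lemx c%:M A -> opb c^-1 (invmx A).
Proof.
move=> c0 sA h y; have uA := pd_unit (pd_of_ge c0 sA h).
have := lemx_qf (invmx A *m y) h; rewrite qf_scalar qfE mulKVmx // -norm2_sqr.
have := dot_le_norm2 (invmx A *m y) y; set x := norm2 _; set v := norm2 y => h1 h2.
have x0 : 0 <= x := norm2_ge0 _; have v0 : 0 <= v := norm2_ge0 _.
have h3 : c * x ^+ 2 <= x * v by exact: le_trans h2 (le_trans (ler_norm _) h1).
rewrite mulrC ler_pdivlMr //; case: (eqVneq x 0) => [->|xn]; first by rewrite mul0r.
by rewrite -(@ler_pM2l _ x) ?lt0r ?xn // mulrA -expr2 mulrC.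
Qed.

Lemma mxtrace_gram0 m n (A : 'M[R]_(m, n)) : \tr (A^T *m A) = 0 -> A = 0.
Proof.
move=> h; apply/matrixP => i j; rewrite [RHS]mxE; apply/eqP; rewrite -sqrf_eq0; apply/eqP.
have e : \tr (A^T *m A) = \sum_j \sum_i A i j ^+ 2.
  apply: eq_bigr => k _; rewrite mxE; apply: eq_bigr => l _.
  by rewrite [X in X * _]mxE expr2.
rewrite e in h.
have := @psumr_eq0P _ _ predT (fun j => \sum_i A i j ^+ 2) (fun j _ => sumr_ge0 _ (fun i _ => sqr_ge0 (A i j))) h j isT.
by move/psumr_eq0P => /(_ _ i isT); apply => k _; exact: sqr_ge0.
Qed.

Lemma mxtrace_gram_kproj m n (J : 'M[R]_(m, n)) (S : 'M[R]_n) :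
  \tr (J^T *m J *m kproj S) = \tr ((J *m kproj S)^T *m (J *m kproj S)).
Proof.
rewrite trmx_mul kproj_sym -{1}kproj_idem; set K := kproj S.
rewrite (mulmxA (J^T *m J) K K) (mxtrace_mulC _ K); congr (\tr _).
by rewrite -!mulmxA.
Qed.

End KernelProjection.

(** * Empirical and mean Gram matrix *)

Section Data.
Context {R : realType} (nx nu nw : nat).
Variable M : 'I_nw -> 'M[R]_(nx, nx + nu).
Context {d : measure_display} {T : measurableType d} (P : probability T R).
Variables (zs : nat -> T -> 'cV[R]_(nx + nu)) (rz : R).
Hypothesis rzs : forall i, random_vector (zs i).
Hypothesis lzs : forall i, same_law P P (zs i) (zs 0%N).
Hypothesis izs : forall i j, i != j -> indep2 P (sigma_of (zs i)) (sigma_of (zs j)).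
Hypothesis bzs : forall i, {ae P, forall om, norm2 (zs i om) <= rz}.
Hypothesis dzs : dominated_by_lebesgue P (zs 0%N).

Let s := sdim nw.
Let g p q (z : 'cV[R]_(nx + nu)) : R := gram_at M z p q.

Definition mean_gram : 'M[R]_s := \matrix_(p, q) ex P (fun om => g p q (zs 0%N om)).
Definition gram_kernel : 'M[R]_s := kproj mean_gram.

Lemma measurable_gram_entry p q : measurable_fun setT (g p q : vspace (nx + nu) -> R).
Proof. exact: mxmeas_gram_at. Qed.

Lemma gram_entry_bounded : exists2 c, 0 <= c &
  forall i, {ae P, forall om, mxabs (gram_at M (zs i om)) <= c}.
Proof.
have [c c0 hc] := gram_at_bounded M rz; exists c => // i.
by apply: filterS (bzs i) => om; exact: hc.
Qed.

Lemma gram_entry_integ i p q : integ P (fun om => g p q (zs i om)).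
Proof.
have [c c0 hc] := gram_entry_bounded.
apply: (@integ_bound _ _ _ _ _ c); first exact: measurable_comp_vector (measurable_gram_entry p q).
by apply: filterS (hc i) => om; apply: le_trans; exact: mxabs_entry.
Qed.

Lemma mean_gram_psd : psdmx mean_gram.
Proof.
split.
  by apply/matrixP => p q; rewrite !mxE; congr (ex P _); apply/funext => om;
     rewrite /g -[in LHS]gram_at_sym mxE.
move=> x; rewrite -/(qf _ _); have -> : qf mean_gram x = ex P (fun om => qf (gram_at M (zs 0%N om)) x).
  under [in RHS]eq_fun do rewrite qf_entries.
  rewrite qf_entries (ex_sum _ (F := fun p om => \sum_q gram_at M (zs 0%N om) p q * (x p 0 * x q 0))).
    apply: eq_bigr => p _; rewrite (ex_sum _ (F := fun q om => gram_at M (zs 0%N om) p q * (x p 0 * x q 0))).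
      apply: eq_bigr => q _; rewrite mxE mulrC -exZ ?(gram_entry_integ 0) //.
      by congr (ex P _); apply/funext => om; rewrite mulrC.
    by move=> q; under [X in integ _ X]eq_fun do rewrite mulrC; apply/integZ/gram_entry_integ.
  move=> p; apply: integ_sum => q.
  by under [X in integ _ X]eq_fun do rewrite mulrC; apply/integZ/gram_entry_integ.
by apply: ex_ge0 => om; exact: (gram_at_psd M _).2.
Qed.

(** The trace of [gram_at M z *m gram_kernel] is a sum of squares, and its expectation is the trace
    of [mean_gram *m gram_kernel = 0]. Equality of laws extends this from the first regressor to
    all. *)
Lemma gram_kernel_ae : {ae P, forall om, forall i, gram_at M (zs i om) *m gram_kernel = 0}.
Proof.
pose f (z : 'cV[R]_(nx + nu)) : R := \tr (gram_at M z *m gram_kernel).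
have fE z : f z = \tr ((skron (model_at M z) *m gram_kernel)^T *m (skron (model_at M z) *m gram_kernel)).
  exact: mxtrace_gram_kproj.
have fS z : f z = \sum_p \sum_q gram_kernel q p * g p q z.
  by apply: eq_bigr => p _; rewrite mxE; apply: eq_bigr => q _; rewrite mulrC.
have f0 z : 0 <= f z.
  rewrite fE; apply: sumr_ge0 => p _; rewrite mxE; apply: sumr_ge0 => q _.
  by rewrite [X in X * _]mxE -expr2 sqr_ge0.
have mf : measurable_fun setT (f : vspace (nx + nu) -> R).
  apply: measurable_trace; apply: mxmeasM; [exact: mxmeas_gram_at|exact: mxmeas_cst].
have iF : integ P (fun om => f (zs 0%N om)).
  under [X in integ _ X]eq_fun do rewrite fS.
  by apply: integ_sum => p; apply: integ_sum => q; apply/integZ/gram_entry_integ.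
have e0 : ex P (fun om => f (zs 0%N om)) = 0.
  have <- : \tr (mean_gram *m gram_kernel) = 0 by rewrite mul_kproj mxtrace0.
  under eq_fun do rewrite fS.
  rewrite (ex_sum _ (F := fun p om => \sum_q gram_kernel q p * g p q (zs 0%N om))).
    apply: eq_bigr => p _; rewrite mxE (ex_sum _ (F := fun q om => gram_kernel q p * g p q (zs 0%N om))).
      by apply: eq_bigr => q _; rewrite exZ ?mxE 1?mulrC //; exact: gram_entry_integ.
    by move=> q; apply/integZ/gram_entry_integ.
  by move=> p; apply: integ_sum => q; apply/integZ/gram_entry_integ.
have ae0 := ex_eq0_ae iF (fun om => f0 _) e0.
apply: ae_foralln => i.
have lz : same_law P P (zs 0%N) (zs i) by move=> A vA; rewrite lzs.
have hi : {ae P, forall om, f (zs i om) <= 0}.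
  by apply: (law_ae_le (rzs 0) (rzs i) lz mf); apply: filterS ae0 => om ->.
apply: filterS hi => om h; have fz : f (zs i om) = 0 by apply/eqP; rewrite eq_le h f0.
rewrite fE in fz; rewrite /gram_at -mulmxA (mxtrace_gram0 fz) mulmx0 //.
Qed.

Lemma gram_kernel_madj (W : 'M[R]_nw) S : symmx W -> symmx S ->
  madj M (smat (gram_kernel *m svec W)) S = 0.
Proof.
move=> sW sS; apply: (madj_unidentifiable (rzs 0) dzs) => //; first exact: smat_sym.
by apply: filterS gram_kernel_ae => om h; rewrite svec_smat mulmxA h mul0mx.
Qed.

(* Chebyshev's inequality for the entries of the empirical Gram matrix. *)
Lemma gram_lln : exists2 l, 0 < l & forall e, 0 < e -> exists N0, forall N, (N0 <= N)%N ->
  exists A, [/\ measurable A, ((1 - e)%:E <= P A)%E &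
    forall om, A om -> lemx (N%:R * l)%:M (gram_reg M N (zs ^~ om) gram_kernel)].
Proof.
have pdG := pd_kproj mean_gram_psd; have [l l0 hl] := pd_ge pdG.
have [c c0 hc] := gram_entry_bounded.
exists (l / 2); first by lra.
pose s2 : R := s%:R * s%:R.
have s20 : 0 <= s2 by apply: mulr_ge0.
(* If each of the [s2] entries of the mean deviates by at most [eta], the lower bound [l] drops at
   most to [l / 2]. *)
pose eta := l / (2 * (s2 + 1)); have eta0 : 0 < eta by apply: divr_gt0 => //; lra.
have etas : s2 * eta <= l / 2.
  have -> : l / 2 = (s2 + 1) * eta by rewrite /eta; field; rewrite gt_eqF //; lra.
  by rewrite ler_wpM2r ?ltW //; lra.
move=> e e0.
pose V := s2 * (2 * c) ^+ 2; have V0 : 0 <= V by apply: mulr_ge0 => //; exact: sqr_ge0.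
(* [V] bounds the total variance per sample, so the failure probability is at most
   [N V / (N eta)^2], which is below [e] from [N0] on. *)
pose N0 := (Num.truncn (V / eta ^+ 2 / e)).+1; exists N0 => N NN.
have N0R : 0 < N%:R :> R by rewrite ltr0n; apply: leq_trans NN.
pose D p q om := \sum_(i < N) (g p q (zs i om) - mean_gram p q).
pose X om := \sum_p \sum_q D p q om ^+ 2.
have hD p q := @centered_sum_sq _ _ _ P _ zs (g p q) c N rzs lzs izs (measurable_gram_entry p q) c0
  (fun i => filterS (fun om h => le_trans (mxabs_entry _ p q) h) (hc i)).
have {}hD p q : integ P (fun om => D p q om ^+ 2) /\
    ex P (fun om => D p q om ^+ 2) <= N%:R * (2 * c) ^+ 2.
  rewrite (_ : (fun om => D p q om ^+ 2) = fun om => (\sum_(i < N)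
     (g p q (zs i om) - ex P (fun om => g p q (zs 0%N om)))) ^+ 2); first exact: hD.
  by apply/funext => om; congr (_ ^+ 2); apply: eq_bigr => i _; rewrite mxE.
have iD p q := (hD p q).1.
have iX : integ P X by apply: integ_sum => p; apply: integ_sum.
have eX : ex P X <= N%:R * V.
  rewrite /X (ex_sum _ (F := fun p om => \sum_q D p q om ^+ 2)); last by move=> p; apply: integ_sum.
  apply: (@le_trans _ _ (\sum_(p < s) \sum_(q < s) N%:R * (2 * c) ^+ 2)).
    apply: ler_sum => p _; rewrite (ex_sum _ (F := fun q om => D p q om ^+ 2)) //.
    by apply: ler_sum => q _; exact: (hD p q).2.
  rewrite !sumr_const !card_ord -[leLHS]mulr_natl -[_ *+ s]mulr_natl /V /s2.
  by rewrite le_eqVlt; apply/orP; left; apply/eqP; ring.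
have a0 : 0 < (N%:R * eta) ^+ 2 by rewrite exprn_gt0 // mulr_gt0.
have X0 om : 0 <= X om by apply: sumr_ge0 => p _; apply: sumr_ge0 => q _; exact: sqr_ge0.
have mX := integ_meas iX.
have mbad : measurable [set om | (N%:R * eta) ^+ 2 <= X om].
  rewrite -[X in measurable X]setTI; apply: measurable_fun_le => //; exact: measurable_cst.
exists (~` [set om | (N%:R * eta) ^+ 2 <= X om]); split; first exact: measurableC.
  rewrite probability_setC // EFinB; apply: leeB => //.
  apply: le_trans (ex_markov iX X0 a0) _; rewrite lee_fin ler_pdivrMr //.
  apply: le_trans eX _; have -> : e * (N%:R * eta) ^+ 2 = N%:R * (N%:R * e * eta ^+ 2) by ring.
  rewrite ler_pM2l // -!ler_pdivrMr ?exprn_gt0 //.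
  by apply: ltW; apply: lt_le_trans (truncnS_gt _) _; rewrite ler_nat.
move=> om /= /negP; rewrite -ltNge => Xom.
have small p q : `|D p q om| <= N%:R * eta.
  have r0 : 0 <= N%:R * eta by apply: mulr_ge0 => //; exact: ltW.
  rewrite -(@ler_pXn2r _ 2) ?nnegrE // real_normK ?num_real //.
  apply: le_trans (ltW Xom); rewrite /X (bigD1 p) //= (bigD1 q) //= -addrA lerDl.
  apply: addr_ge0; first by apply: sumr_ge0 => j _; exact: sqr_ge0.
  by apply: sumr_ge0 => j _; apply: sumr_ge0 => k _; exact: sqr_ge0.
set G := gram_reg _ _ _ _.
have sG : symmx G.
  rewrite /symmx /G /gram_reg linearD linearZ /= kproj_sym linear_sum /=; congr (_ + _).
  by apply: eq_bigr => i _; exact: gram_at_sym.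
pose E : 'M[R]_s := \matrix_(p, q) D p q om.
have GE : G = N%:R *: (mean_gram + gram_kernel) + E.
  rewrite /G /gram_reg [in RHS]scalerDr [RHS]addrAC; congr (_ + _); apply/matrixP => p q.
  rewrite summxE mxE [X in X + _]mxE [X in _ + X]mxE /D sumrB sumr_const card_ord mulr_natl.
  by rewrite addrC subrK.
have sE : symmx E.
  have -> : E = G - N%:R *: (mean_gram + gram_kernel) by rewrite GE addrC addKr.
  by apply: symmxB => //; apply: symmxZ; exact: pdG.1.
have hE : lemx (- (N%:R * (l / 2))%:M) E.
  apply: opb_ge => //; apply: opbW (opb_mxabs E).
  apply: (@le_trans _ _ (\sum_(p < s) \sum_(q < s) N%:R * eta)).
    by apply: ler_sum => p _; apply: ler_sum => q _; rewrite mxE.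
  rewrite !sumr_const !card_ord -[leLHS]mulr_natl -[_ *+ s]mulr_natl.
  rewrite [leLHS](_ : _ = N%:R * (s2 * eta)); last by rewrite /s2; ring.
  by rewrite ler_wpM2l // ltW.
have := lemxD (lemxZ (ltW N0R) hl) hE; rewrite -GE.
by rewrite scale_scalar_mx -raddfB /=; congr (lemx _%:M _); field.
Qed.
End Data.

(** * Concentration of the estimation error *)

Section SymmetricBounds.
Context {R : realType}.

(** Polarization: the upper bound at [x + t *: (A *m x)] and the lower bound at [x - t *: (A *m x)],
    with [t = c^-1]. *)
Lemma opb_lemx n c (A : 'M[R]_n) : 0 <= c -> symmx A -> lemx (- c%:M) A -> lemx A c%:M -> opb c A.
Proof.
move=> c0 sA h1 h2 x; set y := A *m x.
have pol t : 4 * (t * dot y y) <= 2 * c * (dot x x + t ^+ 2 * dot y y).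
  have := lemx_qf (x + t *: y) h2; have := lemx_qf (x - t *: y) h1.
  rewrite -scaleN1r qfZl !qf_scalar !qfE !mulmxDr mulmxN -!scalemxAr -/y.
  rewrite !dotDl !dotDr !dotNl !dotNr !dotZl !dotZr.
  have -> : dot x (A *m y) = dot y y by rewrite dot_mulr sA.
  rewrite (dotC x y); lra.
have y0 := dot_ge0 y; have x0 := dot_ge0 x.
rewrite -(@ler_pXn2r _ 2) ?nnegrE ?norm2_ge0 //; last by apply: mulr_ge0 => //; exact: norm2_ge0.
rewrite exprMn !norm2_sqr; case: (eqVneq c 0) => [c_0|cn].
  by have := pol 1; rewrite c_0 expr0n /= mul0r mulr0 mul0r; lra.
have cp : 0 < c by rewrite lt0r cn.
have := pol c^-1; have -> : 2 * c * (dot x x + c^-1 ^+ 2 * dot y y) = 2 * (c * dot x x) + 2 * (c^-1 * dot y y).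
  by field.
move=> h; have h' : c^-1 * dot y y <= c * dot x x by lra.
by move: h'; rewrite mulrC ler_pdivrMr // mulrAC -expr2.
Qed.

Lemma rank1_le n (x : 'cV[R]_n) r : norm2 x <= r -> lemx (x *m x^T) (r ^+ 2)%:M.
Proof.
move=> xr; apply: lemxP => [||y]; [by rewrite /symmx trmx_mul trmxK|exact: symmx_scalar|].
rewrite qf_rank1 qf_scalar; apply: le_trans (dot_CS x y) _.
rewrite ler_wpM2r ?dot_ge0 // -norm2_sqr lerXn2r ?nnegrE ?norm2_ge0 //.
exact: le_trans (norm2_ge0 _) xr.
Qed.

(** Separates the map, which depends on the regressors, from the coordinates of the noise, so that
    independence applies term by term. *)
Lemma svec_map_expand n (H : 'M[R]_(sdim n)) X :
  svec_map H X = \sum_p svec X p 0 *: svec_map H (smat (delta_mx p 0)).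
Proof.
have e (s : 'cV[R]_(sdim n)) : s = \sum_p s p 0 *: delta_mx p 0.
  by rewrite {1}[s]matrix_sum_delta; apply: eq_bigr => p _; rewrite big_ord1.
rewrite {1}/svec_map {1}(e (svec X)).
rewrite mulmx_sumr (lin_sum _ _ _ (@smat_linear R _)); apply: eq_bigr => p _.
by rewrite -scalemxAr (lin_Z _ (@smat_linear R _)) /svec_map svec_smat.
Qed.

End SymmetricBounds.

Section Measurability.
Context {R : realType} (nx nu nw : nat).
Variable M : 'I_nw -> 'M[R]_(nx, nx + nu).
Context {d : measure_display} {T : measurableType d}.
Variables (zs : nat -> T -> 'cV[R]_(nx + nu)) (K : 'M[R]_(sdim nw)) (N : nat).
Hypothesis rzs : forall i, (i < N)%N -> random_vector (zs i).

Lemma mxmeas_hat_map i : (i < N)%N -> mxmeas (fun om => hat_map M N (zs ^~ om) K i).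
Proof.
have mg j : (j < N)%N -> mxmeas (fun om => gram_at M (zs j om)).
  move=> jN p q; exact: (@measurable_comp_vector _ _ _ _ _ (fun z => gram_at M z p q) (rzs jN) (@mxmeas_gram_at R nx nu nw M p q)).
move=> iN; apply: mxmeasM (mg _ iN); apply: mxmeas_invmx.
apply: mxmeasD; last exact: mxmeas_cst.
by apply: mxmeas_sum => j _; exact: mg.
Qed.

Definition hat_norm i om := svec_map_norm (hat_map M N (zs ^~ om) K i).
Definition hat_zeta om := Num.sqrt (\sum_(i < N) hat_norm i om ^+ 2).

Lemma measurable_hat_norm i : (i < N)%N -> measurable_fun setT (hat_norm i).
Proof.
move=> iN; have [c c0 hc] := @svec_map_norm_lipschitz R nw.
exact: (measurable_lipschitz c0 hc (mxmeas_hat_map iN)).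
Qed.

Lemma measurable_hat_zeta : measurable_fun setT hat_zeta.
Proof.
apply: measurableT_comp; first by apply: continuous_measurable_fun; exact: sqrt_continuous.
by apply: measurable_sum => i; apply: measurable_funX; exact: measurable_hat_norm.
Qed.

Lemma mxmeas_svec_map (H : T -> 'M[R]_(sdim nw)) (X : T -> 'M[R]_nw) :
  mxmeas H -> mxmeas X -> mxmeas (fun om => svec_map (H om) (X om)).
Proof.
move=> mH mX i j; pose s om := H om *m svec (X om).
have ms : mxmeas s.
  apply: mxmeasM => // p q.
  rewrite (_ : (fun om => _) = fun om => (if (lowpos p).1 == (lowpos p).2 then 1 else Num.sqrt 2)
    * X om (lowpos p).1 (lowpos p).2).
    by apply: measurable_funM; [exact: measurable_cst|exact: mX].
  by apply/funext => om; rewrite mxE; case: (lowpos p) => a b /=; case: eqP => _; rewrite ?mul1r.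
rewrite (_ : (fun om => _) = fun om => \sum_p s om p 0 * sbasis p i j).
  by apply: measurable_sum => p; apply: measurable_funM; [exact: ms|exact: measurable_cst].
by apply/funext => om; rewrite /svec_map summxE; apply: eq_bigr => p _; rewrite mxE.
Qed.

End Measurability.

Section Events.
Context {R : realType} {d : measure_display} {T : measurableType d} (P : probability T R).

(** Removing a null set turns an almost sure property, possibly not measurable, into a sure one on
    the event. *)
Lemma event_ae (A : set T) (Q : T -> Prop) : measurable A -> {ae P, forall om, Q om} ->
  exists B, [/\ measurable B, (P A <= P B)%E & forall om, B om -> A om /\ Q om].
Proof.
move=> mA [N0 [mN PN hN]]; exists (A `\` N0); split; first exact: measurableD.
  rewrite -[leRHS]adde0 -PN; apply: le_trans (_ : (P ((A `\` N0) `|` N0) <= _)%E).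
    apply: le_measure; rewrite ?inE //; first by apply: measurableU => //; exact: measurableD.
    by move=> om Aom; case: (pselect (N0 om)) => h; [right|left].
  by apply: measureU2 => //; exact: measurableD.
move=> om [Aom nN]; split => //; apply: contrapT => nQ; exact/nN/hN.
Qed.

Lemma eventI (A B : set T) a b : measurable A -> measurable B -> ((1 - a)%:E <= P A)%E ->
  ((1 - b)%:E <= P B)%E -> measurable (A `&` B) /\ ((1 - (a + b))%:E <= P (A `&` B))%E.
Proof.
move=> mA mB hA hB; split; first exact: measurableI.
have mC : measurable (~` A `|` ~` B) by apply: measurableU; exact: measurableC.
have e : A `&` B = ~` (~` A `|` ~` B) by rewrite setCU !setCK.
rewrite e probability_setC // EFinB; apply: leeB => //.
apply: le_trans (measureU2 _ (measurableC mA) (measurableC mB)) _.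
have h C c : measurable C -> ((1 - c)%:E <= P C)%E -> (P (~` C) <= c%:E)%E.
  move=> mC' hC; rewrite probability_setC // leeBlDr ?fin_num_measure //.
  by rewrite -leeBlDl // -EFinB.
by rewrite EFinD; apply: leeD; exact: h.
Qed.
End Events.

(** * The noise part of the estimation error *)

Section Noise.
Context {R : realType} (nx nu nw : nat).
Variable M : 'I_nw -> 'M[R]_(nx, nx + nu).
Context {d : measure_display} {T : measurableType d} (P : probability T R).
Variables (zs : nat -> T -> 'cV[R]_(nx + nu)) (ws : nat -> T -> 'cV[R]_nw).
Variables (rw : R) (W : 'M[R]_nw) (K : 'M[R]_(sdim nw)) (N : nat).
Hypothesis rzs : forall i, random_vector (zs i).
Hypothesis rws : forall i, random_vector (ws i).

Definition data_sigma (i : nat + nat) : set (set T) :=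
  match i with inl j => sigma_of (zs j) | inr j => sigma_of (ws j) end.

Hypothesis ind : independent P data_sigma.
Hypothesis bws : forall i, {ae P, forall om, norm2 (ws i om) <= rw}.
Hypothesis mws : forall i k l, ex P (fun om => ws i om k 0 * ws i om l 0) = W k l.

Definition noise_dev i om : 'M[R]_nw := ws i om *m (ws i om)^T - W.

Lemma data_sigma_salg i : sigma_algebra setT (data_sigma i).
Proof. by case: i => i; exact: sigma_of_salg. Qed.

Lemma data_sigma_measurable i : data_sigma i `<=` measurable.
Proof. by case: i => i; apply: sigma_of_measurable. Qed.

Lemma rank1_entry (x : 'cV[R]_nw) k l : (x *m x^T) k l = x k 0 * x l 0.
Proof. by rewrite mxE big_ord1; congr (_ * _); exact: mxE. Qed.

Lemma noise_mul_integ i k l : integ P (fun om => ws i om k 0 * ws i om l 0).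
Proof.
apply: (@integ_bound _ _ _ _ _ (rw * rw)).
  by apply: measurable_funM; exact: (random_vectorP _).1.
apply: filterS (bws i) => om h; rewrite normrM; apply: ler_pM => //.
  exact: le_trans (norm2_entry _ _) h.
exact: le_trans (norm2_entry _ _) h.
Qed.

Lemma noise_W_sym : symmx W.
Proof.
apply/matrixP => k l; rewrite mxE -!(mws 0); congr (ex P _).
by apply/funext => om; rewrite mulrC.
Qed.

Lemma noise_dev_sym i om : symmx (noise_dev i om).
Proof. by apply: symmxB; [rewrite /symmx trmx_mul trmxK|exact: noise_W_sym]. Qed.

Lemma noise_W_qf x : integ P (fun om => qf (ws 0%N om *m (ws 0%N om)^T) x) /\
  qf W x = ex P (fun om => qf (ws 0%N om *m (ws 0%N om)^T) x).
Proof.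
have e : (fun om => qf (ws 0%N om *m (ws 0%N om)^T) x) =
    (fun om => \sum_k \sum_l x k 0 * x l 0 * (ws 0%N om k 0 * ws 0%N om l 0)).
  apply/funext => om; rewrite qf_entries; apply: eq_bigr => k _; apply: eq_bigr => l _.
  by rewrite rank1_entry mulrC.
have i0 k l : integ P (fun om => x k 0 * x l 0 * (ws 0%N om k 0 * ws 0%N om l 0)).
  by apply/integZ/noise_mul_integ.
rewrite e; split; first by apply: integ_sum => k; exact: integ_sum.
rewrite qf_entries (ex_sum _ (F := fun k om => \sum_l x k 0 * x l 0 * (ws 0%N om k 0 * ws 0%N om l 0))).
  apply: eq_bigr => k _.
  rewrite (ex_sum _ (F := fun l om => x k 0 * x l 0 * (ws 0%N om k 0 * ws 0%N om l 0))) //.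
  by apply: eq_bigr => l _; rewrite (exZ _ (noise_mul_integ _ _ _)) mws mulrC.
by move=> k; exact: integ_sum.
Qed.

Lemma noise_W_le : lemx 0 W /\ lemx W (rw ^+ 2)%:M.
Proof.
have sW := noise_W_sym.
split; apply: lemxP => //; try exact: symmx0; try exact: symmx_scalar.
  move=> x; have [i1 ->] := noise_W_qf x; rewrite qf0l; apply: ex_ge0 => om.
  by rewrite qf_rank1 sqr_ge0.
move=> x; have [i1 ->] := noise_W_qf x; rewrite -(ex_cst P (qf _ x)).
apply: ex_le => //; first exact: integ_cst.
by apply: filterS (bws 0) => om h; exact/lemx_qf/rank1_le.
Qed.

(** Both terms of the difference lie between 0 and [rw ^+ 2], so the bound is [rw ^+ 2] and not
    twice that; this is the constant in [betaW]. *)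
Lemma noise_dev_opb i : {ae P, forall om, opb (rw ^+ 2) (noise_dev i om)}.
Proof.
apply: filterS (bws i) => om h; have [W0 Wr] := noise_W_le.
have pw : psdmx (ws i om *m (ws i om)^T).
  split; first by rewrite /symmx trmx_mul trmxK.
  by move=> x; rewrite -/(qf _ _) qf_rank1 sqr_ge0.
apply: opb_lemx; [exact: sqr_ge0|exact: noise_dev_sym| |].
  have := psdD pw Wr; rewrite /lemx /noise_dev opprK => h'.
  by rewrite -addrA [- W + _]addrC.
have := lemxD (rank1_le h) W0; rewrite addr0.
by rewrite /lemx /noise_dev opprB addrA.
Qed.

Lemma svec_noise_fmeas i p : fmeas (sigma_of (ws i)) (fun om => svec (noise_dev i om) p 0) /\
  integ P (fun om => svec (noise_dev i om) p 0) /\ ex P (fun om => svec (noise_dev i om) p 0) = 0.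
Proof.
pose c : R := if (lowpos p).1 == (lowpos p).2 then 1 else Num.sqrt 2.
pose k := (lowpos p).1; pose l := (lowpos p).2.
have -> : (fun om => svec (noise_dev i om) p 0) =
    (fun om => c * (ws i om k 0 * ws i om l 0 - W k l)).
  apply/funext => om; rewrite mxE /c /k /l; case: (lowpos p) => a b /=.
  rewrite /noise_dev !mxE big_ord1 [X in _ * X]mxE.
  by case: eqP => _; rewrite ?mul1r.
have iw := integB (noise_mul_integ i k l) (integ_cst P (W k l)).
split; [|split; first exact: integZ]; last first.
  by rewrite exZ // exB ?ex_cst ?mws ?subrr ?mulr0 //; [exact: noise_mul_integ|exact: integ_cst].
pose g (w : 'cV[R]_nw) := c * (w k 0 * w l 0 - W k l).
apply: (@fmeas_comp_sigma_of _ _ _ _ (ws i) g).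
apply: measurable_funM; first exact: measurable_cst.
apply: measurable_funB; last exact: measurable_cst.
by apply: measurable_funM; exact: vspace_coord.
Qed.

Let Hm i om := hat_map M N (zs ^~ om) K i.
Let h i om := hat_norm M zs K N i om.
Let zh om := hat_zeta M zs K N om.

Lemma hat_norm_ge0 i om : 0 <= h i om.
Proof. exact: svec_map_norm_ge0. Qed.

Lemma hat_zeta_ge0 om : 0 <= zh om. Proof. exact: sqrtr_ge0. Qed.

Lemma hat_norm_le_zeta i om : (i < N)%N -> h i om <= zh om.
Proof.
move=> iN; rewrite -(ger0_norm (hat_norm_ge0 i om)) -sqrtr_sqr; apply: ler_wsqrtr.
rewrite (bigD1 (Ordinal iN)) //= lerDl; apply: sumr_ge0 => j _; exact: sqr_ge0.
Qed.

Variables (sgn L : R).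
Hypotheses (sgn1 : `|sgn| = 1) (L0 : 0 < L) (nw0 : (0 < nw)%N).

(** Makes the squared weights [b] sum to [L], or to 0 when [rw ^+ 2 * zh om = 0]. It is random, but
    a function of the regressors alone. *)
Let tau om := Num.sqrt L / (rw ^+ 2 * zh om).
Let B i om := (sgn * tau om) *: svec_map (Hm i om) (noise_dev i om).
Let b i om := tau om * (rw ^+ 2 * h i om).
(** All regressors, and the noise terms before [i]. *)
Let gens i : seq (nat + nat) := map inl (iota 0 N) ++ map inr (iota 0 i).
Let G i := [set A | exists2 j, j \in gens i & data_sigma j A].

Let tau_ge0 om : 0 <= tau om.
Proof.
apply: divr_ge0; first exact: sqrtr_ge0.
by apply: mulr_ge0; [exact: sqr_ge0|exact: hat_zeta_ge0].
Qed.

Let b_ge0 i om : 0 <= b i om.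
Proof.
by apply: mulr_ge0 => //; apply: mulr_ge0; [exact: sqr_ge0|exact: hat_norm_ge0].
Qed.

Let b_sum om : \sum_(i < N) b i om ^+ 2 <= L.
Proof.
have e : \sum_(i < N) b i om ^+ 2 = (tau om * (rw ^+ 2 * zh om)) ^+ 2.
  have -> : (tau om * (rw ^+ 2 * zh om)) ^+ 2 = (tau om * rw ^+ 2) ^+ 2 * zh om ^+ 2 by ring.
  rewrite /zh /hat_zeta sqr_sqrtr; last by apply: sumr_ge0 => i _; exact: sqr_ge0.
  rewrite mulr_sumr; apply: eq_bigr => i _; rewrite /b -exprMn; congr (_ ^+ 2).
  by rewrite mulrA.
rewrite e /tau; set c := rw ^+ 2 * _.
case: (eqVneq c 0) => [->|c0]; first by rewrite mulr0 expr0n ltW.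
by rewrite mulfVK // sqr_sqrtr // ltW.
Qed.

(** The maps [hat_map] are not bounded uniformly, since [gram_reg] may be nearly singular; the
    normalised ones are, which gives integrability. *)
Let tau_hat i om : (i < N)%N -> tau om * h i om <= Num.sqrt L / rw ^+ 2.
Proof.
move=> iN; have := hat_norm_le_zeta om iN; have := hat_norm_ge0 i om; rewrite /tau.
have s0 : 0 <= Num.sqrt L / rw ^+ 2 by apply: divr_ge0; [exact: sqrtr_ge0|exact: sqr_ge0].
case: (eqVneq (zh om) 0) => [-> h1 h2|z0 h1 h2].
  by rewrite mulr0 invr0 mulr0 mul0r.
have zp : 0 < zh om by rewrite lt0r z0 hat_zeta_ge0.
rewrite invfM mulrA -mulrA ler_piMr // mulrC ler_pdivrMr // mul1r //.
Qed.

Let gens_random i : let T' := g_sigma_algebraType (G i) in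
  (forall j, (j < N)%N -> @random_vector R _ T' _ (zs j)) /\
  (forall j, (j < i)%N -> @random_vector R _ T' _ (ws j)).
Proof.
split=> j jN A vA; apply: sub_sigma_algebra.
  exists (inl j); last by exists A => //; rewrite setTI.
  by rewrite mem_cat map_f // mem_iota.
exists (inr j); last by exists A => //; rewrite setTI.
by rewrite mem_cat orbC map_f // mem_iota.
Qed.

Let G_meas i : <<s G i >> `<=` measurable.
Proof.
apply: smallest_sub; first exact: sigma_algebra_measurable.
by move=> A [j _]; exact: data_sigma_measurable.
Qed.

Let tau_fmeas i : fmeas <<s G i >> tau.
Proof.
apply/fmeasP; have [rz _] := gens_random i.
apply: measurable_funM; first exact: measurable_cst.
apply: (measurableT_comp (f := @GRing.inv R)); first exact: measurable_inv.
by apply: measurable_funM; [exact: measurable_cst|exact: measurable_hat_zeta].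
Qed.

Let b_fmeas i j : (j < N)%N -> fmeas <<s G i >> (b j).
Proof.
move=> jN; apply/fmeasP; have [rz _] := gens_random i.
apply: measurable_funM; first exact: ((fmeasP (G i) tau).2 (@tau_fmeas i)).
by apply: measurable_funM; [exact: measurable_cst|exact: measurable_hat_norm].
Qed.

Let coef_fmeas i j (X : 'M[R]_nw) k l : (j < N)%N ->
  fmeas <<s G i >> (fun om => sgn * tau om * svec_map (Hm j om) X k l).
Proof.
move=> jN; apply/fmeasP; have [rz _] := gens_random i.
apply: measurable_funM.
  by apply: measurable_funM; [exact: measurable_cst|exact: ((fmeasP (G i) tau).2 (@tau_fmeas i))].
have mH := @mxmeas_hat_map _ _ _ _ M _ (g_sigma_algebraType (G i)) zs K N rz j jN.
exact: (mxmeas_svec_map mH (mxmeas_cst _)).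
Qed.

Let B_fmeas i j k l : (j < i)%N -> (j < N)%N -> fmeas <<s G i >> (fun om => B j om k l).
Proof.
move=> ji jN; apply/fmeasP; have [rz rw'] := gens_random i.
suff : @mxmeas R _ (g_sigma_algebraType (G i)) _ _ (B j) by exact.
apply: mxmeasZ.
  by apply: measurable_funM; [exact: measurable_cst|exact: ((fmeasP (G i) tau).2 (@tau_fmeas i))].
apply: mxmeas_svec_map.
  exact: (@mxmeas_hat_map _ _ _ _ M _ (g_sigma_algebraType (G i)) zs K N rz j jN).
have mw c := (@random_vectorP _ _ (g_sigma_algebraType (G i)) _ (ws j)).1 (rw' j ji) c.
move=> p q; rewrite (_ : (fun om => _) = fun om => ws j om p 0 * ws j om q 0 - W p q).
  by apply: measurable_funB; [apply: measurable_funM|exact: measurable_cst].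
by apply/funext => om; rewrite /noise_dev 2!mxE [X in _ + X]mxE big_ord1 [X in _ * X]mxE.
Qed.

(** After [svec_map_expand] each term is a factor measurable for [G i] times a centered coordinate
    of the noise, which is independent of [G i]. *)
Let B_mart i k l (A : T -> R) c : (i < N)%N -> fmeas <<s G i >> A ->
  {ae P, forall om, `|A om| <= c} -> ex P (fun om => A om * B i om k l) = 0.
Proof.
move=> iN fA bA.
pose X p : 'M[R]_nw := smat (delta_mx p 0).
pose Y p om := A om * (sgn * tau om * svec_map (Hm i om) (X p) k l).
pose u p om := svec (noise_dev i om) p 0.
have -> : (fun om => A om * B i om k l) = (fun om => \sum_p Y p om * u p om).
  apply/funext => om; rewrite /B mxE svec_map_expand summxE !mulr_sumr.
  by apply: eq_bigr => p _; rewrite mxE /Y /u; ring.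
have fY p : fmeas <<s G i >> (Y p).
  by apply/fmeasP; apply: measurable_funM; apply/fmeasP => //; exact: coef_fmeas.
have iY p : integ P (Y p).
  have s0 : 0 <= Num.sqrt L / rw ^+ 2 by apply: divr_ge0; [exact: sqrtr_ge0|exact: sqr_ge0].
  apply: (@integ_bound _ _ _ _ _ (c * (mxabs (X p) * (Num.sqrt L / rw ^+ 2)))).
    exact: (fmeas_measurable (@G_meas i) (fY p)).
  apply: filterS bA => om hA; rewrite /Y normrM; apply: ler_pM => //.
  rewrite (normrM (sgn * tau om)) (normrM sgn) sgn1 mul1r (ger0_norm (tau_ge0 om)).
  have hX : `|svec_map (Hm i om) (X p) k l| <= mxabs (X p) * h i om.
    apply: opb_entry; apply: opb_svec_map; [exact: smat_sym|exact: mxabs_ge0|exact: opb_mxabs].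
  apply: le_trans (ler_wpM2l (tau_ge0 om) hX) _.
  by rewrite mulrCA; apply: ler_wpM2l; [exact: mxabs_ge0|exact: tau_hat].
have ii : indep2 P <<s G i >> (sigma_of (ws i)).
  apply: (@indep_generated _ _ _ P _ data_sigma (gens i) (inr i)) => //.
  - exact: data_sigma_salg.
  - exact: data_sigma_measurable.
  rewrite mem_cat negb_or; apply/andP; split; apply/negP => /mapP[j hj] //.
  by case=> ij; move: hj; rewrite mem_iota -ij add0n ltnn andbF.
have yu p : integ P (fun om => Y p om * u p om) /\ ex P (fun om => Y p om * u p om) = 0.
  have [fu [iu eu]] := svec_noise_fmeas i p.
  have [h1 ->] := ex_indep (@G_meas i) (sigma_of_measurable (rws i)) ii (fY p) fu (iY p) iu.
  by rewrite eu mulr0.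
rewrite (ex_sum _ (F := fun p om => Y p om * u p om)); last by move=> p; exact: (yu p).1.
by rewrite big1 // => p _; exact: (yu p).2.
Qed.

(* When [rw ^+ 2 * zh om = 0] the weight [tau om] is the junk value [0], but then every
   summand vanishes almost surely. *)
Lemma noise_concentration : exists A, [/\ measurable A,
  ((1 - 3 / 2 * (nw%:R * expR (- (L / 2))))%:E <= P A)%E &
  forall om, A om -> lemx (sgn *: \sum_(i < N) svec_map (Hm i om) (noise_dev i om))
    (Num.sqrt L * (rw ^+ 2 * zh om))%:M].
Proof.
have hB i : {ae P, forall om, opb (rw ^+ 2 * h i om) (svec_map (Hm i om) (noise_dev i om))}.
  apply: filterS (noise_dev_opb i) => om ho.
  by apply: opb_svec_map => //; [exact: noise_dev_sym|exact: sqr_ge0].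
have [||||||||||A [mA PA hA]] := @matrix_hoeffding R d T P nw N L B b G => //.
- by move=> i om; apply: symmxZ; exact: smat_sym.
- move=> i iN k l; apply: (fmeas_measurable (@G_meas i.+1)); exact: B_fmeas.
- by move=> i j _ jN; exact: b_fmeas.
- by move=> i j k l /andP[ji iN]; apply: B_fmeas => //; exact: ltn_trans iN.
- move=> i iN; apply: filterS (hB i) => om ho.
  have -> : b i om = `|sgn * tau om| * (rw ^+ 2 * h i om).
    by rewrite (normrM sgn) sgn1 mul1r (ger0_norm (tau_ge0 om)).
  exact: opbZ.
have [A' [mA' PA' hA']] := event_ae mA (ae_foralln hB).
exists A'; split => //; first exact: le_trans PA'.
move=> om /hA'[/hA hom hz]; set S := \sum_(i < N) _.
have BS : \sum_(0 <= j < N) B j om = (sgn * tau om) *: S.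
  by rewrite big_mkord scaler_sumr.
case: (eqVneq (rw ^+ 2 * zh om) 0) => [z0|z0].
  have -> : S = 0.
    apply: big1 => i _; apply/matrixP => k l; rewrite [RHS]mxE; apply/eqP; rewrite -normr_le0.
    apply: le_trans (opb_entry _ _ (hz i)) _; rewrite -z0.
    by apply: ler_wpM2l; [exact: sqr_ge0|exact: hat_norm_le_zeta].
  by rewrite scaler0 z0 mulr0 raddf0; exact: lemx_refl.
have zp : 0 < rw ^+ 2 * zh om.
  by rewrite lt0r z0; apply: mulr_ge0; [exact: sqr_ge0|exact: hat_zeta_ge0].
have sp : 0 < Num.sqrt L by rewrite sqrtr_gt0.
have := lemxZ (ltW (divr_gt0 zp sp)) hom; rewrite BS scalerA scale_scalar_mx.
have -> : rw ^+ 2 * zh om / Num.sqrt L * (sgn * tau om) = sgn.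
  rewrite /tau; move: (rw ^+ 2 * zh om) (Num.sqrt L) zp sp => c s c0 s0.
  by field; rewrite !gt_eqF.
suff -> : rw ^+ 2 * zh om / Num.sqrt L * L = Num.sqrt L * (rw ^+ 2 * zh om) by [].
rewrite -{2}(sqr_sqrtr (ltW L0)); move: (Num.sqrt L) sp => s s0.
by field; rewrite gt_eqF.
Qed.

End Noise.

(** * Two-sided bounds for the upper covariance estimate *)

Section Estimator.
Context {R : realType} (nx nu nw : nat).
Variable M : 'I_nw -> 'M[R]_(nx, nx + nu).
Context {d : measure_display} {T : measurableType d} (P : probability T R).
Variables (xs : nat -> T -> 'cV[R]_nx) (zs : nat -> T -> 'cV[R]_(nx + nu)).
Variables (ws : nat -> T -> 'cV[R]_nw) (rz rw delta : R) (W : 'M[R]_nw).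
Hypothesis delta01 : 0 < delta < 1.
Hypothesis rzs : forall i, random_vector (zs i).
Hypothesis rws : forall i, random_vector (ws i).
Hypothesis lzs : forall i, same_law P P (zs i) (zs 0%N).
Hypothesis ind : independent P (data_sigma zs ws).
Hypothesis xsE : forall i om, xs i om = model_at M (zs i om) *m ws i om.
Hypothesis dzs : dominated_by_lebesgue P (zs 0%N).
Hypothesis bzs : forall i, {ae P, forall om, norm2 (zs i om) <= rz}.
Hypothesis bws : forall i, {ae P, forall om, norm2 (ws i om) <= rw}.
Hypothesis mws : forall i k l, ex P (fun om => ws i om k 0 * ws i om l 0) = W k l.

Let K := gram_kernel M P zs.

(* The part of [W] that the data can identify: replacing [W] by it changes neither the
   moment dynamics nor their adjoint, see [madj_identifiable]. *)
Definition identifiable : 'M[R]_nw := smat ((1%:M - K) *m svec W).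

Lemma zs_indep i j : i != j -> indep2 P (sigma_of (zs i)) (sigma_of (zs j)).
Proof.
move=> ij A B sA sB.
apply: (@indep_generated _ _ _ P _ (data_sigma zs ws) [:: inl i] (inl j)) => //.
- exact: data_sigma_salg.
- exact: data_sigma_measurable.
- by rewrite inE; apply: contra ij => /eqP[->].
by apply: sub_sigma_algebra; exists (inl i); rewrite ?inE.
Qed.

Lemma madj_identifiable S : symmx S -> madj M identifiable S = madj M W S.
Proof.
have sW := noise_W_sym mws; move=> sS.
have -> : identifiable = W - smat (K *m svec W).
  by rewrite /identifiable mulmxBl mul1mx (lin_B (@smat_linear R _)) smat_svec.
rewrite (lin_B (madj_linearW M S)) (gram_kernel_madj M rzs lzs bzs dzs sW sS).
exact: subr0.
Qed.

(** Each [hat_map] is of order 1 / N, so the root of the sum of N squares is of order 1 / sqrt N. *)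
Lemma hat_zeta_bound : exists2 c, 0 <= c & forall l, 0 < l -> forall N, (0 < N)%N ->
  {ae P, forall om, lemx (N%:R * l)%:M (gram_reg M N (zs ^~ om) K) ->
    hat_zeta M zs K N om <= c / l / Num.sqrt N%:R}.
Proof.
have [cg cg0 hg] := gram_entry_bounded M bzs; have [cn cn0 hn] := @svec_map_norm_bound R nw.
pose s2 : R := (sdim nw)%:R * (sdim nw)%:R.
have s20 : 0 <= s2 by apply: mulr_ge0.
exists (cn * (s2 * cg)); first by apply: mulr_ge0 => //; exact: mulr_ge0.
move=> l l0 N N0; have NR : 0 < N%:R :> R by rewrite ltr0n.
apply: filterS (ae_foralln hg) => om hgo reg.
have sG : symmx (gram_reg M N (zs ^~ om) K).
  rewrite /symmx /gram_reg linearD linearZ /= kproj_sym linear_sum /=; congr (_ + _).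
  by apply: eq_bigr => i _; exact: gram_at_sym.
have ho := invmx_opb (mulr_gt0 NR l0) sG reg.
have Nl : 0 <= (N%:R * l)^-1 by rewrite invr_ge0; apply/ltW/mulr_gt0.
have hh i : hat_norm M zs K N i om <= cn * (s2 * cg) / l / N%:R.
  apply: le_trans (hn _) _; have -> : cn * (s2 * cg) / l / N%:R = cn * (s2 * (N%:R * l)^-1 * cg) by rewrite invfM; ring.
  apply: ler_wpM2l => //; apply: le_trans (mxabsM _ _) _.
  apply: ler_pM; [exact: mxabs_ge0|exact: mxabs_ge0| |exact: hgo].
  by apply: le_trans (mxabs_opnorm2 _) _; apply: ler_wpM2l => //; exact: opnorm2_le.
set q := cn * (s2 * cg) / l in hh *.
have q0 : 0 <= q.
  by apply: divr_ge0; [apply: mulr_ge0 => //; exact: mulr_ge0|exact: ltW].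
have sq : 0 < Num.sqrt N%:R :> R by rewrite sqrtr_gt0.
have -> : q / Num.sqrt N%:R = Num.sqrt (N%:R * (q / N%:R) ^+ 2).
  have -> : N%:R * (q / N%:R) ^+ 2 = (q / Num.sqrt N%:R) ^+ 2.
    rewrite -{1 2}(sqr_sqrtr (ltW NR)); field; rewrite gt_eqF //.
  by rewrite sqrtr_sqr ger0_norm //; apply: divr_ge0 => //; exact: ltW.
apply: ler_wsqrtr; apply: (@le_trans _ _ (\sum_(i < N) (q / N%:R) ^+ 2)).
  apply: ler_sum => i _; rewrite lerXn2r ?nnegrE ?hat_norm_ge0 //.
  by apply: divr_ge0 => //; exact: ltW.
by rewrite sumr_const card_ord mulr_natl.
Qed.

Lemma betaW_ge0 N zs' : 0 <= betaW M N zs' rw delta.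
Proof.
by apply: mulr_ge0; [apply: mulr_ge0; [exact: sqr_ge0|exact: sqrtr_ge0]|exact: sqrtr_ge0].
Qed.

Lemma lemx_dim0 (A B : 'M[R]_nw) : nw = 0%N -> lemx A B.
Proof.
move=> n0; have no (i : 'I_nw) : False by have := leq_ltn_trans (leq0n i) (ltn_ord i); rewrite n0.
split; first by apply/matrixP => i; case: (no i).
by move=> x; rewrite mxE big1 // => i; case: (no i).
Qed.

Lemma lemx_scalar n (a b : R) : a <= b -> lemx (a%:M : 'M[R]_n) b%:M.
Proof. by move=> ab; rewrite /lemx -raddfB; apply: psd_scalar; rewrite subr_ge0. Qed.

Lemma exp_log_level c : 0 < c -> (0 < nw)%N ->
  let L := 2 * ln (c * nw%:R / delta) in
  3 / 2 * (nw%:R * expR (- (L / 2))) = 3 / 2 / c * delta.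
Proof.
have /andP[d0 _] := delta01; move=> c0 n0 L.
have nR : 0 < nw%:R :> R by rewrite ltr0n.
have p : 0 < c * nw%:R / delta by apply: divr_gt0 => //; exact: mulr_gt0.
rewrite (_ : L / 2 = ln (c * nw%:R / delta)); last by rewrite /L mulrAC mulfV // mul1r.
rewrite expRN lnK ?posrE //; field; rewrite !gt_eqF //.
Qed.

Lemma log_level_gt0 c : 2 <= c -> (0 < nw)%N -> 0 < 2 * ln (c * nw%:R / delta).
Proof.
have /andP[d0 d1] := delta01; move=> c2 n0.
have nR : 1 <= nw%:R :> R by rewrite ler1n.
apply: mulr_gt0 => //; apply: ln_gt0; rewrite ltr_pdivlMr // mul1r.
by apply: lt_le_trans d1 _; apply: le_trans (_ : 1 * 1 <= _); [lra|apply: ler_pM => //; lra].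
Qed.

Lemma estimation_event : exists c N0, 0 <= c /\ forall N, (N0 <= N)%N ->
  exists A, [/\ measurable A, ((1 - delta)%:E <= P A)%E & forall om, A om ->
    let Wup := Wupper M N (xs ^~ om) (zs ^~ om) rw delta in
    lemx identifiable Wup /\ lemx Wup (identifiable + (c / Num.sqrt N%:R)%:M)].
Proof.
have /andP[d0 d1] := delta01.
have [n0|n0] := posnP nw.
  exists 0, 0%N; split => // N _; exists setT; split => //.
    by rewrite probability_setT lee_fin; lra.
  by move=> om _ Wup; split; exact: lemx_dim0.
have [cz cz0 hz] := hat_zeta_bound.
have [l l0 hl] := gram_lln M rzs lzs zs_indep bzs.
(* By [exp_log_level] the levels 2 and 12 below fail with probability at most 3/4 and 1/8 of
   [delta], so this event may take 1/8. *)
have [N0 hN0] := hl (delta / 8) ltac:(lra).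
pose L1 := 2 * ln (2 * nw%:R / delta); pose L2 := 2 * ln (12 * nw%:R / delta).
have L10 : 0 < L1 by apply: log_level_gt0.
have L20 : 0 < L2 by apply: log_level_gt0 => //; rewrite ler_nat.
have sL1 : 0 <= Num.sqrt L1 by exact: sqrtr_ge0.
have sL2 : 0 <= Num.sqrt L2 by exact: sqrtr_ge0.
have r20 : 0 <= rw ^+ 2 by exact: sqr_ge0.
pose c := (Num.sqrt L1 + Num.sqrt L2) * (rw ^+ 2 * (cz / l)).
exists c, (maxn 1 N0); split.
  apply: mulr_ge0; first exact: addr_ge0.
  by apply: mulr_ge0 => //; apply: divr_ge0 => //; exact: ltW.
move=> N; rewrite geq_max => /andP[N1 NN].
have [A0 [mA0 PA0 hA0]] := hN0 N NN.
(* The sign -1 at the level of [betaW] bounds the error from below by [- betaW]; the sign 1 at the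
   larger level bounds it from above. *)
have [A1 [mA1 PA1 hA1]] := noise_concentration M K N rzs rws ind bws mws (normrN1 R) L10 n0.
have [A2 [mA2 PA2 hA2]] := noise_concentration M K N rzs rws ind bws mws (normr1 R) L20 n0.
rewrite (exp_log_level _ n0) // in PA1; rewrite (exp_log_level _ n0) // in PA2.
have [mA01 PA01] := eventI mA0 mA1 PA0 PA1.
have [mA012 PA012] := eventI mA01 mA2 PA01 PA2.
have aeg := gram_kernel_ae M rzs lzs bzs.
have [A [mA PA hA]] := event_ae mA012 (filterI aeg (hz l l0 N N1)).
exists A; split => //.
  apply: le_trans PA; apply: le_trans PA012; rewrite lee_fin lerD2l lerN2.
  by rewrite le_eqVlt; apply/orP; left; apply/eqP; field.
move=> om /hA[[[/hA0 reg /hA1 S1] /hA2 S2] [gK /(_ reg) hzeta]] Wup.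
have sG : symmx (gram_reg M N (zs ^~ om) K).
  rewrite /symmx /gram_reg linearD linearZ /= kproj_sym linear_sum /=; congr (_ + _).
  by apply: eq_bigr => i _; exact: gram_at_sym.
have NR : 0 < N%:R :> R by rewrite ltr0n.
have uG := pd_unit (pd_of_ge (mulr_gt0 NR l0) sG reg).
have kS := kproj_sym (mean_gram M P zs); have kI := kproj_idem (mean_gram M P zs).
have gK' i (iN : (i < N)%N) := gK i.
have err := @estimation_error _ _ _ _ M N (xs ^~ om) (zs ^~ om) (ws ^~ om) K (fun i => xsE i om) N1 kS kI gK' uG W (noise_W_sym mws).
have zE := @zeta_hat_map _ _ _ _ M N (zs ^~ om) K N1 kS kI gK' uG.
set S := \sum_(i < N) _ in S1 S2 err.
have bE : betaW M N (zs ^~ om) rw delta =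
    Num.sqrt L1 * (rw ^+ 2 * hat_zeta M zs K N om).
  by rewrite /betaW zE mulrC.
have WE : Wup = identifiable + (S + (betaW M N (zs ^~ om) rw delta)%:M).
  by rewrite /Wup /Wupper addrA; congr (_ + _); rewrite -err addrC subrK.
split.
  rewrite WE; apply: lemx_addr; move: S1; rewrite bE scaleN1r /lemx opprK.
  by rewrite addrC.
rewrite WE; apply: lemxD; first exact: lemx_refl.
apply: (lemx_trans (B := (Num.sqrt L2 * (rw ^+ 2 * hat_zeta M zs K N om))%:M +
  (Num.sqrt L1 * (rw ^+ 2 * hat_zeta M zs K N om))%:M)).
  by rewrite bE; apply: lemxD; [rewrite -[S]scale1r|exact: lemx_refl].
rewrite -raddfD /=; apply: lemx_scalar.
move: hzeta {hA0 hA1 hA2 PA PA01 PA012}; rewrite /c; move: (hat_zeta M zs K N om) => z hzeta.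
have -> : (Num.sqrt L1 + Num.sqrt L2) * (rw ^+ 2 * (cz / l)) / Num.sqrt N%:R =
  (Num.sqrt L2 + Num.sqrt L1) * (rw ^+ 2 * (cz / l / Num.sqrt N%:R)) by ring.
rewrite -mulrDl; apply: ler_wpM2l; first exact: addr_ge0.
exact: ler_wpM2l.
Qed.

End Estimator.

(** * Optimality gap *)

(** The finite bounds on both sides exclude infinite values of the difference. *)
Lemma ereal_gap (R : realType) (cost val : \bar R) (a k : R) :
  (a%:E <= val -> val <= cost -> cost <= (a + k)%:E -> `|cost - val| <= k%:E)%E.
Proof.
move: cost val => [c||] [w||] //=; rewrite ?leye_eq ?leeNy_eq //.
by rewrite !lee_fin => h1 h2 h3; rewrite ger0_norm; lra.
Qed.

Lemma posnoise_of_lemx (R : realType) (nx nu nw : nat) (M : 'I_nw -> 'M[R]_(nx, nx + nu))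
    (W W' : 'M[R]_nw) : posnoise M W -> symmx W' ->
  (forall S, psdmx S -> lemx (madj M W S) (madj M W' S)) -> posnoise M W'.
Proof. by move=> [_ pW] sW' h; split => // S pS; apply: lemx_psd (pW _ pS) (h _ pS). Qed.

Section Main.
Context (R : realType) (nx nu nv nw : nat) (M : 'I_nw -> 'M[R]_(nx, nx + nu)).
Variables (At : 'I_nv -> 'M[R]_nx) (Bt : 'I_nv -> 'M[R]_(nx, nu)).
Variables (Qx : 'M[R]_nx) (Ru : 'M[R]_nu) (rw delta : R).
Context (d : measure_display) (T : measurableType d) (P : probability T R).
Variables (x0 : T -> 'cV[R]_nx) (v : nat -> T -> 'cV[R]_nv).
Context (d' : measure_display) (D : measurableType d') (PD : probability D R).
Variables (xs : nat -> D -> 'cV[R]_nx) (zs : nat -> D -> 'cV[R]_(nx + nu)).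
Variables (ws : nat -> D -> 'cV[R]_nw) (rz : R).

Let w om := disturbance M At Bt (v 0%N om).
Let Wst := second_moment P w.
Let X0 := second_moment P x0.
Let Wup N om := Wupper M N (xs ^~ om) (zs ^~ om) rw delta.
Let Wlo N om := Wlower M N (xs ^~ om) (zs ^~ om) rw delta.

Hypothesis delta01 : 0 < delta < 1.
Hypothesis pdH : pdmx (block_mx Qx 0 0 Ru).
Hypothesis rv : forall t, random_vector (v t).
Hypothesis bv0 : {ae P, forall om, norm2 (w om) <= rw}.
Hypothesis rzs : forall i, random_vector (zs i).
Hypothesis rws : forall i, random_vector (ws i).
Hypothesis lzs : forall i, same_law PD PD (zs i) (zs 0%N).
Hypothesis lws : forall i, same_law PD P (ws i) w.
Hypothesis ind : independent PD (data_sigma zs ws).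
Hypothesis xsE : forall i om, xs i om = model_at M (zs i om) *m ws i om.
Hypothesis dzs : dominated_by_lebesgue PD (zs 0%N).
Hypothesis bzs : forall i, {ae PD, forall om, norm2 (zs i om) <= rz}.

Lemma disturbance_random : random_vector w.
Proof.
by apply/random_vectorP => k; apply: (fmeas_measurable (sigma_of_measurable (rv 0))); exact: fmeas_dist.
Qed.

Lemma sample_law i : same_law P PD w (ws i).
Proof. by move=> A vA; rewrite lws. Qed.

Lemma sample_bound i : {ae PD, forall om, norm2 (ws i om) <= rw}.
Proof.
apply: (law_ae_le disturbance_random (rws i) (sample_law i) _ bv0).
by apply: measurable_norm2 => j; exact: vspace_coord.
Qed.

Lemma sample_second_moment i k l : ex PD (fun om => ws i om k 0 * ws i om l 0) = Wst k l.
Proof.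
pose f (x : 'cV[R]_nw) := x k 0 * x l 0.
have mf : measurable_fun setT (f : vspace nw -> R).
  by apply: measurable_funM; exact: vspace_coord.
have iw : integ P (fun om => f (w om)).
  apply: (@integ_bound _ _ _ _ _ (rw * rw)).
    exact: (measurable_comp_vector disturbance_random mf).
  apply: filterS bv0 => om h; rewrite normrM; apply: ler_pM => //.
    exact: le_trans (norm2_entry _ _) h.
  exact: le_trans (norm2_entry _ _) h.
have [_ e] := law_ex disturbance_random (rws i) (sample_law i) mf iw.
by rewrite [LHS]e second_momentE.
Qed.

(** Joins the estimation event to [perturbation_bound] with [e = c / Num.sqrt N%:R]. Neither cost
    functional enters yet, so both parts of the theorem share this event. *)
Lemma controller_event : exists (Pst : 'M[R]_nx) C N0,
  [/\ psdmx Pst, lemx (block_mx Pst 0 0 0) (block_mx Qx 0 0 Ru + madj M Wst Pst) &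
    forall N, (N0 <= N)%N -> with_probability_at_least PD (1 - delta) [set om |
      dr_stabilizable M (Wlo N om) (Wup N om) ->
      (exists K, is_dr_controller M Qx Ru (Wup N om) K) /\
      forall K, is_dr_controller M Qx Ru (Wup N om) K -> exists U,
        [/\ psdmx U, lemx (Jmap M Qx Ru Wst K U) U & lemx U (Pst + (C / N%:R)%:M)]]].
Proof.
have pW := W_posnoise rv bv0; rewrite -/w -/Wst in pW.
have [Pst [C [e0 [pP HJB C0 e00 hpert]]]] := perturbation_bound pdH pW.
have [c [N0 [c0 hest]]] := estimation_event delta01 rzs rws lzs ind xsE bzs sample_bound sample_second_moment.
(* From [N1] on, [c / Num.sqrt N%:R] is within the range [e0] of the perturbation bound. *)
pose N1 := (Num.truncn ((c / e0) ^+ 2)).+1.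
exists Pst, (C * c ^+ 2), (maxn N0 N1); split => // N; rewrite geq_max => /andP[NN0 NN1].
have NR : 0 < N%:R :> R by rewrite ltr0n; apply: leq_trans NN1.
have sN : 0 < Num.sqrt N%:R :> R by rewrite sqrtr_gt0.
have [A [mA PA hA]] := hest N NN0; exists A; split => // om /hA[lo up] stab.
set e := c / Num.sqrt N%:R in up.
have e_ge0 : 0 <= e by apply: divr_ge0 => //; exact: ltW.
have e_le : e <= e0.
  rewrite /e ler_pdivrMr // mulrC -ler_pdivrMr // -[c / e0]ger0_norm; last first.
    by apply: divr_ge0 => //; exact: ltW.
  rewrite -sqrtr_sqr; apply: ler_wsqrtr; apply: ltW.
  by apply: lt_le_trans (truncnS_gt _) _; rewrite ler_nat.
have e2 : C * e ^+ 2 = C * c ^+ 2 / N%:R by rewrite /e expr_div_n sqr_sqrtr ?mulrA // ltW.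
have sup : symmx (Wup N om) by apply: symmxD; [exact: smat_sym|exact: symmx_scalar].
(* Transfers order bounds against the identifiable part to the true covariance, at the level of
   adjoint maps. *)
have mid S : psdmx S -> madj M (identifiable M PD zs Wst) S = madj M Wst S.
  by move=> pS; apply: (madj_identifiable M rzs lzs dzs bzs sample_second_moment); exact: psd_sym.
have hlo S : psdmx S -> lemx (madj M Wst S) (madj M (Wup N om) S).
  move=> pS; rewrite -mid // /lemx -(lin_B (madj_linearW M S)).
  exact: madj_psd.
have hup S : psdmx S -> lemx (madj M (Wup N om) S) (madj M Wst S + e *: madj M 1%:M S).
  move=> pS; rewrite -mid // -(lin_Z e (madj_linearW M S)) -(lin_D (madj_linearW M S)).
  rewrite /lemx -(lin_B (madj_linearW M S)) scalemx1.
  exact: madj_psd.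
(* The robust hypothesis is applied at the upper end of the interval, which belongs to it because
   [betaW] is nonnegative. *)
have stab' : stabilizable M (Wup N om).
  have [K hK] := stab; apply: (@stabilizable_of_radius _ _ _ _ _ _ K).
    exact: posnoise_of_lemx hlo.
  apply: hK => //; last exact: lemx_refl.
  apply: lemxD; first exact: lemx_refl.
  have b0 := betaW_ge0 M rw delta N (zs ^~ om).
  rewrite /lemx opprK -raddfD; apply: psd_scalar; exact: addr_ge0.
have [ctrl hU] := hpert (Wup N om) e sup e_ge0 e_le hlo hup stab'.
by split => // K /hU[U [pU JU hUP]]; exists U; split => //; rewrite -e2.
Qed.

(** Abstracts what the two problems have in common: Bellman subsolutions bound the value from below,
    feedback is feasible, and supersolutions bound its cost from above. *)
Lemma cost_gap_event (val : \bar R) (cost : 'M[R]_(nu, nx) -> \bar R) : psdmx X0 ->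
  (forall S, psdmx S -> lemx (block_mx S 0 0 0) (block_mx Qx 0 0 Ru + madj M Wst S) ->
    ((\tr (S *m X0))%:E <= val)%E) ->
  (forall K, (val <= cost K)%E) ->
  (forall K U, psdmx U -> lemx (Jmap M Qx Ru Wst K U) U -> (cost K <= (\tr (U *m X0))%:E)%E) ->
  exists (C : R) (N0 : nat), forall N, (N0 <= N)%N ->
    with_probability_at_least PD (1 - delta) [set om |
      dr_stabilizable M (Wlo N om) (Wup N om) ->
      (exists K, is_dr_controller M Qx Ru (Wup N om) K) /\
      forall K, is_dr_controller M Qx Ru (Wup N om) K ->
        (`| cost K - val | <= (C / N%:R)%:E)%E].
Proof.
move=> pX0 hval hle hcost; have [Pst [C [N0 [pP HJB hN]]]] := controller_event.
exists (C * \tr X0), N0 => N /hN[A [mA PA hA]]; exists A; split => // om /hA h /h[ctrl hU].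
split => // K /hU[U [pU JU hUP]].
apply: (ereal_gap (hval _ pP HJB) (hle K)); apply: le_trans (hcost K U pU JU) _.
rewrite lee_fin; apply: le_trans (mxtrace_lemxM hUP pX0) _.
by rewrite mulmxDl mxtraceD mul_scalar_mx mxtraceZ mulrAC.
Qed.

End Main.

Theorem mainTheorem6 (R : realType) (nx nu nv nw : nat)
  (M : 'I_nw -> 'M[R]_(nx, nx + nu))
  (At : 'I_nv -> 'M[R]_nx) (Bt : 'I_nv -> 'M[R]_(nx, nu))
  (Qx : 'M[R]_nx) (Ru : 'M[R]_nu) (rw delta : R)
  (* the true system: initial state and multiplicative noise *)
  (d : measure_display) (T : measurableType d) (P : probability T R)
  (x0 : T -> 'cV[R]_nx) (v : nat -> T -> 'cV[R]_nv)
  (* the data: sample i is (xs i, zs i), with xs i = M(zs i) (ws i) *)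
  (d' : measure_display) (D : measurableType d') (PD : probability D R)
  (xs : nat -> D -> 'cV[R]_nx) (zs : nat -> D -> 'cV[R]_(nx + nu))
  (ws : nat -> D -> 'cV[R]_nw) :
  0 < delta < 1 ->
  \rank (unfold3 M) = nw ->
  \rank (col_mx (unfold3 M) (unfold3 (fun i => row_mx (At i) (Bt i)))) = nw ->
  pdmx (block_mx Qx 0 0 Ru) ->
  random_vector x0 -> square_integrable P x0 ->
  (forall t, random_vector (v t)) ->
  (forall t, same_law P P (v t) (v 0%N)) ->
  independent P
    (fun i : option nat => if i is Some t then sigma_of (v t)
                           else sigma_of x0) ->
  {ae P, forall om, norm2 (disturbance M At Bt (v 0%N om)) <= rw} ->
  (forall i, random_vector (zs i)) ->
  (forall i, random_vector (ws i)) ->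
  (forall i, same_law PD PD (zs i) (zs 0%N)) ->
  (forall i, same_law PD P (ws i)
     (fun om => disturbance M At Bt (v 0%N om))) ->
  independent PD
    (fun i : nat + nat => match i with
                          | inl j => sigma_of (zs j)
                          | inr j => sigma_of (ws j)
                          end) ->
  (forall i om, xs i om = model_at M (zs i om) *m ws i om) ->
  dominated_by_lebesgue PD (zs 0%N) ->
  (exists rz : R, forall i, {ae PD, forall om, norm2 (zs i om) <= rz}) ->
  let X0 := second_moment P x0 in
  let Wstar := second_moment P (fun om => disturbance M At Bt (v 0%N om)) in
  let xdata om i := xs i om in
  let zdata om i := zs i om in
  let Wlo N om := Wlower M N (xdata om) (zdata om) rw delta in
  let Wup N om := Wupper M N (xdata om) (zdata om) rw delta in
  (exists (C : R) (N0 : nat), forall N, (N0 <= N)%N ->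
    with_probability_at_least PD (1 - delta) [set om |
      dr_stabilizable M (Wlo N om) (Wup N om) ->
      (exists K, is_dr_controller M Qx Ru (Wup N om) K) /\
      forall K, is_dr_controller M Qx Ru (Wup N om) K ->
        (`| moment_cost Qx Ru (closed_loop_moments M Wstar X0 K)
            - val_LQRcp M Qx Ru Wstar X0 | <= (C / N%:R)%:E)%E])
  /\
  (exists (C : R) (N0 : nat), forall N, (N0 <= N)%N ->
    with_probability_at_least PD (1 - delta) [set om |
      dr_stabilizable M (Wlo N om) (Wup N om) ->
      (exists K, is_dr_controller M Qx Ru (Wup N om) K) /\
      forall K, is_dr_controller M Qx Ru (Wup N om) K ->
        (`| slqr_cost P At Bt Qx Ru x0 v (feedback_input At Bt x0 v K)
            - val_SLQR P At Bt Qx Ru x0 v | <= (C / N%:R)%:E)%E]).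
Proof.
move=> delta01 rkM rkMV pdH rx0 sx0 rv lv iv bv0 rzs rws lzs lws ind xsE dzs [rz bzs].
move=> X0 Wstar xdata zdata Wlo Wup.
have pX0 : psdmx X0 := X0psd rx0 sx0.
have pW : posnoise M Wstar := W_posnoise rv bv0.
split.
  apply: (cost_gap_event delta01 pdH rv bv0 rzs rws lzs lws ind xsE dzs bzs pX0
    (cost := fun K => moment_cost Qx Ru (closed_loop_moments M Wstar X0 K))).
  - move=> S pS HJB; apply: le_ereal_inf_tmp => _ [Z feas <-].
    exact: (moment_cost_ge pdH pW pS HJB feas).
  - move=> K; apply: ereal_inf_lbound; exists (closed_loop_moments M Wstar X0 K) => //.
    exact: closed_loop_feasible.
  - by move=> K U pU JU; exact: moment_cost_closed_loop_le.
apply: (cost_gap_event delta01 pdH rv bv0 rzs rws lzs lws ind xsE dzs bzs pX0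
  (cost := fun K => slqr_cost P At Bt Qx Ru x0 v (feedback_input At Bt x0 v K))).
- move=> S pS HJB; apply: le_ereal_inf_tmp => _ [u adm <-].
  exact: (slqr_cost_ge rkM rkMV pdH rx0 rv lv bv0 pS HJB adm).
- move=> K; apply: ereal_inf_lbound; exists (feedback_input At Bt x0 v K) => //.
  exact: (feedback_admissible rkM rkMV rx0 rv iv).
- move=> K U pU JU; rewrite (slqr_cost_feedback rkM rkMV pdH rx0 sx0 rv lv iv bv0).
  exact: moment_cost_closed_loop_le.
Qed.
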